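(* Let $\Phi=\{x_i\}$ be a homogeneous Poisson point process on $\mathbb{R}^2$ with intensity $\lambda>0$, let $x\in\mathbb{R}^2$ be a receiver, let $\alpha>2$ and let $0<\phi\le 2\pi$. Each point $x_i$ carries a channel gain $h_i\ge0$, the $h_i$ i.i.d. with PDF $f_h$, independent of $\Phi$, with $\bar h_{2/\alpha}:=E[h^{2/\alpha}]<\infty$. Let $\Phi'=\{x_i\in\Phi:\angle\overrightarrow{x x_i}\le\phi\}$ (angle of $x_i-x$ w.r.t. the horizontal axis, in $[0,2\pi)$), and let $z_1<z_2<\cdots$ be the values $\|x_i-x\|^{\alpha}/h_i$, $x_i\in\Phi'$, in increasing order. For $n\ge1$ define the partial accumulative interference $\mathcal{I}(n)=\sum_{k=n+1}^\infty z_k^{-1}$. Then for every $s>0$, $$\mathcal{L}_{\mathcal{I}(n)}(s\mid z_n):=E\left[e^{-s\mathcal{I}(n)}\,\middle|\,z_n\right]=\exp\left\{\frac{\phi\lambda}{\alpha}\bar h_{2/\alpha}\,q_{z_n}(s)\right\},$$ where $q_{z_n}(s)=s^{2/\alpha}\gamma\left(-\frac{2}{\alpha},\frac{s}{z_n}\right)+\frac{\alpha}{2}z_n^{2/\alpha}$.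
   Context: For $a>0$, $\gamma(a,b)=\int_0^b t^{a-1}e^{-t}\,dt$ is the lower incomplete gamma function; for $a=-2/\alpha\in(-1,0)$, $\gamma(a,b)$ denotes its analytic continuation $\gamma(a,b)=\Gamma(a)-\Gamma(a,b)$, equivalently $\gamma(a,b)=\int_0^b t^{a-1}(e^{-t}-1)\,dt+\frac{b^a}{a}$, where $\Gamma(a,b)=\int_b^\infty t^{a-1}e^{-t}dt$. *)

(* Defs.v *)
From HB Require Import structures.
From mathcomp Require Import all_boot all_order all_algebra.
From mathcomp Require Import all_classical all_reals all_analysis.
Set Implicit Arguments. Unset Strict Implicit. Unset Printing Implicit Defensive.
Import Order.TTheory GRing.Theory Num.Theory.
Import numFieldNormedType.Exports.
Local Open Scope classical_set_scope.
Local Open Scope ring_scope.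

Section Defs.
Variable R : realType.

Definition norm2 (v : R * R) : R := Num.sqrt (v.1 ^+ 2 + v.2 ^+ 2).

Definition angle2 (v : R * R) : R :=
  if 0 <= v.2 then acos (v.1 / norm2 v) else 2 * pi - acos (v.1 / norm2 v).

Definition leb2 := ((@lebesgue_measure R) \x (@lebesgue_measure R))%E.

Definition bounded2 (A : set (R * R)) : Prop :=
  exists M : R, forall p, A p -> `|p.1| <= M /\ `|p.2| <= M.

Definition poisson_prob (mu : R) (k : nat) : R :=
  expR (- mu) * mu ^+ k / (k`!)%:R.

Definition count_in {Omega : Type} (X : nat -> Omega -> R * R)
  (w : Omega) (A : set (R * R)) : \bar R :=
  (\sum_(i <oo) (if `[< A (X i w) >] then (1 : \bar R) else 0))%E.

(* Homogeneous PPP of intensity lam on R^2, given by an injective enumeration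
   X of its points: finite-dimensional distributions of the counts on disjoint
   bounded Borel sets are independent Poisson(lam |A|). *)
Definition is_homogeneous_PPP {d : measure_display} {Omega : measurableType d}
  (P : probability Omega R) (lam : R) (X : nat -> Omega -> R * R) : Prop :=
  (forall i, measurable_fun setT (X i)) /\
  (forall w, injective (X ^~ w)) /\
  forall (m : nat) (A : 'I_m -> set (R * R)) (k : 'I_m -> nat),
    (forall j, measurable (A j) /\ bounded2 (A j)) ->
    (forall j j', j != j' -> A j `&` A j' = set0) ->
    P [set w | forall j, count_in X w (A j) = ((k j)%:R)%:E] =
    (\prod_(j < m) poisson_prob (lam * fine (leb2 (A j))) (k j))%:E.

(* marks H i.i.d. with Lebesgue density f, and independent of the points X
   (independence of sigma(X) and sigma(H) stated on generating pi-systems) *)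
Definition iid_marks_indep {d : measure_display} {Omega : measurableType d}
  (P : probability Omega R) (f : R -> R) (X : nat -> Omega -> R * R)
  (H : nat -> Omega -> R) : Prop :=
  (forall i, measurable_fun setT (H i)) /\
  forall (m : nat) (J : 'I_m -> nat) (C : 'I_m -> set (R * R))
         (m' : nat) (I : 'I_m' -> nat) (B : 'I_m' -> set R),
    injective I -> (forall j, measurable (C j)) -> (forall i, measurable (B i)) ->
    P [set w | (forall j, C j (X (J j) w)) /\ (forall i, B i (H (I i) w))] =
    (P [set w | forall j, C j (X (J j) w)] *
     (\prod_(i < m') Rintegral (@lebesgue_measure R) (B i) f)%:E)%E.

Definition zval (x : R * R) (alpha : R) (p : R * R) (h : R) : \bar R :=
  if h == 0 then +oo%E else (norm2 (p.1 - x.1, p.2 - x.2) `^ alpha / h)%:E.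

Definition in_sector (x : R * R) (phi : R) (p : R * R) : bool :=
  angle2 (p.1 - x.1, p.2 - x.2) <= phi.

(* n-th smallest value z_n (counted with multiplicity) among points of Phi' *)
Definition z_order {Omega : Type} (X : nat -> Omega -> R * R)
  (H : nat -> Omega -> R) (x : R * R) (alpha phi : R) (n : nat) (w : Omega) : R :=
  inf [set t : R | (n%:R%:E <=
     \sum_(i <oo) (if in_sector x phi (X i w) &&
                      (zval x alpha (X i w) (H i w) <= t%:E)%E
                   then (1 : \bar R) else 0))%E].

Definition interf {Omega : Type} (X : nat -> Omega -> R * R)
  (H : nat -> Omega -> R) (x : R * R) (alpha phi : R) (n : nat) (w : Omega)
  : \bar R :=
  (\sum_(i <oo)
     (if in_sector x phi (X i w) &&
         ((z_order X H x alpha phi n w)%:E < zval x alpha (X i w) (H i w))%E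
      then (H i w / norm2 ((X i w).1 - x.1, (X i w).2 - x.2) `^ alpha)%:E
      else 0))%E.

Definition expNE (s : R) (I : \bar R) : R :=
  if I is r%:E then expR (- s * r) else 0.

(* analytic continuation of the lower incomplete gamma, for a in (-1,0) *)
Definition lgamma_cont (a b : R) : R :=
  Rintegral (@lebesgue_measure R) `]0, b]
    (fun t => t `^ (a - 1) * (expR (- t) - 1)) + b `^ a / a.

Definition q_fun (alpha z s : R) : R :=
  s `^ (2 / alpha) * lgamma_cont (- (2 / alpha)) (s / z)
  + alpha / 2 * z `^ (2 / alpha).

End Defs.

(* Main.v *)
(** Give each point [x_i] of the process its mark [h_i]; the resulting process
on the plane times the line is Poisson with intensity [lam] Lebesgue x law of
[h], with generating functional [E prod_i v(x_i, h_i) = exp(-lam int (1 - v))].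
The image of the sector points under [z = |x_i - x|^alpha / h_i] has mean
measure [phi / 2 * E h^(2/alpha) * a^(2/alpha)] on [0, a[, and a layer-cake
computation turns [int (1 - e^(-s/z))] over [z >= b] into
[- phi / alpha * E h^(2/alpha) * q_b(s)].  Evaluating the functional at
[v = theta] on [z < a] and [v = e^(-s/z)] on [z >= b] shows, by comparing the
powers of [theta], that the number of [z_i] below [a] is independent of
[Y_b], the product of the [e^(-s/z_i)] over [z_i >= b], as soon as [a <= b].
The event [a <= z_n < b] holds when fewer than [n] of the [z_i] are below [a]
but not below [b], so
[E (Y_b ; a <= z_n < b) = E Y_b * P (a <= z_n < b)].
Summing over a dyadic grid, with [b] the grid point just above [z_n], and
refining the grid gives the conditional expectation, because [Y_b] decreases
to [e^(-s I(n))] as [b] decreases to [z_n]. *)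
Require Import Defs.
From HB Require Import structures.
From mathcomp Require Import all_boot all_order all_algebra.
From mathcomp Require Import all_classical all_reals all_analysis.
From mathcomp Require Import measurable_realfun ring lra.
Set Implicit Arguments.
Unset Strict Implicit.
Unset Printing Implicit Defensive.
Import Order.TTheory GRing.Theory Num.Theory.
Import numFieldNormedType.Exports.
Local Open Scope classical_set_scope.
Local Open Scope ring_scope.

(** Every expectation is taken of an infinite product of factors in [[0, 1]] along the enumeration
    of the points. Its partial products decrease, so it exists even when infinitely many points
    qualify or the interference diverges. The price is that limits pass through such a product only
    from above, and this fixes two directions: the generating functional comes from lower
    approximations of [1 - v], and the grid point [b] lies strictly above [z_n]. As [b] comes down
    each factor of [Y_b] is eventually constant, and exactly the points with [z_i > z_n] remain, so
    that ties among the [z_i] call for no separate argument. The regions [z < a] and [z >= b] must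
    be disjoint for their exponents to add, whence [a <= b]. Both ends of a cell [[a, b[] are
    admissible levels against the same [Y_b], and the identity on the cell is the difference of the
    two. Since [z_n] is an infimum with default value 0, its description by counts and its
    positivity hold only almost surely; both come from the generating function of a count at
    [1/2]. *)

(** * Infinite products of factors in [0, 1] *)

Definition iprod {R : realType} (v : nat -> R) : R :=
  limn (fun M => \prod_(i < M) v i).

Lemma prod_unit {R : realType} (v : nat -> R) (M : nat) :
  (forall i, 0 <= v i <= 1) -> 0 <= \prod_(i < M) v i <= 1.
Proof.
move=> v01; elim: M => [|M /andP[IH0 IH1]]; first by rewrite big_ord0 ler01 lexx.
have /andP[v0 v1] := v01 M.
by rewrite big_ord_recr/= mulr_ge0//= mulr_ile1.
Qed.

Lemma iprod_nonincreasing {R : realType} (v : nat -> R) :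
  (forall i, 0 <= v i <= 1) -> nonincreasing_seq (fun M => \prod_(i < M) v i).
Proof.
move=> v01; apply/nonincreasing_seqP => M; rewrite big_ord_recr/=.
have /andP[p0 _] := prod_unit M v01.
by have /andP[_ v1] := v01 M; rewrite ler_piMr.
Qed.

Lemma iprod_is_cvg {R : realType} (v : nat -> R) :
  (forall i, 0 <= v i <= 1) -> cvgn (fun M => \prod_(i < M) v i).
Proof.
move=> v01; apply: nonincreasing_is_cvgn; first exact: iprod_nonincreasing.
by exists 0 => _ [M _ <-]; have /andP[] := prod_unit M v01.
Qed.

Lemma iprod_le_prod {R : realType} (v : nat -> R) (M : nat) :
  (forall i, 0 <= v i <= 1) -> iprod v <= \prod_(i < M) v i.
Proof.
move=> v01; apply: (nonincreasing_cvgn_ge (iprod_nonincreasing v01)).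
exact: iprod_is_cvg.
Qed.

Lemma iprod_unit {R : realType} (v : nat -> R) :
  (forall i, 0 <= v i <= 1) -> 0 <= iprod v <= 1.
Proof.
move=> v01; apply/andP; split; last first.
  by rewrite (le_trans (iprod_le_prod 0 v01))// big_ord0.
apply: limr_ge; first exact: iprod_is_cvg.
by near=> M; have /andP[] := prod_unit M v01.
Unshelve. all: by end_near. Qed.

Lemma le_iprod {R : realType} (v w : nat -> R) :
  (forall i, 0 <= v i) -> (forall i, v i <= w i) -> (forall i, w i <= 1) ->
  iprod v <= iprod w.
Proof.
move=> v0 vw w1.
have v01 i : 0 <= v i <= 1 by rewrite v0 (le_trans (vw i)).
have w01 i : 0 <= w i <= 1 by rewrite w1 (le_trans (v0 i)).
apply: ler_lim; [exact: iprod_is_cvg..|].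
near=> M; apply: ler_prod => i _; by rewrite v0 vw.
Unshelve. all: by end_near. Qed.

Lemma iprodM {R : realType} (v w : nat -> R) :
  (forall i, 0 <= v i <= 1) -> (forall i, 0 <= w i <= 1) ->
  iprod (fun i => v i * w i) = iprod v * iprod w.
Proof.
move=> v01 w01; apply/cvg_lim => //.
under eq_fun do rewrite big_split/=.
by apply: cvgM; exact: iprod_is_cvg.
Qed.

Lemma cvg_prod_ord {R : realType} (v_ : nat -> nat -> R) (v : nat -> R) M :
  (forall i, v_ n i @[n --> \oo] --> v i) ->
  \prod_(i < M) v_ n i @[n --> \oo] --> \prod_(i < M) v i.
Proof.
move=> h; elim: M => [|M IH].
  by under eq_fun do rewrite big_ord0; rewrite big_ord0; exact: cvg_cst.
under eq_fun do rewrite big_ord_recr/=; rewrite big_ord_recr/=.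
exact: cvgM.
Qed.

(* Only one-sided domination makes the limit pass through the infinite product:
   [v_ n i <= v i] is not enough. *)
Lemma cvg_iprod_above {R : realType} (v_ : nat -> nat -> R) (v : nat -> R) :
  (forall i, 0 <= v i) -> (forall n i, v i <= v_ n i) ->
  (forall n i, v_ n i <= 1) ->
  (forall i, v_ n i @[n --> \oo] --> v i) ->
  iprod (v_ n) @[n --> \oo] --> iprod v.
Proof.
move=> v0 vv v1 h.
have v01 i : 0 <= v i <= 1 by rewrite v0 (le_trans (vv 0 i)).
have vn01 n i : 0 <= v_ n i <= 1 by rewrite v1 (le_trans (v0 i)).
have cv := iprod_is_cvg v01.
apply/cvgrPdist_lt => e e0.
(* A finite [M] with partial product below [iprod v + e] settles the upper bound: [iprod (v_ n)]
   lies under its own product over [M] factors, which converges to that one. *)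
have [M _ HM] : \forall M \near \oo, \prod_(i < M) v i < iprod v + e.
  have /cvgrPdist_lt/(_ e e0) [M _ HM] := cv.
  exists M => // k /= /HM; rewrite ltr_norml => /andP[]; rewrite -/(iprod v); lra.
have {}HM := HM M (leqnn M).
have /cvgrPdist_lt := @cvg_prod_ord _ v_ v M h.
have e'0 : 0 < iprod v + e - \prod_(i < M) v i by rewrite subr_gt0.
move=> /(_ _ e'0) [N _ HN]; exists N => // n /= /HN.
have h1 := le_iprod v0 (vv n) (v1 n).
have h2 := iprod_le_prod M (vn01 n).
by rewrite !ltr_norml => /andP[]; lra.
Qed.

Lemma measurable_prod_ord {R : realType} d (T : measurableType d)
    (f : nat -> T -> R) M :
  (forall i, measurable_fun setT (f i)) ->
  measurable_fun setT (fun w => \prod_(i < M) f i w).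
Proof.
move=> mf; elim: M => [|M IH].
  by under eq_fun do rewrite big_ord0; exact: measurable_cst.
under eq_fun do rewrite big_ord_recr/=.
exact: measurable_funM.
Qed.

Lemma measurable_iprod {R : realType} d (T : measurableType d)
    (f : nat -> T -> R) :
  (forall i, measurable_fun setT (f i)) -> (forall i w, 0 <= f i w <= 1) ->
  measurable_fun setT (fun w => iprod (f ^~ w)).
Proof.
move=> mf f01; apply: (measurable_fun_cvg (fun M => measurable_prod_ord M mf)).
by move=> w _; apply: iprod_is_cvg => i; exact: f01.
Qed.

(** * Bounded convergence and transfer of integrals between measures *)

Lemma bounded_cvg_integral {R : realType} d (T : measurableType d)
    (P : probability T R) (D : set T) (f_ : nat -> T -> R) (f : T -> R) :
  measurable D ->
  (forall n, measurable_fun setT (f_ n)) -> measurable_fun setT f ->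
  (forall n w, 0 <= f_ n w <= 1) ->
  {ae P, forall w, f_ n w @[n --> \oo] --> f w} ->
  (\int[P]_(w in D) (f_ n w)%:E @[n --> \oo] --> \int[P]_(w in D) (f w)%:E)%E.
Proof.
move=> mD mf_ mf f01 cf.
have := @dominated_convergence _ _ _ P D mD (fun n w => (f_ n w)%:E)
  (fun w => (f w)%:E) (cst 1%E).
move=> /(_ _ _ _ _ _)[] //.
- by move=> n; apply/measurable_EFinP/measurable_funTS.
- by apply/measurable_EFinP/measurable_funTS.
- by apply: filterS cf => w h _; apply: cvg_EFin; [exact: nearW|exact: h].
- apply/integrableP; split; first exact: measurable_cst.
  rewrite (eq_integral (cst 1%E)); last by move=> x _; rewrite /= normr1.
  by rewrite integral_cst// mul1e (le_lt_trans (probability_le1 P mD))// ltry.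
- by apply: aeW => w n _ /=; rewrite lee_fin ger0_norm; have /andP[] := f01 n w.
Qed.

Import HBNNSimple.

(** The right-hand side sees [m], [xi] and [r] only through the integrals of [r] over preimages of
    sets, so two triples agreeing on these give equal integrals. *)
Lemma integral_comp_approx {R : realType} d1 d3 (T1 : measurableType d1)
    (T3 : measurableType d3) (m : {measure set T1 -> \bar R})
    (xi : T1 -> T3) (r : T1 -> R) (g : T3 -> \bar R)
    (mg : measurable_fun setT g) :
  measurable_fun setT xi -> measurable_fun setT r ->
  (forall w, 0 <= r w) -> (forall t, 0 <= g t)%E ->
  (\int[m]_w (g (xi w) * (r w)%:E) =
   limn (fun n => \sum_(y \in range (nnsfun_approx measurableT mg n))
     (y%:E * \int[m]_(w in xi @^-1` (nnsfun_approx measurableT mg n @^-1` [set y]))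
       (r w)%:E)))%E.
Proof.
move=> mxi mr r0 g0; set g_ := nnsfun_approx measurableT mg.
have mgn n : measurable_fun setT (fun w => ((g_ n) (xi w))%:E * (r w)%:E)%E.
  apply: emeasurable_funM; apply/measurable_EFinP => //.
  exact: measurableT_comp.
transitivity (limn (fun n => \int[m]_w (((g_ n) (xi w))%:E * (r w)%:E)))%E.
  rewrite -monotone_convergence//.
  - apply: eq_integral => w _; apply/esym/cvg_lim => //.
    apply: cvgeZr => //; apply: (@cvg_nnsfun_approx _ _ _ _ measurableT _ mg) => //.
  - by move=> n w _; rewrite mule_ge0// lee_fin.
  - move=> w _ a b ab; rewrite lee_wpmul2r ?lee_fin//.
    exact/lefP/nd_nnsfun_approx.
congr (limn _); apply/funext => n.
have mpre y : measurable (xi @^-1` (g_ n @^-1` [set y])).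
  rewrite -[X in measurable X]setTI; apply: mxi => //.
transitivity (\int[m]_w (\sum_(y \in range (g_ n)) (y%:E * ((\1_(g_ n @^-1` [set y]) (xi w))%:E * (r w)%:E))))%E.
  apply: eq_integral => w _.
  rewrite (fimfunE (g_ n) (xi w)) -fsumEFin// ge0_mule_fsuml; last first.
    move=> y; rewrite lee_fin; case: (ltP y 0) => y0; last by rewrite mulr_ge0.
    by rewrite preimage_nnfun0// indic0 mulr0.
  by apply: eq_fsbigr => y _; rewrite EFinM muleA.
rewrite ge0_integral_fsum//.
- apply: eq_fsbigr => y /[1!inE] -[t _ <-].
  rewrite ge0_integralZl//; last 3 first.
  + apply: emeasurable_funM; apply/measurable_EFinP => //.
    by apply: (@measurableT_comp _ _ _ _ _ _ (\1_(g_ n @^-1` [set g_ n t]) : T3 -> R)) => //.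
  + by move=> w _; rewrite mule_ge0// lee_fin.
  + by rewrite lee_fin.
  congr (_ * _)%E; rewrite [RHS]integral_mkcond; apply: eq_integral => w _.
  rewrite /patch indicE; case: ifPn => [|h].
    by rewrite inE/= => h; rewrite mem_set// mul1e.
  by rewrite memNset ?mul0e//; move=> h'; move: h; rewrite notin_setE; apply.
- move=> y; apply: emeasurable_funM => //; apply: emeasurable_funM; apply/measurable_EFinP => //.
  by apply: (@measurableT_comp _ _ _ _ _ _ (\1_(g_ n @^-1` [set y]) : T3 -> R)) => //.
- move=> y w _; case: (ltP y 0) => y0; last by rewrite !mule_ge0// lee_fin.
  by rewrite preimage_nnfun0// indic0 mul0e mule0.
Qed.

(** Serves as the common change of variables: for affine maps of the line, for the law of a mark,
    and for the joint law of a point and its mark. *)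
Lemma integral_transfer {R : realType} d1 d2 d3 (T1 : measurableType d1)
    (T2 : measurableType d2) (T3 : measurableType d3)
    (m1 : {measure set T1 -> \bar R}) (m2 : {measure set T2 -> \bar R})
    (xi : T1 -> T3) (zeta : T2 -> T3) (r1 : T1 -> R) (r2 : T2 -> R) :
  measurable_fun setT xi -> measurable_fun setT zeta ->
  measurable_fun setT r1 -> measurable_fun setT r2 ->
  (forall w, 0 <= r1 w) -> (forall w, 0 <= r2 w) ->
  (forall D, measurable D -> \int[m1]_(w in xi @^-1` D) (r1 w)%:E =
     \int[m2]_(w in zeta @^-1` D) (r2 w)%:E)%E ->
  forall g : T3 -> \bar R, measurable_fun setT g -> (forall t, 0 <= g t)%E ->
  (\int[m1]_w (g (xi w) * (r1 w)%:E) = \int[m2]_w (g (zeta w) * (r2 w)%:E))%E.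
Proof.
move=> mxi mze mr1 mr2 r10 r20 h g mg g0.
rewrite (integral_comp_approx m1 mg)// (integral_comp_approx m2 mg)//.
congr (limn _); apply/funext => n; apply: eq_fsbigr => y _.
by rewrite h.
Qed.

(** Packing this set function as a measure makes the uniqueness theorems, on pi-systems and on
    intervals, applicable to it. *)
Lemma weighted_law_exists {R : realType} d1 d3 (T1 : measurableType d1)
    (T3 : measurableType d3) (m : {measure set T1 -> \bar R})
    (xi : T1 -> T3) (r : T1 -> R) :
  measurable_fun setT xi -> measurable_fun setT r -> (forall w, 0 <= r w) ->
  exists mm : {measure set T3 -> \bar R},
    forall D, mm D = (\int[m]_(w in xi @^-1` D) (r w)%:E)%E.
Proof.
move=> mxi mr r0.
pose f (D : set T3) := (\int[m]_(w in xi @^-1` D) (r w)%:E)%E.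
have mpre D : measurable D -> measurable (xi @^-1` D).
  by move=> mD; rewrite -[X in measurable X]setTI; exact: mxi.
have f0 : f set0 = 0%E by rewrite /f preimage_set0 integral_set0.
have fge0 D : (0 <= f D)%E by apply: integral_ge0 => w _; rewrite lee_fin.
have fadd : semi_sigma_additive f.
  move=> F mF tF mUF.
  have -> : f (\bigcup_n F n) = (\sum_(n <oo) f (F n))%E.
    rewrite /f preimage_bigcup ge0_integral_bigcup//.
    - by move=> k; exact: mpre.
    - by apply/measurable_EFinP/measurable_funTS.
    - by move=> w _; rewrite lee_fin.
    - apply/trivIsetP => i j _ _ ij; rewrite -preimage_setI.
      by move/trivIsetP: tF => ->//; rewrite preimage_set0.
  apply: is_cvg_nneseries => n _ _; exact: fge0.
pose mix := isMeasure.Build _ _ _ f f0 fge0 fadd.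
pose mm : {measure set T3 -> \bar R} := HB.pack f mix.
by exists mm.
Qed.

Lemma integral_indicM {R : realType} d1 d3 (T1 : measurableType d1)
    (T3 : measurableType d3) (m : {measure set T1 -> \bar R})
    (xi : T1 -> T3) (r : T1 -> R) (D : set T3) :
  (\int[m]_w (\1_D (xi w) * r w)%:E = \int[m]_(w in xi @^-1` D) (r w)%:E)%E.
Proof.
rewrite [RHS]integral_mkcond; apply: eq_integral => w _.
rewrite /patch indicE; case: ifPn => h.
  by move: h; rewrite inE/= => h; rewrite mem_set// mul1r.
by rewrite memNset ?mul0r//; move=> h'; move: h; rewrite notin_setE; apply.
Qed.

(** Uniqueness of measures from a pi-system asks for finite mass along an exhausting sequence; here
    the constant sequence [setT], a member of [G], plays that part. *)
Lemma integral_transfer_pi {R : realType} d1 d2 d3 (T1 : measurableType d1)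
    (T2 : measurableType d2) (T3 : measurableType d3)
    (m1 : {measure set T1 -> \bar R}) (m2 : {measure set T2 -> \bar R})
    (G : set (set T3))
    (xi : T1 -> T3) (zeta : T2 -> T3) (r1 : T1 -> R) (r2 : T2 -> R) :
  measurable = <<s G >> -> setI_closed G -> G setT ->
  measurable_fun setT xi -> measurable_fun setT zeta ->
  measurable_fun setT r1 -> measurable_fun setT r2 ->
  (forall w, 0 <= r1 w) -> (forall w, 0 <= r2 w) ->
  (\int[m1]_w (r1 w)%:E < +oo)%E ->
  (forall D, G D -> \int[m1]_w (\1_D (xi w) * r1 w)%:E =
     \int[m2]_w (\1_D (zeta w) * r2 w)%:E)%E ->
  forall g : T3 -> R, measurable_fun setT g -> (forall t, 0 <= g t) ->
  (\int[m1]_w (g (xi w) * r1 w)%:E = \int[m2]_w (g (zeta w) * r2 w)%:E)%E.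
Proof.
move=> mG IG GT mxi mze mr1 mr2 r10 r20 fin h g mg g0.
have := @integral_transfer _ _ _ _ _ _ _ m1 m2 _ _ _ _ mxi mze mr1 mr2 r10 r20.
move=> /(_ _ (EFin \o g)); apply => //; last exact/measurable_EFinP.
have [n1 n1E] := weighted_law_exists m1 mxi mr1 r10.
have [n2 n2E] := weighted_law_exists m2 mze mr2 r20.
move=> D mD; rewrite -n1E -n2E.
apply: (measure_unique G (fun _ => setT)) => //.
- by rewrite bigcup_const.
- by move=> C GC; rewrite n1E n2E -!integral_indicM; exact: h.
- by move=> _; rewrite n1E preimage_setT.
Qed.

(** * Averaging out independent marks *)

(** The mean over an independent mark with the point held fixed, taken as a real number so that it
    can again be a factor of an [iprod]. *)
Definition kmean {R : realType} d1 d2 (T : measurableType d1)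
    (U : measurableType d2) (mu : probability U R) (g : T * U -> R) (t : T) : R :=
  fine (\int[mu]_h (g (t, h))%:E)%E.

Lemma integral_unit_fin {R : realType} d2 (U : measurableType d2)
    (mu : probability U R) (g : U -> R) : measurable_fun setT g ->
  (forall z, 0 <= g z <= 1) -> (0 <= \int[mu]_h (g h)%:E <= 1)%E.
Proof.
move=> mg g01; apply/andP; split.
  by apply: integral_ge0 => h _; rewrite lee_fin; have /andP[] := g01 h.
rewrite -[leRHS](@probability_setT _ _ _ mu) -[leRHS]mul1e -integral_cst//.
apply: ge0_le_integral => //.
- by move=> h _; rewrite lee_fin; have /andP[] := g01 h.
- exact/measurable_EFinP.
- by move=> h _; rewrite lee_fin; have /andP[] := g01 h.
Qed.

Section kernel_mean.
Context {R : realType} {d1 d2 : measure_display} {T : measurableType d1}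
  {U : measurableType d2} (mu : probability U R) (g : T * U -> R).
Hypothesis mg : measurable_fun setT g.
Hypothesis g01 : forall z, 0 <= g z <= 1.

Let mgt t : measurable_fun setT (fun h => g (t, h)).
Proof. exact: measurableT_comp. Qed.

Lemma kmeanE t : (kmean mu g t)%:E = (\int[mu]_h (g (t, h))%:E)%E.
Proof.
have /andP[h0 h1] := integral_unit_fin mu (mgt t) (fun h => g01 (t, h)).
by rewrite fineK// ge0_fin_numE// (le_lt_trans h1)// ltry.
Qed.

Lemma kmean_unit t : 0 <= kmean mu g t <= 1.
Proof.
rewrite -!lee_fin kmeanE.
exact: integral_unit_fin (mgt t) (fun h => g01 (t, h)).
Qed.

Lemma measurable_kmean : measurable_fun setT (kmean mu g).
Proof.
apply: measurableT_comp => //.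
apply: (@measurable_fun_fubini_tonelli_F _ _ _ _ _ mu (EFin \o g)).
  exact/measurable_EFinP.
by move=> z; rewrite lee_fin; have /andP[] := g01 z.
Qed.

End kernel_mean.

Lemma kmean_rect {R : realType} d1 d2 (T : measurableType d1)
    (U : measurableType d2) (mu : probability U R) (C : set T) (B : set U) t :
  measurable B ->
  kmean mu (\1_(C `*` B) : T * U -> R) t = \1_C t * fine (mu B).
Proof.
move=> mB; rewrite /kmean indicE; have [tC|tC] := boolP (t \in C).
  rewrite /= mul1r; congr fine.
  transitivity (\int[mu]_h (\1_B h)%:E)%E; last by rewrite integral_indic// setIT.
  apply: eq_integral => h _; rewrite !indicE; congr (_ %:R%:E).
  by congr nat_of_bool; apply/idP/idP; rewrite !inE; [case|split => //; move: tC; rewrite inE].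
rewrite /= mul0r (eq_integral (cst 0%E)) ?integral0// => h _.
by rewrite indicE memNset//= => -[/= tC' _]; move: tC; rewrite notin_setE.
Qed.

Lemma indic_unit {R : realType} T (D : set T) t : 0 <= (\1_D t : R) <= 1.
Proof. by rewrite indicE; case: (_ \in _); rewrite /= ?ler01 ?lexx. Qed.

Lemma marking_prod {R : realType} d d1 d2 (Omega : measurableType d)
    (T : measurableType d1) (U : measurableType d2)
    (P : probability Omega R) (mu : probability U R)
    (X : nat -> Omega -> T) (H : nat -> Omega -> U) (M : nat) :
  (forall i, measurable_fun setT (X i)) ->
  (forall i, measurable_fun setT (H i)) ->
  (forall (C : nat -> set T) (B : nat -> set U),
    (forall i, measurable (C i)) -> (forall i, measurable (B i)) ->
    P [set w | forall i : 'I_M, C i (X i w) /\ B i (H i w)] =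
    (P [set w | forall i : 'I_M, C i (X i w)] * (\prod_(i < M) fine (mu (B i)))%:E)%E) ->
  forall g : nat -> T * U -> R,
  (forall i, measurable_fun setT (g i)) -> (forall i z, 0 <= g i z <= 1) ->
  (\int[P]_w (\prod_(i < M) g i (X i w, H i w))%:E =
   \int[P]_w (\prod_(i < M) kmean mu (g i) (X i w))%:E)%E.
Proof.
move=> mX mH indep.
pose rect (f : T * U -> R) := exists C B, [/\ measurable C, measurable B & f = \1_(C `*` B)].
(* From index [k] on, every factor is the indicator of a rectangle: [k = 0] is the hypothesis
   [indep], and [k = M] leaves the factors arbitrary. *)
suff claim k : forall g : nat -> T * U -> R,
    (forall i, measurable_fun setT (g i)) -> (forall i z, 0 <= g i z <= 1) ->
    (forall i : 'I_M, (k <= i)%N -> rect (g i)) ->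
  (\int[P]_w (\prod_(i < M) g i (X i w, H i w))%:E =
   \int[P]_w (\prod_(i < M) kmean mu (g i) (X i w))%:E)%E.
  by move=> g mg g01; apply: (claim M) => // i; rewrite leqNgt ltn_ord.
elim: k => [|k IH] g mg g01 rg.
  have /choice[CB CBE] : forall i : nat, exists CB : set T * set U,
      [/\ measurable CB.1, measurable CB.2 & (i < M)%N -> g i = \1_(CB.1 `*` CB.2)].
    move=> i; case: (ltnP i M) => iM; last first.
      by exists (setT, setT); split => //; exact: measurableT.
    have [C [B [mC mB gE]]] := rg (Ordinal iM) isT.
    by exists (C, B); split.
  have mC i : measurable (CB i).1 by have [] := CBE i.
  have mB i : measurable (CB i).2 by have [] := CBE i.
  have gE (i : 'I_M) : g i = \1_((CB i).1 `*` (CB i).2) by have [_ _] := CBE i; exact.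
  have prod_indic (V : nat -> Omega -> bool) w :
      \prod_(i < M) ((V i w)%:R : R) = \1_[set w | forall i : 'I_M, V i w] w.
    rewrite indicE; have [h|h] := boolP (w \in _).
      by rewrite big1// => i _; move: h; rewrite inE/= => ->.
    move: h; rewrite notin_setE/= => /existsNP[i /negP/negbTE Vi].
    by rewrite (bigD1 i)//= Vi mul0r.
  have mpre1 i : measurable (X i @^-1` (CB i).1).
    by rewrite -[X in measurable X]setTI; exact: mX.
  have mpre2 i : measurable (H i @^-1` (CB i).2).
    by rewrite -[X in measurable X]setTI; exact: mH.
  have mI (F : 'I_M -> set Omega) : (forall i, measurable (F i)) ->
      measurable [set w | forall i, F i w].
    move=> mF; rewrite (_ : [set w | _] = \bigcap_(i in [set: 'I_M]) F i).
      by apply: fin_bigcap_measurable => // i _; exact: mF.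
    by apply/seteqP; split => w /= h i; [move=> _; exact: h|exact: h].
  under eq_integral => w _ do under eq_bigr => i _ do rewrite gE indicE.
  under eq_integral => w _ do rewrite (prod_indic (fun i w => (X i w, H i w) \in (CB i).1 `*` (CB i).2)).
  rewrite integral_indic//; last first.
    apply: (mI (fun i => [set w | (X i w, H i w) \in (CB i).1 `*` (CB i).2])) => i.
    rewrite (_ : [set w | _] = X i @^-1` (CB i).1 `&` H i @^-1` (CB i).2); first exact: measurableI.
    by apply/seteqP; split => w /=; rewrite inE.
  have -> : [set w | forall i : 'I_M, (X i w, H i w) \in (CB i).1 `*` (CB i).2] =
      [set w | forall i : 'I_M, (CB i).1 (X i w) /\ (CB i).2 (H i w)].
    by apply/seteqP; split => w /= h i; have := h i; rewrite inE.
  rewrite setIT.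
  refine (etrans (indep (fun i => (CB i).1) (fun i => (CB i).2) mC mB) _).
  under [RHS]eq_integral => w _ do under eq_bigr => i _ do rewrite gE kmean_rect// indicE.
  under [RHS]eq_integral => w _ do rewrite big_split/= EFinM.
  rewrite ge0_integralZr//; last 3 first.
  - apply/measurable_EFinP; apply: (measurable_prod_ord (f := fun i w => ((X i w \in (CB i).1)%:R : R))) => i.
    by apply: (@measurableT_comp _ _ _ _ _ _ (\1_((CB i).1) : T -> R)).
  - by move=> w _; rewrite lee_fin prodr_ge0.
  - by rewrite lee_fin prodr_ge0// => i _; apply: fine_ge0.
  congr (_ * _)%E.
  under eq_integral => w _ do rewrite (prod_indic (fun i w => X i w \in (CB i).1)).
  rewrite integral_indic//; last first.
    apply: (mI (fun i => [set w | X i w \in (CB i).1])) => i.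
    rewrite (_ : [set w | _] = X i @^-1` (CB i).1)//.
    by apply/seteqP; split => w /=; rewrite inE.
  rewrite setIT.
  have -> : [set w | forall i : 'I_M, X i w \in (CB i).1] = [set w | forall i : 'I_M, (CB i).1 (X i w)]; last by [].
  by apply/seteqP; split => w /= h i; have := h i; rewrite inE.
have [Mk|kM] := leqP M k.
  by apply: IH => // i ki; have := leq_trans Mk ki; rewrite leqNgt ltn_ord.
pose k0 := Ordinal kM.
have mgX f i : measurable_fun setT f -> measurable_fun setT (fun w => (f (X i w, H i w) : R)).
  move=> mf; apply: (measurableT_comp mf); exact: measurable_fun_pair.
pose r1 w := \prod_(i < M | i != k0) g i (X i w, H i w).
pose r2 w := \prod_(i < M | i != k0) kmean mu (g i) (X i w).
have r1E w : r1 w = \prod_(i < M) (if i == k0 then 1 else g i (X i w, H i w)).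
  by rewrite [RHS](bigD1 k0)//= eqxx mul1r; apply: eq_bigr => i /negbTE ->.
have r2E w : r2 w = \prod_(i < M) (if i == k0 then 1 else kmean mu (g i) (X i w)).
  by rewrite [RHS](bigD1 k0)//= eqxx mul1r; apply: eq_bigr => i /negbTE ->.
have mr1 : measurable_fun setT r1.
  rewrite (funext r1E).
  apply: (measurable_prod_ord (f := fun (i : nat) w => if i == k :> nat then 1 else g i (X i w, H i w))) => i.
  by case: eqP => _; [exact: measurable_cst|exact: mgX].
have mr2 : measurable_fun setT r2.
  rewrite (funext r2E).
  apply: (measurable_prod_ord (f := fun (i : nat) w => if i == k :> nat then 1 else kmean mu (g i) (X i w))) => i.
  case: eqP => _; first exact: measurable_cst.
  by apply: measurableT_comp => //; exact: measurable_kmean.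
have r1_01 w : 0 <= r1 w <= 1.
  rewrite r1E; apply: (prod_unit (v := fun i => if i == k :> nat then 1 else g i (X i w, H i w))) => i.
  by case: eqP => // _; rewrite ler01 lexx.
have r2_01 w : 0 <= r2 w <= 1.
  rewrite r2E; apply: (prod_unit (v := fun i => if i == k :> nat then 1 else kmean mu (g i) (X i w))) => i.
  by case: eqP => _; rewrite ?ler01 ?lexx//; exact: kmean_unit.
(* Undoes the average at coordinate [k] by an independent copy of the mark on [P \x mu], so that
   both sides are integrals of the same function of a point and a mark. *)
have fub (f : T * U -> R) : measurable_fun setT f -> (forall z, 0 <= f z <= 1) ->
    (\int[(P \x mu)%E]_z (f (X k z.1, z.2) * r2 z.1)%:E =
     \int[P]_w (kmean mu f (X k w) * r2 w)%:E)%E.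
  move=> mf f01; pose F z := (f (X k z.1, z.2) * r2 z.1)%:E.
  have F0 z : (0 <= F z)%E.
    by rewrite lee_fin mulr_ge0//; [have /andP[] := f01 (X k z.1, z.2)|have /andP[] := r2_01 z.1].
  have mF : measurable_fun setT F.
    apply/measurable_EFinP; apply: measurable_funM.
      apply: (measurableT_comp mf); apply: measurable_fun_pair => //.
      exact: measurableT_comp.
    exact: measurableT_comp.
  rewrite (fubini_tonelli1 F)//; apply: eq_integral => w _.
  rewrite /fubini_F /F/=.
  under eq_integral => h _ do rewrite EFinM.
  rewrite ge0_integralZr//.
  - by rewrite EFinM kmeanE.
  - apply/measurable_EFinP; apply: (measurableT_comp mf); exact: measurable_fun_pair.
  - by move=> h _; rewrite lee_fin; have /andP[] := f01 (X k w, h).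
  - by rewrite lee_fin; have /andP[] := r2_01 w.
under eq_integral => w _ do rewrite (bigD1 k0)//=.
under [RHS]eq_integral => w _ do rewrite (bigD1 k0)//=.
rewrite -fub//.
apply: (@integral_transfer_pi _ _ _ _ _ _ _ P (P \x mu)%E _ (fun w => (X k w, H k w)) (fun z => (X k z.1, z.2)) r1 (fun z => r2 z.1) (measurable_prod_measurableType _ _)).
- move=> _ _ [C1 mC1 [B1 mB1 <-]] [C2 mC2 [B2 mB2 <-]].
  rewrite -setXI; exists (C1 `&` C2); first exact: measurableI.
  by exists (B1 `&` B2) => //; exact: measurableI.
- by exists setT => //; exists setT => //; rewrite setXTT.
- exact: measurable_fun_pair.
- by apply: measurable_fun_pair => //; exact: measurableT_comp.
- by [].
- exact: measurableT_comp.
- by move=> w; have /andP[] := r1_01 w.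
- by move=> w; have /andP[] := r2_01 w.1.
- by have /andP[_ h] := integral_unit_fin P mr1 r1_01; rewrite (le_lt_trans h)// ltry.
- move=> _ [C mC [B mB <-]].
  have mCB : measurable_fun setT (\1_(C `*` B) : T * U -> R) by apply: measurable_indic; exact: measurableX.
  rewrite (fub (\1_(C `*` B))) //; last by move=> z; exact: indic_unit.
  (* With a rectangle put at coordinate [k], the factors are rectangles from [k] on, and the
     induction hypothesis applies. *)
  pose g' (i : nat) := if i == k then \1_(C `*` B) : T * U -> R else g i.
  have e1 w : \prod_(i < M) g' i (X i w, H i w) = \1_(C `*` B) (X k w, H k w) * r1 w.
    rewrite (bigD1 k0)//= {1}/g' eqxx; congr (_ * _); apply: eq_bigr => i.
    by rewrite -val_eqE /g'/= => /negbTE ->.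
  have e2 w : \prod_(i < M) kmean mu (g' i) (X i w) = kmean mu (\1_(C `*` B)) (X k w) * r2 w.
    rewrite (bigD1 k0)//= {1}/g' eqxx; congr (_ * _); apply: eq_bigr => i.
    by rewrite -val_eqE /g'/= => /negbTE ->.
  under eq_integral => w _ do rewrite -e1.
  under [RHS]eq_integral => w _ do rewrite -e2.
  apply: IH; rewrite /g'.
  + by move=> i; case: eqP.
  + by move=> i z; case: eqP => // _; exact: indic_unit.
  + move=> i; rewrite leq_eqVlt; case: eqP => [ki _|_ /= ki].
      by exists C, B; rewrite -ki eqxx.
    by case: eqP => [ik|_]; [exists C, B|exact: rg].
- exact: mg.
- by move=> t; have /andP[] := g01 k t.
Qed.

(** * Counting along an enumeration *)

Section counting.
Context {R : realType}.
Implicit Types b : nat -> bool.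

Definition partial_count b (M : nat) : nat := (\sum_(i < M) b i)%N.

Lemma partial_count_nd b : {homo partial_count b : m n / (m <= n)%N}.
Proof.
apply: homo_leq => [//|m n p|n]; first exact: leq_trans.
by rewrite /partial_count big_ord_recr/= leq_addr.
Qed.

Lemma partial_count_cases b :
  (exists k, \forall n \near \oo, partial_count b n = k) \/
  (forall k, \forall n \near \oo, (k <= partial_count b n)%N).
Proof.
have [h|/existsNP[k /forallNP h]] :=
    pselect (forall k, exists n, (k <= partial_count b n)%N).
  right => k; have [n kn] := h k; exists n => // m /= nm.
  exact: leq_trans kn (partial_count_nd _ nm).
left.
have ub n : (partial_count b n <= k)%N.
  by rewrite leqNgt; apply/negP => /ltnW; exact: h.
pose Q j := `[< exists n, partial_count b n = j >].
have exQ : exists j, Q j by exists (partial_count b 0); apply/asboolP; exists 0.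
have ubQ j : Q j -> (j <= k)%N by move=> /asboolP[n <-].
case: (ex_maxnP exQ ubQ) => j /asboolP[n nj] jmax.
exists j; exists n => // m /= nm; apply/eqP; rewrite eqn_leq; apply/andP; split.
  by apply: jmax; apply/asboolP; exists m.
by rewrite -nj; exact: partial_count_nd.
Qed.

(** [None] stands for an infinite count. *)
Definition total_count b : option nat :=
  if pselect (exists k, \forall n \near \oo, partial_count b n = k) is left h
  then Some (projT1 (cid h)) else None.

Lemma total_count_some b k : total_count b = Some k <->
  \forall n \near \oo, partial_count b n = k.
Proof.
rewrite /total_count; case: pselect => [h|h].
  case: cid => j /= [N _ jE]; split => [[<-]|[M _ kE]]; first by exists N.
  congr Some; rewrite -(jE (maxn N M)) ?(kE (maxn N M))//= ?leq_maxr//.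
  by rewrite leq_maxl.
by split => // kE; exfalso; apply: h; exists k.
Qed.

Definition count_series b : \bar R :=
  (\sum_(i <oo) (if b i then (1 : \bar R) else 0))%E.

Lemma count_series_cvg b :
  ((partial_count b n)%:R%:E @[n --> \oo] --> count_series b)%E.
Proof.
rewrite (_ : (fun n => _) =
    (fun n => \sum_(0 <= i < n) (if b i then (1 : \bar R) else 0))%E); last first.
  apply/funext => n; rewrite big_mkord /partial_count natr_sum -sumEFin.
  by apply: eq_bigr => i _; case: (b i).
by apply: is_cvg_nneseries => i _ _; case: (b i).
Qed.

Lemma count_series_some b k :
  total_count b = Some k -> count_series b = (k%:R)%:E.
Proof.
move=> /total_count_some [N _ kE].
rewrite -(cvg_lim (@ereal_hausdorff R) (@count_series_cvg b)); apply/cvg_lim => //.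
by apply: cvg_near_cst; exists N => // n /= /kE ->.
Qed.

Lemma count_series_none b : total_count b = None -> count_series b = +oo%E.
Proof.
move=> bN; have [[k kE]|h] := partial_count_cases b.
  by move/total_count_some : kE; rewrite bN.
rewrite -(cvg_lim (@ereal_hausdorff R) (@count_series_cvg b)); apply/cvg_lim => //.
apply/cvgeyPge => A; near=> n; rewrite lee_fin.
rewrite (le_trans (ltW (truncnS_gt A)))// ler_nat; near: n; exact: h.
Unshelve. all: by end_near. Qed.

Lemma count_seriesE b k :
  count_series b = (k%:R)%:E <-> total_count b = Some k.
Proof.
split; last exact: count_series_some.
case E : (total_count b) => [j|].
  by rewrite (count_series_some E) => -[/eqP]; rewrite eqr_nat => /eqP ->.
by rewrite (count_series_none E).
Qed.

Lemma le_count_series n b : (n%:R%:E <= count_series b)%E =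
  ~~ (if total_count b is Some k then (k < n)%N else false).
Proof.
case E : (total_count b) => [j|].
  by rewrite (count_series_some E) lee_fin ler_nat leqNgt.
by rewrite (count_series_none E) leey.
Qed.

Lemma le_count_seriesP n b : (n%:R%:E <= count_series b)%E <->
  exists M, (n <= partial_count b M)%N.
Proof.
rewrite le_count_series; split.
  case E : (total_count b) => [j|] jn.
    move/total_count_some : E => [M _ ME]; exists M.
    by rewrite ME//= leqNgt.
  have [[k kE]|h] := partial_count_cases b.
    by move/total_count_some : kE; rewrite E.
  by have [M _ HM] := h n; exists M; apply: HM => /=.
move=> [M nM]; case E : (total_count b) => [j|//].
move/total_count_some : E => [N _ NE]; rewrite -leqNgt.
rewrite -(NE (maxn N M)); last by rewrite /= leq_maxl.
by rewrite (leq_trans nM)// partial_count_nd// leq_maxr.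
Qed.

Lemma prod_count b (th : R) M :
  \prod_(i < M) (if b i then th else 1) = th ^+ partial_count b M.
Proof.
elim: M => [|M IH]; first by rewrite big_ord0 /partial_count big_ord0.
rewrite big_ord_recr/= IH /partial_count big_ord_recr/=.
by case: (b M); rewrite ?addn1 ?exprSr// mulr1 addn0.
Qed.

(** The bound [th < 1] sends an infinite count to 0, the default value of [oapp]; at [th = 1] the
    product would be 1. *)
Lemma iprod_count b (th : R) : 0 <= th < 1 ->
  iprod (fun i => if b i then th else 1) =
  oapp (fun k => th ^+ k) 0 (total_count b).
Proof.
move=> /andP[th0 th1]; apply/cvg_lim => //.
under eq_fun do rewrite prod_count.
case E : (total_count b) => [j|] /=.
  move/total_count_some : E => [N _ NE].
  by apply: cvg_near_cst; exists N => // n /= /NE ->.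
have [[k kE]|h] := partial_count_cases b.
  by move/total_count_some : kE; rewrite E.
have th1' : `|th| < 1 by rewrite ger0_norm.
apply/cvgrPdist_lt => e e0.
have /cvgrPdist_lt/(_ e e0)[K _ HK] := cvg_expr th1'.
near=> n; apply: HK => /=; near: n; exact: h.
Unshelve. all: by end_near. Qed.

Lemma measurable_count_series d (T : measurableType d) (b : nat -> T -> bool) :
  (forall i, measurable_fun setT (b i)) ->
  measurable_fun setT (fun w => count_series (b ^~ w)).
Proof.
move=> mb; apply: (@ge0_emeasurable_sum _ _ _ _ _ xpredT) => //.
  by move=> k x _ _; case: (b k x).
by move=> k _; apply: measurable_fun_ifT => //; exact: measurable_cst.
Qed.

Lemma measurable_total_count d (T : measurableType d) (b : nat -> T -> bool) k :
  (forall i, measurable_fun setT (b i)) ->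
  measurable [set w | total_count (b ^~ w) = Some k].
Proof.
move=> mb; rewrite (_ : [set w | _] =
    (fun w => count_series (b ^~ w)) @^-1` [set (k%:R)%:E]).
  by rewrite -[X in measurable X]setTI; exact: measurable_count_series.
by apply/seteqP; split => w /= /count_seriesE.
Qed.

End counting.

(** * Generating functions of independent Poisson counts *)

Lemma indep_count_mean {R : realType} d (Omega : measurableType d)
    (P : probability Omega R) (m : nat) (K : nat -> Omega -> option nat)
    (p : nat -> nat -> R) :
  (forall j a, measurable [set w | K j w = Some a]) ->
  (forall j a, 0 <= p j a) ->
  (forall k : nat -> nat, P [set w | forall j : 'I_m, K j w = Some (k j)] =
    (\prod_(j < m) p j (k j))%:E) ->
  forall (phi : nat -> nat -> R) (e : nat -> R),
  (forall j a, 0 <= phi j a <= 1) ->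
  (forall j : 'I_m, \sum_(a <oo) (phi j a * p j a)%:E = (e j)%:E)%E ->
  (\int[P]_w (\prod_(j < m) oapp (phi j) 0 (K j w))%:E = (\prod_(j < m) e j)%:E)%E.
Proof.
move=> mK p0 PK.
pose single (f : nat -> R) := exists a, f = fun n => (n == a)%:R.
have sumsingle a (q : nat -> R) :
    (\sum_(n <oo) ((n == a)%:R * q n)%:E = (q a)%:E)%E.
  apply/cvg_lim => //; apply: cvg_near_cst; exists a.+1 => // n /= an.
  rewrite big_mkord sumEFin (bigD1 (Ordinal an))//= eqxx mul1r big1 ?addr0//.
  by move=> i; rewrite -val_eqE/= => /negbTE ->; rewrite mul0r.
have moapp (f : nat -> R) j : (forall a, 0 <= f a) ->
    measurable_fun setT (fun w => oapp f 0 (K j w)).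
  move=> f0; pose h a w : R := f a * \1_[set w | K j w = Some a] w.
  have hE w : (oapp f 0 (K j w))%:E = (\sum_(a <oo) (h a w)%:E)%E.
    case E : (K j w) => [a|] /=.
      rewrite -(sumsingle a f); apply: eq_eseriesr => n _; congr EFin.
      rewrite /h mulrC indicE; congr (_ * _%:R); congr nat_of_bool.
      by apply/eqP/idP => [->|]; rewrite inE/= E// => -[->].
    rewrite eseries0// => n _ _; rewrite /h indicE memNset ?mulr0//=.
    by rewrite E.
  apply/measurable_EFinP; rewrite (_ : _ \o _ = fun w => (\sum_(a <oo) (h a w)%:E)%E).
    apply: (@ge0_emeasurable_sum _ _ _ _ _ xpredT) => //.
      by move=> k x _ _; rewrite lee_fin mulr_ge0.
    move=> k _; apply/measurable_EFinP; apply: measurable_funM => //.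
  by apply/funext => w; exact: hE.
have oapp01 (f : nat -> R) o : (forall a, 0 <= f a <= 1) -> 0 <= oapp f 0 o <= 1.
  by case: o => //= _; rewrite lexx ler01.
suff claim k : forall (phi : nat -> nat -> R) (e : nat -> R),
    (forall j a, 0 <= phi j a <= 1) ->
    (forall j : 'I_m, \sum_(a <oo) (phi j a * p j a)%:E = (e j)%:E)%E ->
    (forall j : 'I_m, (k <= j)%N -> single (phi j)) ->
  (\int[P]_w (\prod_(j < m) oapp (phi j) 0 (K j w))%:E = (\prod_(j < m) e j)%:E)%E.
  by move=> phi e phi01 he; apply: (claim m) => // j; rewrite leqNgt ltn_ord.
elim: k => [|k IH] phi e phi01 he hs.
  have /choice[a aE] : forall j : nat, exists a : nat, (j < m)%N -> phi j = fun n => (n == a)%:R.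
    move=> j; case: (ltnP j m) => jm; last by exists 0.
    by have [a aE] := hs (Ordinal jm) isT; exists a.
  have eE (j : 'I_m) : e j = p j (a j).
    by apply: EFin_inj; rewrite -he aE//; exact: sumsingle.
  under [in RHS]eq_bigr => j _ do rewrite eE.
  rewrite -PK.
  transitivity (\int[P]_w (\1_[set w | forall j : 'I_m, K j w = Some (a j)] w)%:E)%E; last first.
    rewrite integral_indic ?setIT//.
    rewrite (_ : [set w | _] = \bigcap_(j in [set: 'I_m]) [set w | K j w = Some (a j)]).
      by apply: fin_bigcap_measurable => // i _; exact: mK.
    by apply/seteqP; split => w /= h i; [move=> _; exact: h|exact: h].
  apply: eq_integral => w _; congr EFin; rewrite indicE.
  have [|h] := boolP (w \in _).
    by rewrite inE/= => h; rewrite big1// => j _; rewrite h/= aE// eqxx.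
    move: h; rewrite notin_setE/= => /existsNP[j Kj].
    rewrite (bigD1 j)//=; case E : (K j w) => [b|] /=; last by rewrite mul0r.
    rewrite aE//; case: eqP => [ba|]; last by rewrite mul0r.
    by exfalso; apply: Kj; rewrite E ba.
have [mk|km] := leqP m k.
  by apply: IH => // j kj; have := leq_trans mk kj; rewrite leqNgt ltn_ord.
pose k0 := Ordinal km.
pose r w := \prod_(j < m | j != k0) oapp (phi j) 0 (K j w).
pose Q := \prod_(j < m | j != k0) e j.
have rE w : r w = \prod_(j < m) (if j == k0 then 1 else oapp (phi j) 0 (K j w)).
  by rewrite [RHS](bigD1 k0)//= eqxx mul1r; apply: eq_bigr => i /negbTE ->.
have phi0 j a : 0 <= phi j a by have /andP[] := phi01 j a.
have mr : measurable_fun setT r.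
  rewrite (funext rE).
  apply: (measurable_prod_ord (f := fun (j : nat) w => if j == k :> nat then 1 else oapp (phi j) 0 (K j w))) => j.
  by case: eqP => _; [exact: measurable_cst|exact: moapp].
have r0 w : 0 <= r w.
  by apply: prodr_ge0 => j _; have /andP[] := oapp01 (phi j) (K j w) (phi01 j).
(* With [phi k] replaced by the indicator of [a], all indices from [k] on carry indicators of single
   values, the case covered by [IH]. *)
have step a : (\int[P]_w (\1_[set w | K k w = Some a] w * r w)%:E = (p k a * Q)%:E)%E.
  pose phi' (j : nat) := if j == k then fun n => (n == a)%:R else phi j.
  pose e' (j : nat) := if j == k then p k a else e j.
  have e1 w : \prod_(j < m) oapp (phi' j) 0 (K j w) = \1_[set w | K k w = Some a] w * r w.
    rewrite (bigD1 k0)//= {1}/phi' eqxx; congr (_ * _).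
      rewrite indicE; case E : (K k w) => [b|] /=.
        congr (_%:R); congr nat_of_bool.
        by apply/eqP/idP; rewrite inE/= E; [move=> ->|case].
      by rewrite memNset//= E.
    apply: eq_bigr => i; by rewrite -val_eqE /phi'/= => /negbTE ->.
  have e2 : \prod_(j < m) e' j = p k a * Q.
    rewrite (bigD1 k0)//= {1}/e' eqxx; congr (_ * _).
    by apply: eq_bigr => i; rewrite -val_eqE /e'/= => /negbTE ->.
  under eq_integral => w _ do rewrite -e1.
  rewrite -e2; apply: IH; rewrite /phi' /e'.
  - by move=> j b; case: eqP => // _; case: eqP; rewrite ?lexx ?ler01.
  - by move=> j; case: eqP => [->|_]; [exact: sumsingle|exact: he].
  - move=> j; rewrite leq_eqVlt; case: eqP => [<-|_ /= kj].
      by move=> _; rewrite eqxx; exists a.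
    by case: eqP => _; [exists a|exact: hs].
under eq_integral => w _ do rewrite (bigD1 k0)//= -/(r w).
rewrite (bigD1 k0)//= -/Q.
(* Factor [k] is expanded over the finite values of the count; each term is then an instance of
   [step]. *)
transitivity (\int[P]_w (\sum_(a <oo) ((phi k a)%:E * (\1_[set w | K k w = Some a] w * r w)%:E)))%E.
  apply: eq_integral => w _.
  case E : (K k w) => [b|] /=; last first.
    by rewrite mul0r eseries0// => n _ _; rewrite indicE memNset ?mul0r ?mule0//= E.
  rewrite -(sumsingle b (fun a => phi k a * r w)).
  apply: eq_eseriesr => n _; rewrite -EFinM indicE; congr EFin.
  rewrite mulrCA; congr (_ * _); last first.
    congr (_%:R * _); congr nat_of_bool.
    by apply/eqP/idP; rewrite inE/= E; [move=> ->|case].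
have mi a : measurable_fun setT (fun w => (\1_[set w | K k w = Some a] w * r w)%:E).
  by apply/measurable_EFinP; apply: measurable_funM => //; exact: measurable_indic.
rewrite integral_nneseries//; last 2 first.
- by move=> n; apply: emeasurable_funM => //; exact: measurable_cst.
- by move=> n w _; rewrite -EFinM lee_fin !mulr_ge0.
transitivity (\sum_(a <oo) (Q%:E * (phi k a * p k a)%:E))%E.
  apply: eq_eseriesr => a _; rewrite ge0_integralZl//; last 2 first.
  - by move=> w _; rewrite lee_fin mulr_ge0.
  - by rewrite lee_fin.
  by rewrite step -!EFinM; congr EFin; ring.
rewrite nneseriesZl; last by move=> a _; rewrite lee_fin mulr_ge0.
by rewrite (he k0) -EFinM mulrC.
Qed.

Lemma poisson_pgf {R : realType} (mu th : R) : 0 <= mu -> 0 <= th ->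
  (\sum_(a <oo) (th ^+ a * Defs.poisson_prob mu a)%:E = (expR (- mu * (1 - th)))%:E)%E.
Proof.
move=> mu0 th0; apply/cvg_lim => //.
rewrite (_ : (fun n => _) = (fun n => (expR (- mu) * series (exp_coeff (th * mu)) n)%:E)); last first.
  apply/funext => n; rewrite sumEFin /series/= mulr_sumr; congr EFin.
  by apply: eq_bigr => i _; rewrite /Defs.poisson_prob /exp_coeff/= exprMn; ring.
apply: cvg_EFin; first exact: nearW.
rewrite (_ : expR (- mu * (1 - th)) = expR (- mu) * expR (th * mu)); last first.
  by rewrite -expRD; congr expR; ring.
apply: cvgM; first exact: cvg_cst.
rewrite /expR; exact: is_cvg_series_exp_coeff.
Qed.

Lemma iprod_prod {R : realType} (v : nat -> nat -> R) m :
  (forall j i, 0 <= v j i <= 1) ->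
  iprod (fun i => \prod_(j < m) v j i) = \prod_(j < m) iprod (v j).
Proof.
move=> v01; elim: m => [|m IH].
  under eq_fun do rewrite big_ord0; rewrite big_ord0.
  apply/cvg_lim => //; under eq_fun do rewrite big1//; exact: cvg_cst.
under eq_fun do rewrite big_ord_recr/=.
rewrite iprodM//; last by move=> i; apply: (prod_unit (v := v ^~ i)).
by rewrite IH big_ord_recr.
Qed.

Lemma measurable_asbool d (T : measurableType d) (D : set T) :
  measurable D -> measurable_fun setT (fun t => `[< D t >]).
Proof.
move=> mD; apply: (@measurable_fun_bool _ _ _ _ true).
rewrite setTI (_ : _ @^-1` _ = D)//.
by apply/seteqP; split => t /= => [/asboolP|/asboolP].
Qed.

(** For a step function the infinite product is a product of powers [th_j ^ N_j] of the counts on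
    disjoint bounded sets, so its mean is a product of Poisson generating functions. *)
Lemma pgfl_step {R : realType} d (Omega : measurableType d)
    (P : probability Omega R) (lam : R) (X : nat -> Omega -> R * R) (m : nat)
    (A : nat -> set (R * R)) (th : nat -> R) :
  0 <= lam -> is_homogeneous_PPP P lam X ->
  (forall j, measurable (A j)) -> (forall j, bounded2 (A j)) ->
  (forall j j', j != j' -> A j `&` A j' = set0) ->
  (forall j : 'I_m, 0 <= th j < 1) ->
  (\int[P]_w (iprod (fun i => \prod_(j < m) (if `[< A j (X i w) >] then th j else 1)))%:E
   = (expR (- lam * \sum_(j < m) fine (leb2 (A j)) * (1 - th j)))%:E)%E.
Proof.
move=> lam0 [mX [injX PX]] mA bA dA th01'.
(* The extension by 0 makes the bounds on [th] hold at every natural index, as the lemmas on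
   sequences require. *)
pose th' j := if (j < m)%N then th j else 0.
have th'E (j : 'I_m) : th' j = th j by rewrite /th' ltn_ord.
have th01 j : 0 <= th' j < 1.
  rewrite /th'; case: ltnP => jm; last by rewrite lexx ltr01.
  exact: (th01' (Ordinal jm)).
have fA0 j : 0 <= fine (leb2 (A j)) by rewrite fine_ge0//; exact: measure_ge0.
under eq_integral => w _ do under eq_fun do under eq_bigr do rewrite -th'E.
under [X in (expR (_ * X))%:E]eq_bigr do rewrite -th'E.
pose K j w := @total_count (fun i => `[< A j (X i w) >]).
have mK j a : measurable [set w | K j w = Some a].
  apply: (@measurable_total_count R _ _ (fun i w => `[< A j (X i w) >])) => i.
  apply: (measurableT_comp (f := fun p => `[< A j p >])) => //.
  exact: measurable_asbool.
pose p j a := Defs.poisson_prob (lam * fine (leb2 (A j))) a.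
have := @indep_count_mean R _ _ P m K p mK _ _ (fun j a => th' j ^+ a)
  (fun j => expR (- (lam * fine (leb2 (A j))) * (1 - th' j))).
move=> /(_ _ _ _ _) h.
transitivity (\int[P]_w (\prod_(j < m) oapp (fun a => th' j ^+ a) 0 (K j w))%:E)%E.
  apply: eq_integral => w _; rewrite (iprod_prod (v := fun j i => if `[< A j (X i w) >] then th' j else 1)).
    by congr EFin; apply: eq_bigr => j _; rewrite iprod_count.
  move=> j i; have /andP[t0 t1] := th01 j.
  by case: asboolP => _; rewrite ?t0 ?(ltW t1)// ler01 lexx.
rewrite h.
- rewrite -expR_sum mulr_sumr; congr ((expR _)%:E).
  by apply: eq_bigr => j _; ring.
- by move=> j a; rewrite /p /Defs.poisson_prob !mulr_ge0// ?expR_ge0// exprn_ge0// mulr_ge0.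
- move=> k; rewrite -(PX m (fun j => A j) (fun j => k j))//.
    congr (P _); apply/seteqP; split => w /= hk j; have := hk j.
      exact: count_series_some.
    exact: (iffLR (count_seriesE _ _)).
  by move=> j j' jj'; apply: dA; move: jj'; apply: contra_neq => /val_inj.
- by move=> j a; have /andP[t0 t1] := th01 j; rewrite exprn_ge0//= exprn_ile1// ltW.
- by move=> j; apply: poisson_pgf; [rewrite mulr_ge0|have /andP[] := th01 j].
Qed.

(** * Integration over the plane and over the plane with marks *)

Lemma measurable_sum_ord {R : realType} d (T : measurableType d)
    (f : nat -> T -> R) M :
  (forall i, measurable_fun setT (f i)) ->
  measurable_fun setT (fun w => \sum_(i < M) f i w).
Proof.
move=> mf; elim: M => [|M IH].
  by under eq_fun do rewrite big_ord0; exact: measurable_cst.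
under eq_fun do rewrite big_ord_recr/=.
exact: measurable_funD.
Qed.

Local Notation plane R := (@lebesgue_measure R \x @lebesgue_measure R)%E.

Lemma integral_EFin_cst {R : realType} d (T : measurableType d)
    (m : {measure set T -> \bar R}) (D : set T) (c : R) :
  measurable D -> (\int[m]_(w in D) c%:E = c%:E * m D)%E.
Proof. by move=> mD; rewrite -integral_cst. Qed.

Lemma integral_leb_cst {R : realType} (D : set R) (c : R) : measurable D ->
  (\int[@lebesgue_measure R]_(w in D) c%:E = c%:E * @lebesgue_measure R D)%E.
Proof.
move=> mD.
exact: (@integral_EFin_cst R _ (measurableTypeR R) lebesgue_measure D c mD).
Qed.

Lemma integral_probability1 {R : realType} d (T : measurableType d)
    (mu : probability T R) : (\int[mu]_h 1%:E = 1)%E.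
Proof. by rewrite integral_EFin_cst// mul1e; exact: probability_setT. Qed.

Lemma plane_tonelli {R : realType} (F : R * R -> \bar R) :
  measurable_fun setT F -> (forall p, 0 <= F p)%E ->
  (\int[plane R]_p F p =
   \int[@lebesgue_measure R]_y \int[@lebesgue_measure R]_x F (x, y))%E.
Proof.
move=> mF F0; exact: (@fubini_tonelli2 _ _ (measurableTypeR R)
  (measurableTypeR R) R lebesgue_measure lebesgue_measure F mF F0).
Qed.

Lemma sigma_finite_product {R : realType} d1 d2 (T1 : measurableType d1)
    (T2 : measurableType d2) (m1 : {sigma_finite_measure set T1 -> \bar R})
    (m2 : {sigma_finite_measure set T2 -> \bar R}) :
  sigma_finite setT (m1 \x m2)%E.
Proof.
have /sigma_finiteP[F [FT ndF Ffin]] := sigma_finiteT m1.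
have /sigma_finiteP[G [GT ndG Gfin]] := sigma_finiteT m2.
exists (fun n => F n `*` G n).
  apply/seteqP; split => // -[x y] _.
  have [i _ Fx] : (\bigcup_i F i) x by rewrite -FT.
  have [j _ Gy] : (\bigcup_j G j) y by rewrite -GT.
  exists (maxn i j) => //; split => /=.
    by move/subsetPset: (ndF _ _ (leq_maxl i j)); apply.
  by move/subsetPset: (ndG _ _ (leq_maxr i j)); apply.
move=> n; have [mF fF] := Ffin n; have [mG fG] := Gfin n.
split; first exact: measurableX.
by rewrite product_measure1E// lte_mul_pinfty// ge0_fin_numE.
Qed.

(** The product measure equipped with its sigma-finite structure, so that it can itself be a factor
    in Tonelli's theorem. *)
Definition sigma_finite_prod {R : realType} d1 d2 (T1 : measurableType d1)
    (T2 : measurableType d2) (m1 : {sigma_finite_measure set T1 -> \bar R})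
    (m2 : {sigma_finite_measure set T2 -> \bar R}) :
    {sigma_finite_measure set (T1 * T2)%type -> \bar R} :=
  HB.pack (m1 \x m2)%E (Measure_isSigmaFinite.Build _ _ _ (m1 \x m2)%E (sigma_finite_product m1 m2)).

Lemma marked_plane_tonelli {R : realType} (mu : probability R R)
    (F : (R * R) * R -> \bar R) :
  measurable_fun setT F -> (forall p, 0 <= F p)%E ->
  (\int[(plane R \x mu)%E]_z F z = \int[plane R]_p \int[mu]_h F (p, h))%E.
Proof.
move=> mF F0; exact: (@fubini_tonelli1 _ _
  (measurableTypeR R * measurableTypeR R)%type R R
  (sigma_finite_prod lebesgue_measure lebesgue_measure) mu F mF F0).
Qed.

(** * The generating functional of a Poisson process *)

Section dyadic_step.
Context {R : realType} (w : R * R -> R).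
Hypothesis mw : measurable_fun setT w.
Hypothesis w01 : forall p, 0 <= w p <= 1.

Definition box (n : nat) : set (R * R) :=
  [set p | `|p.1| <= n%:R /\ `|p.2| <= n%:R].

(** Index [j] carries the value [(j + 1) / 2^n]. The value 0 gets no level: points there, like those
    outside the box, contribute the factor 1, and every level keeps a factor strictly below 1. *)
Definition level (n j : nat) : set (R * R) :=
  [set p | box n p /\ Num.truncn (2 ^+ n * w p) = j.+1].

(** Rounds [w] down to a multiple of [2^-n] inside a box; [1 - step] therefore stays above [1 - w],
    the side from which infinite products converge. *)
Definition step (n : nat) (p : R * R) : R :=
  \sum_(j < 2 ^ n) j.+1%:R / 2 ^+ n * \1_(level n j) p.

Lemma bounded_level n j : bounded2 (level n j).
Proof. by exists n%:R => p [[]]. Qed.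

Lemma boxE n : box n = `[- n%:R, n%:R]%classic `*` `[- n%:R, n%:R]%classic.
Proof. by apply/seteqP; split => p; rewrite /box/= !in_itv/= !ler_norml. Qed.

Lemma measurable_box n : measurable (box n).
Proof. by rewrite boxE; exact: measurableX. Qed.

Lemma measurable_level n j : measurable (level n j).
Proof.
rewrite (_ : level n j = box n `&`
    (fun p => 2 ^+ n * w p) @^-1` `[j.+1%:R, j.+2%:R[%classic).
  apply: measurableI; first exact: measurable_box.
  rewrite -[X in measurable X]setTI.
  by apply: (measurable_funM (f := cst (2 ^+ n)) (g := w)).
have t0 p : 0 <= 2 ^+ n * w p by rewrite mulr_ge0//; have /andP[] := w01 p.
apply/seteqP; split => p /= [bp]; rewrite in_itv/= -truncn_eq// => h; split => //.
  by rewrite h.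
exact/eqP.
Qed.

Lemma trivIset_level n j j' : j != j' -> level n j `&` level n j' = set0.
Proof.
move=> jj'; apply/seteqP; split => // p /= [[_ h] [_ h']].
by move: h'; rewrite h => -[jE]; rewrite jE eqxx in jj'.
Qed.

Lemma level_lt n j p : level n j p -> (j < 2 ^ n)%N.
Proof.
move=> [_ tE]; have : (Num.truncn (2 ^+ n * w p))%:R <= 2 ^+ n :> R.
  have /andP[w0 w1] := w01 p.
  by rewrite (@le_trans _ _ (2 ^+ n * w p))// ?truncn_le ?mulr_ge0// ler_piMr.
by rewrite tE -natrX ler_nat.
Qed.

Lemma step_level n j p : level n j p -> step n p = j.+1%:R / 2 ^+ n.
Proof.
move=> lp; rewrite /step (bigD1 (Ordinal (level_lt lp)))//= indicE mem_set// mulr1.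
rewrite big1 ?addr0// => i ij; rewrite indicE memNset ?mulr0// => lp'.
have : (level n i `&` level n j) p by split.
by rewrite trivIset_level//; move: ij; rewrite -val_eqE.
Qed.

Lemma step_out n p : (forall j, ~ level n j p) -> step n p = 0.
Proof.
by move=> h; rewrite /step big1// => j _; rewrite indicE memNset ?mulr0//; exact: h.
Qed.

Lemma stepE n p : box n p -> step n p = (Num.truncn (2 ^+ n * w p))%:R / 2 ^+ n.
Proof.
move=> bp; case E : (Num.truncn (2 ^+ n * w p)) => [|j]; last exact: step_level.
by rewrite mul0r step_out// => j [_]; rewrite E.
Qed.

Lemma step_ge0 n p : 0 <= step n p.
Proof. by apply: sumr_ge0 => j _; rewrite !mulr_ge0. Qed.

Lemma step_le n p : step n p <= w p.
Proof.
have /andP[w0 w1] := w01 p.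
have [bp|nbp] := pselect (box n p); last by rewrite step_out// => j [].
by rewrite stepE// ler_pdivrMr// mulrC truncn_le mulr_ge0.
Qed.

Lemma step_cvg p : step n p @[n --> \oo] --> w p.
Proof.
have [N [N1 N2]] : exists N : nat, `|p.1| <= N%:R /\ `|p.2| <= N%:R.
  exists (Num.truncn (Num.max `|p.1| `|p.2|)).+1.
  have h := ltW (truncnS_gt (Num.max `|p.1| `|p.2|)).
  by split; rewrite (le_trans _ h)// le_max lexx ?orbT.
have c2 : w p - (2^-1) ^+ n @[n --> \oo] --> w p.
  rewrite -[X in _ --> X]subr0; apply: cvgB; first exact: cvg_cst.
  by apply: cvg_expr; rewrite ger0_norm// invf_lt1// ltr1n.
apply: (squeeze_cvgr _ c2 (cvg_cst (w p))).
exists N => // n /= Nn; rewrite step_le andbT stepE.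
  rewrite exprVn ler_pdivlMr// mulrBl mulVf// lerBlDr natr1 mulrC.
  exact: (ltW (truncnS_gt _)).
by split; [apply: (le_trans N1)|apply: (le_trans N2)]; rewrite ler_nat.
Qed.

Lemma measurable_step n : measurable_fun setT (step n).
Proof.
apply: (measurable_sum_ord (f := fun j p => j.+1%:R / 2 ^+ n * \1_(level n j) p)) => j.
apply: measurable_funM => //; apply: measurable_indic; exact: measurable_level.
Qed.

Lemma step_prod n p :
  \prod_(j < 2 ^ n) (if `[< level n j p >] then 1 - j.+1%:R / 2 ^+ n else 1)
  = 1 - step n p.
Proof.
have [[j lp]|h] := pselect (exists j, level n j p); last first.
  rewrite step_out; last by move=> j lp; apply: h; exists j.
  rewrite subr0 big1// => j _; case: asboolP => // lp; exfalso; apply: h.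
  by exists j.
rewrite (step_level lp) (bigD1 (Ordinal (level_lt lp)))//= asboolT// big1 ?mulr1//.
move=> i ij; rewrite asboolF// => lp'.
have : (level n i `&` level n j) p by split.
by rewrite trivIset_level//; move: ij; rewrite -val_eqE.
Qed.

Lemma integral_step n : (\int[plane R]_p (step n p)%:E =
  (\sum_(j < 2 ^ n) fine (leb2 (level n j)) * (j.+1%:R / 2 ^+ n))%:E)%E.
Proof.
have fin j : (leb2 (level n j) < +oo)%E.
  apply: (@le_lt_trans _ _ (plane R (box n))).
    apply: le_measure; rewrite ?inE; [exact: measurable_level|exact: measurable_box|].
    by move=> p [].
  have fI : (@lebesgue_measure R `[(- n%:R)%R, n%:R] < +oo)%E.
    by rewrite lebesgue_measure_itv/=; case: ifP => _; rewrite -?EFinB ltry.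
  by rewrite boxE product_measure1E// lte_mul_pinfty// ge0_fin_numE.
under eq_integral => p _ do rewrite -sumEFin.
rewrite ge0_integral_sum//.
- rewrite -sumEFin; apply: eq_bigr => j _.
  under eq_integral => p _ do rewrite EFinM.
  rewrite ge0_integralZl ?lee_fin//.
    rewrite integral_indic ?setIT//; last exact: measurable_level.
    by rewrite [RHS]EFinM fineK ?ge0_fin_numE ?fin ?measure_ge0// muleC.
  by apply/measurable_EFinP/measurable_indic; exact: measurable_level.
- move=> j; apply/measurable_EFinP; apply: measurable_funM => //.
  by apply: measurable_indic; exact: measurable_level.
Qed.

End dyadic_step.

(** The function approximated is [1 - v]: it is the integrable one, its approximations have bounded
    support, and approximating it from below means approximating [v] from above. *)
Lemma pgfl {R : realType} d (Omega : measurableType d)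
    (P : probability Omega R) (lam : R) (X : nat -> Omega -> R * R)
    (v : R * R -> R) :
  0 <= lam -> is_homogeneous_PPP P lam X ->
  measurable_fun setT v -> (forall p, 0 <= v p <= 1) ->
  (\int[plane R]_p (1 - v p)%:E < +oo)%E ->
  (\int[P]_w (iprod (fun i => v (X i w)))%:E
   = (expR (- lam * fine (\int[plane R]_p (1 - v p)%:E)))%:E)%E.
Proof.
move=> lam0 PPP mv v01 vfin; have [mX _] := PPP.
pose w p := 1 - v p.
have mw : measurable_fun setT w by apply: measurable_funB.
have w01 p : 0 <= w p <= 1.
  by rewrite /w; have /andP[v0 v1] := v01 p; apply/andP; split; lra.
have iw : (plane R).-integrable setT (EFin \o w).
  apply/integrableP; split; first exact/measurable_EFinP.
  have w0 p : 0 <= w p by have /andP[] := w01 p.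
  by under eq_integral => p _ do rewrite /= ger0_norm//.
have s01 n p : 0 <= 1 - step w n p <= 1.
  have h0 := step_ge0 w n p; have h1 := step_le w01 n p.
  by have /andP[_ w1] := w01 p; apply/andP; split; lra.
have ms := measurable_step mw w01.
have stepn n : (\int[P]_w0 (iprod (fun i => 1 - step w n (X i w0)))%:E =
    (expR (- lam * fine (\int[plane R]_p (step w n p)%:E)))%:E)%E.
  have := @pgfl_step R _ _ P lam X (2 ^ n) (level w n) (fun j => 1 - j.+1%:R / 2 ^+ n) lam0 PPP.
  move=> /(_ _ _ _ _) h.
  transitivity (\int[P]_w0 (iprod (fun i => \prod_(j < 2 ^ n) (if `[< level w n j (X i w0) >] then 1 - j.+1%:R / 2 ^+ n else 1)))%:E)%E.
    by apply: eq_integral => o _; congr ((iprod _)%:E); apply/funext => i; rewrite step_prod.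
  rewrite h.
  - rewrite (integral_step mw w01)/=; congr ((expR (_ * _))%:E).
    by apply: eq_bigr => j _; rewrite opprB addrCA subrr addr0.
  - exact: measurable_level.
  - exact: bounded_level.
  - exact: trivIset_level.
  - move=> j; rewrite subr_ge0 ler_pdivrMr// mul1r -natrX ler_nat ltn_ord/=.
    by rewrite ltrBlDr ltrDl divr_gt0.
have c1 : (\int[P]_w0 (iprod (fun i => 1 - step w n (X i w0)))%:E @[n --> \oo] -->
    \int[P]_w0 (iprod (fun i => v (X i w0)))%:E)%E.
  apply: bounded_cvg_integral => //.
  - move=> n; apply: (measurable_iprod (f := fun i o => 1 - step w n (X i o))) => // i.
    by apply: measurable_funB => //; exact: measurableT_comp.
  - apply: (measurable_iprod (f := fun i o => v (X i o))) => // i.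
    exact: measurableT_comp.
  - by move=> n o; apply: iprod_unit.
  - apply: aeW => o; apply: cvg_iprod_above.
    + by move=> i; have /andP[] := v01 (X i o).
    + by move=> n i; have := step_le w01 n (X i o); rewrite {2}/w; lra.
    + by move=> n i; have /andP[] := s01 n (X i o).
    + move=> i; rewrite (_ : v (X i o) = 1 - w (X i o)); last by rewrite /w; lra.
      by apply: cvgB; [exact: cvg_cst|exact: step_cvg].
have c2 : (\int[plane R]_p (step w n p)%:E @[n --> \oo] --> \int[plane R]_p (w p)%:E)%E.
  have := @dominated_convergence _ _ _ (plane R) setT measurableT
    (fun n p => (step w n p)%:E) (EFin \o w) (EFin \o w).
  move=> /(_ _ _ _ _ _)[] //.
  - by move=> n; apply/measurable_EFinP; exact: ms.
  - by apply/measurable_EFinP; exact: mw.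
  - by apply: aeW => p _; apply: cvg_EFin; [exact: nearW|exact: step_cvg].
  - by apply: aeW => p n _; rewrite /= lee_fin ger0_norm ?step_ge0//; exact: step_le.
have finw : (\int[plane R]_p (w p)%:E)%E \is a fin_num.
  by rewrite ge0_fin_numE//; apply: integral_ge0 => p _; rewrite lee_fin; have /andP[] := w01 p.
apply: (cvg_unique _ c1) => //.
rewrite (funext stepn); apply: cvg_EFin; first exact: nearW.
apply: (@continuous_cvg _ _ _ _ _ _ (fun x => expR x)); first exact: continuous_expR.
apply: cvgMr; apply: fine_cvg; rewrite fineK//.
Qed.

(** * The generating functional of the marked process *)

Section marks.
Context {R : realType} {d : measure_display} {Omega : measurableType d}
  (P : probability Omega R) (f : R -> R) (X : nat -> Omega -> R * R)
  (H : nat -> Omega -> R).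
Hypothesis f0 : forall t, 0 <= f t.
Hypothesis mf : measurable_fun setT f.
Hypothesis f1 : (\int[@lebesgue_measure R]_(t in setT) (f t)%:E = 1)%E.
Hypothesis iid : iid_marks_indep P f X H.

Let leb := @lebesgue_measure R.

Lemma density_fin D : measurable D ->
  ((Rintegral leb D f)%:E = \int[leb]_(t in D) (f t)%:E)%E.
Proof.
move=> mD; rewrite /Rintegral fineK// ge0_fin_numE; last first.
  by apply: integral_ge0 => t _; rewrite lee_fin.
apply: (@le_lt_trans _ _ (\int[leb]_(t in setT) (f t)%:E)%E); last by rewrite f1 ltry.
apply: ge0_subset_integral => //; first exact/measurable_EFinP.
by move=> t _; rewrite lee_fin.
Qed.

Lemma mark_law_exists : exists mu : probability R R,
  (forall B, measurable B -> mu B = P (H 0 @^-1` B)) /\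
  (forall B, measurable B -> mu B = (Rintegral leb B f)%:E).
Proof.
have [mH indep] := iid.
pose mix := isMeasurableFun.Build _ _ _ _ _ (mH 0).
pose H0 : {RV P >-> R} := HB.pack (H 0) mix.
exists (distribution P H0); split => // B mB.
(* The independence clause with no condition on points and a single one on marks is the statement
   that [H 0] has density [f]. *)
have := indep 0 (fun=> 0) (fun=> setT) 1 (fun=> 0) (fun=> B).
move=> /(_ _ _ _); rewrite big_ord_recl big_ord0 mulr1 => h.
transitivity (P [set w | (forall j : 'I_0, setT (X 0 w)) /\ (forall i : 'I_1, B (H 0 w))]).
  congr (P _); apply/seteqP; split => w /=; first by move=> Bw; split.
  by move=> [_ /(_ ord0)].
rewrite h//.
  rewrite (_ : [set w | _] = setT) ?probability_setT ?mul1e//.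
  by apply/seteqP; split.
by move=> i j _; rewrite !ord1.
Qed.

Variable mu : probability R R.
Hypothesis muE : forall B, measurable B -> mu B = (Rintegral leb B f)%:E.

Lemma mark_integral (g : R -> R) : measurable_fun setT g ->
  (forall t, 0 <= g t) ->
  (\int[mu]_h (g h)%:E = \int[leb]_t (g t * f t)%:E)%E.
Proof.
move=> mg g0.
have := @integral_transfer R _ _ _ _ _ _ mu leb id id (cst 1) f.
move=> /(_ _ _ _ _ _ _ _ (EFin \o g)) h.
transitivity (\int[mu]_w ((EFin \o g) (id w) * (cst 1 w)%:E))%E.
  by apply: eq_integral => w _; rewrite /= mule1.
rewrite h//.
- move=> D mD; rewrite preimage_id /= integral_EFin_cst//.
  by rewrite mul1e -density_fin//; exact: muE.
- exact/measurable_EFinP.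
Qed.

Lemma marked_indep M (C : nat -> set (R * R)) (B : nat -> set R) :
  (forall i, measurable (C i)) -> (forall i, measurable (B i)) ->
  P [set w | forall i : 'I_M, C i (X i w) /\ B i (H i w)] =
  (P [set w | forall i : 'I_M, C i (X i w)] * (\prod_(i < M) fine (mu (B i)))%:E)%E.
Proof.
move=> mC mB; have [_ indep] := iid.
have := indep M (fun i => i) (fun i => C i) M (fun i => i) (fun i => B i).
move=> /(_ (@ord_inj M) (fun i => mC i) (fun i => mB i)) h.
rewrite (_ : [set w | forall i : 'I_M, C i (X i w) /\ B i (H i w)] =
   [set w | (forall j : 'I_M, C j (X j w)) /\ (forall i : 'I_M, B i (H i w))]).
  rewrite h; congr (_ * (_)%:E)%E; apply: eq_bigr => i _.
  by rewrite muE.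
apply/seteqP; split => w /=; first by move=> hw; split => j; have [] := hw j.
by move=> [h1 h2] i; split.
Qed.

(** For finitely many factors the marks integrate out and replace [v] by its average over the mark.
    Letting the number of factors grow leaves the functional of the unmarked process at that
    average. *)
Lemma marked_pgfl (lam : R) (v : (R * R) * R -> R) :
  0 <= lam -> is_homogeneous_PPP P lam X ->
  measurable_fun setT v -> (forall z, 0 <= v z <= 1) ->
  (\int[(plane R \x mu)%E]_z (1 - v z)%:E < +oo)%E ->
  (\int[P]_w (iprod (fun i => v (X i w, H i w)))%:E
   = (expR (- lam * fine (\int[(plane R \x mu)%E]_z (1 - v z)%:E)))%:E)%E.
Proof.
move=> lam0 PPP mv v01; have [mX _] := PPP; have [mH _] := iid.
have kv01 p : 0 <= kmean mu v p <= 1 by exact: kmean_unit.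
have mkv : measurable_fun setT (kmean mu v) by exact: measurable_kmean.
have mXH i : measurable_fun setT (fun w => v (X i w, H i w)).
  by apply: (measurableT_comp mv); exact: measurable_fun_pair.
have mkX i : measurable_fun setT (fun w => kmean mu v (X i w)).
  exact: (measurableT_comp mkv).
have fubE : (\int[(plane R \x mu)%E]_z (1 - v z)%:E =
    \int[plane R]_p (1 - kmean mu v p)%:E)%E.
  rewrite marked_plane_tonelli.
  - apply: eq_integral => p _.
    have mvp : measurable_fun setT (fun h => v (p, h)) by exact: measurableT_comp.
    under eq_integral => h _ do rewrite EFinB.
    rewrite integralB//.
    + by rewrite integral_probability1 EFinB kmeanE.
    + apply/integrableP; split; first exact: measurable_cst.
      under eq_integral => h _ do rewrite /= normr1.
      by rewrite integral_probability1 ltry.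
    + apply/integrableP; split; first exact/measurable_EFinP.
      under eq_integral => h _ do rewrite /= (ger0_norm (proj1 (andP (v01 (p, h))))).
      have /andP[_ h] := integral_unit_fin mu mvp (fun h => v01 (p, h)).
      by rewrite (le_lt_trans h)// ltry.
  - by apply/measurable_EFinP; apply: measurable_funB.
  - by move=> z; rewrite lee_fin subr_ge0; have /andP[] := v01 z.
rewrite fubE => fin; refine (etrans _ (pgfl lam0 PPP mkv kv01 fin)).
have c1 : (\int[P]_w (\prod_(i < M) v (X i w, H i w))%:E @[M --> \oo] -->
    \int[P]_w (iprod (fun i => v (X i w, H i w)))%:E)%E.
  apply: bounded_cvg_integral => //.
  - by move=> M; apply: (measurable_prod_ord (f := fun i w => v (X i w, H i w))).
  - exact: (measurable_iprod (f := fun i w => v (X i w, H i w))).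
  - by move=> M w; apply: (prod_unit (v := fun i => v (X i w, H i w))).
  - by apply: aeW => w; apply: iprod_is_cvg.
have c2 : (\int[P]_w (\prod_(i < M) kmean mu v (X i w))%:E @[M --> \oo] -->
    \int[P]_w (iprod (fun i => kmean mu v (X i w)))%:E)%E.
  apply: bounded_cvg_integral => //.
  - by move=> M; apply: (measurable_prod_ord (f := fun i w => kmean mu v (X i w))).
  - exact: (measurable_iprod (f := fun i w => kmean mu v (X i w))).
  - by move=> M w; apply: (prod_unit (v := fun i => kmean mu v (X i w))).
  - by apply: aeW => w; apply: iprod_is_cvg.
apply: (cvg_unique _ c1) => //.
rewrite (_ : (fun M => _) = (fun M => \int[P]_w (\prod_(i < M) kmean mu v (X i w))%:E)%E)//.
apply/funext => M.
by rewrite (marking_prod mX mH (@marked_indep M) (g := fun=> v)).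
Qed.

End marks.

(** * The area of a sector *)

Lemma lebesgue_measure_affine {R : realType} (a b : R) (A : set R) :
  a != 0 -> measurable A ->
  (@lebesgue_measure R A =
   \int[@lebesgue_measure R]_(t in (fun t => (a * t + b)%R) @^-1` A) (`|a|)%:E)%E.
Proof.
move=> a0 mA; pose phi t := a * t + b.
have mphi : measurable_fun setT phi.
  by apply: measurable_funD => //; exact: measurable_funM.
have [mm mmE] := @weighted_law_exists R _ _ (measurableTypeR R) (measurableTypeR R)
  (@lebesgue_measure R) phi (cst `|a|) mphi
  (@measurable_cst _ _ _ _ _ `|a|) (fun=> normr_ge0 a).
rewrite -/phi; refine (etrans _ (mmE A)); apply: (@lebesgue_measure_unique R mm) => // _ [[x y] _ <-].
rewrite mmE /= integral_leb_cst; last first.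
  by rewrite -[X in measurable X]setTI; apply: mphi => //.
case: (ltgtP a 0) a0 => // a0 _.
(* A negative slope reverses the half-open interval: the closed end moves to the left. *)
- rewrite (_ : phi @^-1` _ = `[(y - b) / a, (x - b) / a[%classic); last first.
    apply/seteqP; split => t; rewrite /phi/= !in_itv/= => /andP[].
      move=> h1 h2; rewrite ler_ndivrMr// ltr_ndivlMr//; apply/andP; split; lra.
    rewrite ler_ndivrMr// ltr_ndivlMr// => h1 h2; apply/andP; split; lra.
  rewrite !lebesgue_measure_itv/= !lte_fin ltr_nM2r ?invr_lt0//.
  rewrite ltrD2r; case: ifP => _; last by rewrite mule0.
  by rewrite -!EFinB -EFinM ltr0_norm//; congr EFin; field; lra.
- rewrite (_ : phi @^-1` _ = `](x - b) / a, (y - b) / a]%classic); last first.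
    apply/seteqP; split => t; rewrite /phi/= !in_itv/= => /andP[].
      move=> h1 h2; rewrite ltr_pdivrMr// ler_pdivlMr//; apply/andP; split; lra.
    rewrite ltr_pdivrMr// ler_pdivlMr// => h1 h2; apply/andP; split; lra.
  rewrite !lebesgue_measure_itv/= !lte_fin ltr_pM2r ?invr_gt0//.
  rewrite ltrD2r; case: ifP => _; last by rewrite mule0.
  by rewrite -!EFinB -EFinM gtr0_norm//; congr EFin; field; lra.
Qed.

Lemma ge0_integral_affine {R : realType} (a b : R) (g : R -> \bar R) :
  a != 0 -> measurable_fun setT g -> (forall t, 0 <= g t)%E ->
  (\int[@lebesgue_measure R]_x g x =
   \int[@lebesgue_measure R]_t (g (a * t + b)%R * (`|a|)%:E))%E.
Proof.
move=> a0 mg g0; pose phi t := a * t + b.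
have mphi : measurable_fun setT phi.
  by apply: measurable_funD => //; exact: measurable_funM.
have := @integral_transfer R _ _ _ _ _ _ (@lebesgue_measure R)
  (@lebesgue_measure R) id phi (cst 1) (cst `|a|).
move=> /(_ _ _ _ _ _ _ _ g) h; rewrite -h//.
- by apply: eq_integral => x _; rewrite /= mule1.
- move=> D mD; rewrite preimage_id /= [LHS]integral_leb_cst//.
  by rewrite mul1e (lebesgue_measure_affine b a0).
Qed.

(* Substituting [x = x0 + y t] on each horizontal line turns rays through
   [(x0, y0)] into vertical lines. *)
Lemma integral_plane_slopes {R : realType} (x0 : R * R) (F : R * R -> \bar R) :
  measurable_fun setT F -> (forall p, 0 <= F p)%E ->
  (\int[plane R]_p F p = \int[@lebesgue_measure R]_t \int[@lebesgue_measure R]_y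
     (F (x0.1 + y * t, x0.2 + y)%R * (`|y|)%:E))%E.
Proof.
move=> mF F0; rewrite plane_tonelli//.
have mG : measurable_fun setT (fun y => \int[@lebesgue_measure R]_x F (x, y))%E.
  exact: (@measurable_fun_fubini_tonelli_G _ _ (measurableTypeR R) (measurableTypeR R) R lebesgue_measure F mF F0).
have m2 : measurable_fun setT (fun z : R * R => (x0.1 + z.2 * z.1, x0.2 + z.2)).
  apply: measurable_fun_pair; apply: measurable_funD => //.
  exact: measurable_funM.
have mH : measurable_fun setT (fun z : R * R => F (x0.1 + z.2 * z.1, x0.2 + z.2)%R * (`|z.2|)%:E)%E.
  apply: emeasurable_funM; first exact: (measurableT_comp mF m2).
  by apply/measurable_EFinP; exact: measurableT_comp.
rewrite (ge0_integral_affine x0.2 (oner_neq0 R))//; last first.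
  by move=> y; apply: integral_ge0 => x _.
rewrite (@fubini_tonelli _ _ (measurableTypeR R) (measurableTypeR R) R
  lebesgue_measure lebesgue_measure
  (fun z : R * R => F (x0.1 + z.2 * z.1, x0.2 + z.2)%R * (`|z.2|)%:E)%E)//; last first.
  by move=> z; rewrite mule_ge0// lee_fin.
have msh : measurable_fun setT (fun y : R => 1 * y + x0.2).
  by apply: measurable_funD => //; exact: measurable_funM.
have mK : measurable_fun setT (fun y : R => \int[@lebesgue_measure R]_x
    (F (x0.1 + y * x, x0.2 + y)%R * `|y|%:E))%E.
  apply: (@measurable_fun_fubini_tonelli_G _ _ (measurableTypeR R) (measurableTypeR R) R lebesgue_measure
    (fun z : R * R => F (x0.1 + z.2 * z.1, x0.2 + z.2)%R * (`|z.2|)%:E)%E) => //.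
  by move=> z; rewrite mule_ge0// lee_fin.
apply: ge0_ae_eq_integral => //=.
- apply: emeasurable_funM => //.
  exact: (measurableT_comp mG msh).
- by move=> y _; rewrite mule_ge0// ?lee_fin//; apply: integral_ge0 => x _.
- by move=> y _; apply: integral_ge0 => x _; rewrite mule_ge0// lee_fin.
(* The substitution degenerates on the horizontal line through [x0], which is the exceptional null
   set. *)
- exists [set 0]; split => //; first exact: lebesgue_measure_set1.
  move=> y /= h; apply: contrapT => y0; apply: h => _.
  have y0' : y != 0 by apply/eqP.
  rewrite mul1r normr1 mule1 (addrC y).
  rewrite (ge0_integral_affine x0.1 y0')//; last first.
    by apply: (measurableT_comp mF); exact: measurable_fun_pair.
  by apply: eq_integral => x _; rewrite (addrC (y * x)).
Qed.

Lemma integral_if {R : realType} d (T : measurableType d)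
    (m : {measure set T -> \bar R}) (b : T -> bool) (g : T -> R) :
  (\int[m]_t (if b t then g t else 0)%:E =
   \int[m]_(t in [set t | b t]) (g t)%:E)%E.
Proof.
rewrite [RHS]integral_mkcond; apply: eq_integral => t _.
rewrite /patch; case: ifPn => bt; first by rewrite mem_set.
by rewrite memNset//=; exact/negP.
Qed.

Lemma integral_oneDsqr_ge {R : realType} (a : R) :
  (\int[@lebesgue_measure R]_t (if a <= t then (1 + t ^+ 2)^-1 else 0)%:E =
   (pi / 2 - atan a)%:E)%E.
Proof.
rewrite integral_if (_ : [set t | a <= t] = `[a, +oo[%classic); last first.
  by apply/seteqP; split => t /=; rewrite in_itv/= andbT.
rewrite (ge0_continuous_FTC2y _ _ (@cvgy_atan R))/=.
- by rewrite EFinB.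
- by move=> x _; rewrite invr_ge0 addr_ge0// sqr_ge0.
- apply/continuous_within_itvcyP; split.
    by move=> x x0; apply: continuous_oneDsqrV.
  by apply: cvg_at_right_filter; exact: continuous_oneDsqrV.
- by move=> x x0; exact: derivable_atan.
- by apply: cvg_at_right_filter; exact: continuous_atan.
- by move=> x _; exact: derive1_atan.
Qed.

Lemma measurable_oneDsqrV {R : realType} :
  measurable_fun setT (fun t : R => (1 + t ^+ 2)^-1).
Proof. by apply: continuous_measurable_fun; exact: continuous_oneDsqrV. Qed.

Lemma oneDsqrV_ge0 {R : realType} (t : R) : 0 <= (1 + t ^+ 2)^-1.
Proof. by rewrite invr_ge0 addr_ge0// sqr_ge0. Qed.

Lemma integral_oneDsqrT {R : realType} :
  (\int[@lebesgue_measure R]_t ((1 + t ^+ 2)^-1)%:E = pi%:E)%E.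
Proof.
have m0 (b : R -> bool) : measurable [set t | b t] ->
    measurable_fun setT (fun t => (if b t then (1 + t ^+ 2)^-1 else 0)%:E).
  move=> mb; apply/measurable_EFinP; apply: measurable_fun_ifT => //.
    apply: (@measurable_fun_bool _ _ _ _ true); rewrite setTI.
    by rewrite (_ : _ @^-1` _ = [set t | b t]).
  exact: measurable_oneDsqrV.
have mge : measurable [set t : R | 0 <= t].
  by rewrite (_ : [set _ | _] = `[0, +oo[%classic)//; apply/seteqP; split => t /=; rewrite in_itv/= andbT.
have mlt : measurable [set t : R | t < 0].
  by rewrite (_ : [set _ | _] = `]-oo, 0[%classic)//; apply/seteqP; split => t /=; rewrite in_itv.
transitivity (\int[@lebesgue_measure R]_t
    ((if 0 <= t then (1 + t ^+ 2)^-1 else 0)%:E + (if t < 0 then (1 + t ^+ 2)^-1 else 0)%:E))%E.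
  by apply: eq_integral => t _; case: leP => _; rewrite ?adde0 ?add0e.
rewrite ge0_integralD//; last 4 first.
- by move=> t _; rewrite lee_fin; case: ifP => // _; exact: oneDsqrV_ge0.
- exact: m0.
- by move=> t _; rewrite lee_fin; case: ifP => // _; exact: oneDsqrV_ge0.
- exact: m0.
rewrite integral_oneDsqr_ge atan0 subr0.
have N10 : (-1 : R) != 0 by rewrite oppr_eq0 oner_eq0.
rewrite (ge0_integral_affine 0 N10); last 2 first.
- exact: m0.
- by move=> t; rewrite lee_fin; case: ifP => // _; exact: oneDsqrV_ge0.
transitivity ((pi / 2)%:E + \int[@lebesgue_measure R]_t (if 0 <= t then (1 + t ^+ 2)^-1 else 0 : R)%:E)%E.
  congr (_ + _)%E; apply: ge0_ae_eq_integral => //.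
  - apply: emeasurable_funM => //.
    rewrite (_ : (fun t : R => _) = (fun t : R => (if t > 0 then (1 + t ^+ 2)^-1 else 0)%:E)).
      apply: m0; rewrite (_ : [set _ | _] = `]0, +oo[%classic)//.
      by apply/seteqP; split => t /=; rewrite in_itv/= andbT.
    by apply/funext => t; rewrite addr0 mulN1r oppr_lt0 sqrrN.
  - exact: m0.
  - by move=> t _; rewrite mule_ge0// lee_fin; case: ifP => // _; exact: oneDsqrV_ge0.
  - by move=> t _; rewrite lee_fin; case: ifP => // _; exact: oneDsqrV_ge0.
  - exists [set 0]; split => //; first exact: lebesgue_measure_set1.
    move=> t /= h; apply: contrapT => t0; apply: h => _.
    rewrite addr0 mulN1r oppr_lt0 sqrrN normrN normr1 mule1 le_eqVlt eq_sym.
    by move/eqP/negbTE : t0 => ->.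
by rewrite integral_oneDsqr_ge atan0 subr0 -EFinD; congr EFin; field.
Qed.

(** [pi / 2 - atan t] is the angle of the upward direction [(t, 1)], with derivative [-(1 + t^2)^-1]
    in [t]. The integral thus measures the angles up to [psi], capped at the opening [pi] of a half
    plane. *)
Lemma integral_slope_angle {R : realType} (psi : R) : 0 <= psi ->
  (\int[@lebesgue_measure R]_t (if pi / 2 - atan t <= psi then (1 + t ^+ 2)^-1 else 0)%:E =
   (Num.min psi pi)%:E)%E.
Proof.
rewrite le_eqVlt => /predU1P[<-|psi0].
  rewrite min_l ?pi_ge0// (eq_integral (cst 0%E)) ?integral0// => t _.
  by rewrite leNgt subr_gt0 atan_ltpi2.
have [pipsi|psipi] := leP pi psi.
  rewrite -integral_oneDsqrT; apply: eq_integral => t _; rewrite ifT//.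
  by have := atan_gtNpi2 t; lra.
(* [tan (pi / 2 - psi)] is the cotangent of [psi], the value of [t] at which the angle is [psi]. The
   end cases were split off because the tangent is inverted on an open interval only. *)
have i0 : pi / 2 - psi \in `](- (pi / 2)), (pi / 2)[.
  by rewrite in_itv/=; apply/andP; split; lra.
transitivity (\int[@lebesgue_measure R]_t (if tan (pi / 2 - psi) <= t then (1 + t ^+ 2)^-1 else 0)%:E)%E.
  apply: eq_integral => t _; congr ((if _ then _ else _)%:E).
  have aE := tanK i0; apply/idP/idP => h.
    rewrite leNgt; apply/negP => /lt_atan; rewrite aE; lra.
  have := le_atan h; rewrite aE; lra.
by rewrite integral_oneDsqr_ge tanK//; congr EFin; ring.
Qed.

Lemma integral_radius {R : realType} (c : R) : 0 <= c ->
  (\int[@lebesgue_measure R]_y (if 0 < y < c then y else 0)%:E = (c ^+ 2 / 2)%:E)%E.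
Proof.
rewrite le_eqVlt => /predU1P[<-|c0].
  rewrite expr0n/= mul0r (eq_integral (cst 0%E)) ?integral0// => t _.
  by case: ltgtP.
rewrite integral_if (_ : [set t | 0 < t < c] = `]0, c[%classic)//.
rewrite -(@integral_itv_bndoo _ _ _ _ true false); last first.
  exact/measurable_EFinP.
rewrite (@continuous_FTC2 _ _ (fun y => y ^+ 2 / 2))//.
- by rewrite expr0n/= mul0r sube0.
- by apply: continuous_subspaceT => y.
- split.
  + by move=> y _; apply: derivableM => //; exact: derivable_cst.
  + apply: cvg_at_right_filter; apply: cvgMl; exact: exprn_continuous.
  + apply: cvg_at_left_filter; apply: cvgMl; exact: exprn_continuous.
- move=> y _; rewrite derive1E deriveM//.
  by rewrite derive_cst scaler0 add0r exp_derive /= scaler1 /GRing.scale/= expr1; field.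
Qed.

Lemma acos_slope {R : realType} (t : R) :
  acos (t / Num.sqrt (1 + t ^+ 2)) = pi / 2 - atan t.
Proof.
have h1 := atan_gtNpi2 t; have h2 := atan_ltpi2 t.
rewrite -[RHS]cosK; last by rewrite in_itv/=; apply/andP; split; lra.
congr acos; rewrite -cosN opprB cosBpihalf.
have s0 : Num.sqrt (1 + t ^+ 2) != 0.
  by rewrite sqrtr_eq0 -ltNge (@lt_le_trans _ _ 1)// lerDl sqr_ge0.
have E : sin (atan t) * Num.sqrt (1 + t ^+ 2) = t.
  by rewrite -[RHS](atanK t) /tan cos_atan invrK.
by rewrite -{1}E mulfK.
Qed.

Section sector.
Context {R : realType} (x0 : R * R) (phi : R).
Hypothesis phi0 : 0 < phi.
Hypothesis phi2 : phi <= 2 * pi.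

Definition radius (p : R * R) : R := norm2 (p.1 - x0.1, p.2 - x0.2).

Lemma radius_ge0 p : 0 <= radius p.
Proof. exact: sqrtr_ge0. Qed.

Lemma measurable_radius : measurable_fun setT radius.
Proof.
rewrite /radius /norm2/=.
apply: (measurableT_comp (f := @Num.sqrt R)).
  by apply: continuous_measurable_fun; exact: sqrt_continuous.
by apply: measurable_funD; apply: measurable_funX; apply: measurable_funB.
Qed.

Lemma cosine_itv (u v : R) : -1 <= u / Num.sqrt (u ^+ 2 + v ^+ 2) <= 1.
Proof.
have h0 : 0 <= Num.sqrt (u ^+ 2 + v ^+ 2) by exact: sqrtr_ge0.
have [->|s0] := eqVneq (Num.sqrt (u ^+ 2 + v ^+ 2)) 0.
  by rewrite invr0 mulr0 oppr_le0 ler01.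
rewrite -ler_norml normrM normfV (ger0_norm h0) ler_pdivrMr ?lt0r ?s0// mul1r.
by rewrite -sqrtr_sqr ler_sqrt ?lerDl ?sqr_ge0// addr_ge0 ?sqr_ge0.
Qed.

(** Trades [acos] for a comparison with a cosine, from which measurability of the sector can be read
    off. *)
Lemma le_acos (u psi : R) : -1 <= u <= 1 -> 0 <= psi ->
  (acos u <= psi) = (pi <= psi) || (cos psi <= u).
Proof.
move=> u1 psi0; have a0 := acos_ge0 u1; have api := acos_lepi u1.
have [pipsi|psipi] := leP pi psi; first by rewrite (le_trans api).
have uK : cos (acos u) = u by apply: acosK; rewrite in_itv.
by rewrite /= -{2}uK !leNgt ltr_cos// in_itv/=; apply/andP; split => //; exact: ltW.
Qed.

Lemma ge_acos (u psi : R) : -1 <= u <= 1 -> 0 <= psi ->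
  (psi <= acos u) = (psi <= pi) && (u <= cos psi).
Proof.
move=> u1 psi0; have a0 := acos_ge0 u1; have api := acos_lepi u1.
have [psipi|pipsi] := leP psi pi; last first.
  by apply/negbTE; rewrite -ltNge (le_lt_trans api).
have uK : cos (acos u) = u by apply: acosK; rewrite in_itv.
by rewrite /= -{2}uK !leNgt ltr_cos// in_itv/=; apply/andP.
Qed.

Lemma measurable_in_sector : measurable_fun setT (in_sector x0 phi).
Proof.
pose u (p : R * R) := (p.1 - x0.1) / radius p.
have mu : measurable_fun setT u.
  apply: measurable_funM; first exact: measurable_funB.
  rewrite (_ : (fun p => _) = fun p => radius p `^ (-1)); last first.
    by apply/funext => p; rewrite powR_inv1// radius_ge0.
  by apply: (measurableT_comp (f := fun z : R => z `^ (-1))); [exact: measurable_powR|exact: measurable_radius].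
rewrite (_ : in_sector x0 phi = fun p => if 0 <= p.2 - x0.2
    then (pi <= phi) || (cos phi <= u p)
    else (2 * pi - phi <= pi) && (u p <= cos (2 * pi - phi))); last first.
  apply/funext => p; rewrite /in_sector /angle2/=; case: ifP => _.
    rewrite le_acos ?(ltW phi0)//; exact: cosine_itv.
  rewrite lerBlDr addrC -lerBlDr ge_acos ?subr_ge0//; exact: cosine_itv.
apply: measurable_fun_ifT.
- by apply: measurable_fun_ler => //; exact: measurable_funB.
- by case: (pi <= phi) => //=; apply: measurable_fun_ler.
- by case: (_ <= pi) => //=; apply: measurable_fun_ler.
Qed.

Lemma radius_slope t y : radius (x0.1 + y * t, x0.2 + y) =
  `|y| * Num.sqrt (1 + t ^+ 2).
Proof.
rewrite /radius /norm2/= !(addrC _ (- _)) !addKr.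
rewrite (_ : (y * t) ^+ 2 + y ^+ 2 = y ^+ 2 * (1 + t ^+ 2)); last by ring.
by rewrite sqrtrM ?sqr_ge0// sqrtr_sqr.
Qed.

(** A point of the lower half plane has angle [pi] more than its reflection through the apex, which
    lies on the same line; hence the bound [phi - pi]. *)
Lemma in_sector_slope t y : y != 0 ->
  in_sector x0 phi (x0.1 + y * t, x0.2 + y) =
  (pi / 2 - atan t <= if 0 < y then phi else phi - pi).
Proof.
move=> y0; have := radius_slope t y.
have s0 : 0 < Num.sqrt (1 + t ^+ 2).
  by rewrite sqrtr_gt0 (@lt_le_trans _ _ 1)// lerDl sqr_ge0.
have e1 : x0.1 + y * t - x0.1 = y * t by ring.
have e2 : x0.2 + y - x0.2 = y by ring.
rewrite /radius /in_sector /angle2/= e1 e2 => ->.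
rewrite -acos_slope le0r (negbTE y0)/=; case: ltP => hy.
  rewrite gtr0_norm//; congr (acos _ <= _); field.
  by rewrite y0 gt_eqF.
have {}hy : y < 0 by rewrite lt_neqAle y0.
rewrite ltr0_norm// (_ : y * t / (- y * _) = - (t / Num.sqrt (1 + t ^+ 2))); last first.
  by field; rewrite y0 gt_eqF.
rewrite acosN; last by have := cosine_itv t 1; rewrite expr1n addrC.
by apply/idP/idP; lra.
Qed.

(** On the line of parameter [t] the radius is [|y| * sqrt (1 + t^2)] and the Jacobian is [|y|], so
    each half line inside the sector contributes [r^2 / 2 * (1 + t^2)^-1]. Integrating in [t] then
    measures the angle. *)
Lemma area_sector (r : R) : 0 <= r ->
  (\int[plane R]_p (if in_sector x0 phi p && (radius p < r) then 1 else 0 : R)%:E =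
   (phi * r ^+ 2 / 2)%:E)%E.
Proof.
move=> r0; have phi0' := ltW phi0; have phi2' := phi2.
have mF : measurable_fun setT
    (fun p => (if in_sector x0 phi p && (radius p < r) then 1 else 0 : R)%:E).
  apply/measurable_EFinP; apply: measurable_fun_ifT => //.
  apply: measurable_and; first exact: measurable_in_sector.
  by apply: measurable_fun_ltr => //; exact: measurable_radius.
rewrite (integral_plane_slopes x0 mF); last by move=> p; rewrite lee_fin; case: ifP.
have mrad (c : R) : measurable_fun setT (fun y : R => (if 0 < y < c then y else 0)).
  apply: measurable_fun_ifT => //; apply: measurable_and; exact: measurable_fun_ltr.
have mradN (c : R) : measurable_fun setT (fun y : R => (if 0 < - y < c then - y else 0)).
  by apply: (measurableT_comp (mrad c)); exact: measurable_funN.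
have radN (c : R) : 0 <= c -> (\int[@lebesgue_measure R]_y
    (if 0 < - y < c then - y else 0)%:E = (c ^+ 2 / 2)%:E)%E.
  move=> c0; have N10 : (-1 : R) != 0 by rewrite oppr_eq0 oner_eq0.
  rewrite -integral_radius// (ge0_integral_affine 0 N10).
  - by apply: eq_integral => y _; rewrite normrN normr1 mule1 mulN1r addr0 opprK.
  - by apply/measurable_EFinP; exact: mradN.
  - by move=> y; rewrite lee_fin; case: ifP => // /andP[/ltW].
pose th (t : R) : R := pi / 2 - atan t.
pose g (psi t : R) : R := if th t <= psi then (1 + t ^+ 2)^-1 else 0.
have inner t : (\int[@lebesgue_measure R]_y
    ((if in_sector x0 phi (x0.1 + y * t, x0.2 + y)%R &&
         (radius (x0.1 + y * t, x0.2 + y)%R < r)%R then 1 else 0 : R)%:E * `|y|%:E) =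
    ((g phi t + g (phi - pi) t) * (r ^+ 2 / 2))%:E)%E.
  have s0 : 0 < Num.sqrt (1 + t ^+ 2).
    by rewrite sqrtr_gt0 (@lt_le_trans _ _ 1)// lerDl sqr_ge0.
  have s2 : Num.sqrt (1 + t ^+ 2) ^+ 2 = 1 + t ^+ 2.
    by rewrite sqr_sqrtr// addr_ge0// sqr_ge0.
  pose c := r / Num.sqrt (1 + t ^+ 2).
  have c0 : 0 <= c by rewrite divr_ge0// ltW.
  pose k psi : R := if th t <= psi then 1 else 0.
  have k0 psi : 0 <= k psi by rewrite /k; case: ifP.
  transitivity (\int[@lebesgue_measure R]_y
      ((k phi)%:E * (if 0 < y < c then y else 0)%:E +
       (k (phi - pi)%R)%:E * (if 0 < - y < c then - y else 0)%:E))%E.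
    apply: eq_integral => y _.
    have [->|y0] := eqVneq y 0.
      by rewrite normr0 mule0 oppr0 ltxx/= !mule0 adde0.
    rewrite in_sector_slope// radius_slope -ltr_pdivlMr// -/c -/(th t) /k.
    rewrite -!EFinM -EFinD; congr EFin.
    case: (ltgtP 0 y) y0 => // hy _.
      rewrite gtr0_norm// oppr_gt0 (lt_gtF hy)/= mulr0 addr0.
      by case: (th t <= phi) => /=; rewrite ?mul0r ?mul1r//; case: ifP; rewrite ?mul1r ?mul0r.
    rewrite ltr0_norm// oppr_gt0 hy/= mulr0 add0r.
    by case: (th t <= phi - pi) => /=; rewrite ?mul0r ?mul1r//; case: ifP; rewrite ?mul1r ?mul0r.
  rewrite ge0_integralD//.
  - rewrite !ge0_integralZl ?lee_fin//.
    + rewrite integral_radius// radN// -!EFinM -EFinD /c /g /k; congr EFin.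
      rewrite expr_div_n s2; have h := oneDsqrV_ge0 t.
      by case: (th t <= phi); case: (th t <= phi - pi); ring.
    + by apply/measurable_EFinP; first [exact: mrad|exact: mradN].
    + by move=> y _; rewrite lee_fin; case: ifP => // /andP[/ltW].
    + by apply/measurable_EFinP; first [exact: mrad|exact: mradN].
    + by move=> y _; rewrite lee_fin; case: ifP => // /andP[/ltW].
  - by move=> y _; rewrite -EFinM lee_fin mulr_ge0//; case: ifP => // /andP[/ltW].
  - by apply: emeasurable_funM => //; apply/measurable_EFinP; first [exact: mrad|exact: mradN].
  - by move=> y _; rewrite -EFinM lee_fin mulr_ge0//; case: ifP => // /andP[/ltW].
  - by apply: emeasurable_funM => //; apply/measurable_EFinP; first [exact: mrad|exact: mradN].
under eq_integral => t _ do rewrite inner.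
have g0 psi t : 0 <= g psi t by rewrite /g; case: ifP => // _; exact: oneDsqrV_ge0.
have mg psi : measurable_fun setT (g psi).
  apply: measurable_fun_ifT => //; last exact: measurable_oneDsqrV.
  apply: measurable_fun_ler => //; apply: measurable_funB => //.
  by apply: continuous_measurable_fun; exact: continuous_atan.
under eq_integral => t _ do rewrite EFinM.
rewrite ge0_integralZr ?lee_fin ?divr_ge0 ?sqr_ge0//; last 2 first.
- by apply/measurable_EFinP; apply: measurable_funD; exact: mg.
- by move=> t _; rewrite lee_fin addr_ge0.
under eq_integral => t _ do rewrite EFinD.
rewrite ge0_integralD//; last 4 first.
- by move=> t _; rewrite lee_fin.
- by apply/measurable_EFinP; exact: mg.
- by move=> t _; rewrite lee_fin.
- by apply/measurable_EFinP; exact: mg.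
rewrite /g /th integral_slope_angle//.
(* The upper half plane contributes [min(phi, pi)], the lower one [phi - pi] when this is
   nonnegative and nothing otherwise; the total is [phi] in both cases. *)
have [pphi|phip] := leP pi phi.
  rewrite integral_slope_angle ?subr_ge0//.
  rewrite min_l; last by lra.
  by rewrite -EFinD -EFinM; congr EFin; field.
rewrite (eq_integral (cst 0%E)); last first.
  by move=> t _; rewrite ifF//; apply/negbTE; rewrite -ltNge; have := atan_ltpi2 t; lra.
by rewrite integral0 adde0 -EFinM; congr EFin; field.
Qed.

End sector.

(** * Layer-cake integrals and the incomplete gamma function *)

(** [powR] yields the inverse of nonnegative numbers only, hence the detour through the square; at 0
    both expressions are 0. *)
Lemma measurable_inv {R : realType} : measurable_fun setT (@GRing.inv R).
Proof.
rewrite (_ : @GRing.inv R = fun z => z * (z ^+ 2) `^ (-1)).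
  apply: measurable_funM => //.
  apply: (measurableT_comp (f := fun z : R => z `^ (-1))); first exact: measurable_powR.
  exact: measurable_funX.
apply/funext => z; rewrite powR_inv1 ?sqr_ge0//.
have [->|z0] := eqVneq z 0; first by rewrite invr0 mul0r.
by field.
Qed.

Lemma integral_expRN {R : realType} (y : R) : 0 <= y ->
  (\int[@lebesgue_measure R]_t (if 0 < t < y then expR (- t) else 0)%:E =
   (1 - expR (- y))%:E)%E.
Proof.
rewrite le_eqVlt => /predU1P[<-|y0].
  rewrite oppr0 expR0 subrr (eq_integral (cst 0%E)) ?integral0// => t _.
  by case: ltgtP.
have cexp : continuous (fun t : R => expR (- t)).
  by move=> t; apply: continuous_comp; [exact: opp_continuous|exact: continuous_expR].
rewrite integral_if (_ : [set t | 0 < t < y] = `]0, y[%classic)//.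
rewrite -(@integral_itv_bndoo _ _ _ _ true false); last first.
  by apply/measurable_EFinP/measurable_funTS; exact: continuous_measurable_fun.
rewrite (@continuous_FTC2 _ _ (fun t => - expR (- t)))//.
- by rewrite oppr0 expR0 -EFinB; congr EFin; ring.
- by apply: continuous_subspaceT => t; exact: cexp.
- split.
  + by move=> t _; apply: ex_derive.
  + by apply: cvg_at_right_filter; apply: cvgN; exact: cexp.
  + by apply: cvg_at_left_filter; apply: cvgN; exact: cexp.
- by move=> t _; rewrite derive1E derive_val; ring.
Qed.

Lemma integral_power {R : realType} (a t B : R) : a != 0 -> 0 < t -> t < B ->
  (\int[@lebesgue_measure R]_u (if t < u <= B then u `^ (a - 1) else 0)%:E =
   (a^-1 * (B `^ a - t `^ a))%:E)%E.
Proof.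
move=> a0 t0 tB.
have cp (b u : R) : 0 < u -> {for u, continuous (fun v : R => v `^ b)}.
  move=> u0; apply/differentiable_continuous/derivable1_diffP.
  by apply: derivable_powR; rewrite in_itv/= andbT.
rewrite integral_if (_ : [set u | t < u <= B] = `]t, B]%classic)//.
rewrite integral_itv_obnd_cbnd; last first.
  by apply/measurable_EFinP/measurable_funTS; exact: measurable_powR.
rewrite (@continuous_FTC2 _ _ (fun u => a^-1 * u `^ a))//.
- by rewrite -EFinB; congr EFin; ring.
- apply: continuous_in_subspaceT => u; rewrite inE/= in_itv/= => /andP[tu _].
  by apply: cp; exact: lt_le_trans tu.
- split.
  + move=> u; rewrite in_itv/= => /andP[tu _]; apply: derivableM => //.
    by apply: derivable_powR; rewrite in_itv/= andbT (lt_trans t0).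
  + by apply: cvg_at_right_filter; apply: cvgMr; exact: cp.
  + by apply: cvg_at_left_filter; apply: cvgMr; apply: cp; exact: lt_trans tB.
- move=> u; rewrite in_itv/= => /andP[tu _].
  have u0 := lt_trans t0 tu.
  have h := @is_derive1_powR R a u u0.
  have dp : derivable (fun v : R => v `^ a) u 1 by apply: derivable_powR; rewrite in_itv/= andbT.
  rewrite derive1E deriveM// (@derive_val _ _ _ _ _ _ _ h).
  by rewrite derive_cst scaler0 addr0 /GRing.scale/=; field.
Qed.

Lemma measurable_itv_test {R : realType} d (T : measurableType d) (y : T -> R) (t B : R) :
  measurable_fun setT y -> measurable_fun setT (fun p => t < y p <= B).
Proof.
by move=> my; apply: measurable_and; [exact: measurable_fun_ltr|exact: measurable_fun_ler].
Qed.

(** [1 - e^(-y)] is the integral of [e^(-t)] over [0 < t < y]; Tonelli exchanges it with [m],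
    leaving only the masses of the windows [t < y <= B]. *)
Lemma layer_cake {R : realType} d (T : measurableType d)
    (m : {sigma_finite_measure set T -> \bar R}) (y w : T -> R) (B : R) :
  measurable_fun setT y -> measurable_fun setT w -> (forall p, 0 <= w p) ->
  (\int[m]_p (if 0 < y p <= B then w p * (1 - expR (- y p)) else 0)%:E =
   \int[@lebesgue_measure R]_t ((if 0 < t then expR (- t) else 0)%:E *
      \int[m]_p (if t < y p <= B then w p else 0)%:E))%E.
Proof.
move=> my mw w0.
pose F (z : T * R) : R := if (0 < z.2) && (z.2 < y z.1 <= B) then w z.1 * expR (- z.2) else 0.
have my1 : measurable_fun setT (fun z : T * R => y z.1) by exact: measurableT_comp.
have mw1 : measurable_fun setT (fun z : T * R => w z.1) by exact: measurableT_comp.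
have mexp : measurable_fun setT (fun t : R => expR (- t)).
  by apply: measurableT_comp => //; exact: measurable_funN.
have mF : measurable_fun setT (EFin \o F).
  apply/measurable_EFinP; apply: measurable_fun_ifT => //.
    apply: measurable_and; first by apply: measurable_fun_ltr => //.
    by apply: measurable_and; [apply: measurable_fun_ltr|apply: measurable_fun_ler].
  by apply: measurable_funM => //; exact: (measurableT_comp mexp).
have F0 z : (0 <= (EFin \o F) z)%E.
  by rewrite /= lee_fin /F; case: ifP => // _; rewrite mulr_ge0// expR_ge0.
transitivity (\int[m]_p \int[@lebesgue_measure R]_t (F (p, t))%:E)%E.
  apply: eq_integral => p _; case: ifPn => [/andP[y0 yB]|h].
    transitivity (\int[@lebesgue_measure R]_t ((w p)%:E * (if 0 < t < y p then expR (- t) else 0)%:E))%E.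
      rewrite ge0_integralZl ?lee_fin//.
      - by rewrite integral_expRN ?(ltW y0)// EFinM.
      - apply/measurable_EFinP; apply: measurable_fun_ifT => //.
        by apply: measurable_and; apply: measurable_fun_ltr.
      - by move=> t _; rewrite lee_fin; case: ifP => // _; exact: expR_ge0.
    apply: eq_integral => t _; rewrite -EFinM /F/= yB andbT.
    by case: ifP => // _; rewrite mulr0.
  rewrite (eq_integral (cst 0%E)) ?integral0// => t _.
  rewrite /F/= ifF//; apply/negbTE; apply: contra h => /and3P[t0 ty ->].
  by rewrite (lt_trans t0).
rewrite (@fubini_tonelli _ _ T (measurableTypeR R) R m lebesgue_measure (EFin \o F))//.
apply: eq_integral => t _.
have [t0|t0] := ltP 0 t; last first.
  rewrite mul0e (eq_integral (cst 0%E)) ?integral0// => p _.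
  by rewrite /F/= ltNge t0.
rewrite -ge0_integralZl ?lee_fin ?expR_ge0//.
- apply: eq_integral => p _; rewrite -EFinM /F/= t0/=.
  by case: ifP => _; rewrite ?mulr0// mulrC.
- apply/measurable_EFinP; apply: measurable_fun_ifT => //.
  exact: measurable_itv_test.
- by move=> p _; rewrite lee_fin; case: ifP.
Qed.

(** The layer-cake integral of a measure giving []t, B]] the mass [t^(-dl) - B^(-dl)]. Both the far
    points and [lgamma_cont] reduce to it, so it is never evaluated. *)
Definition cake {R : realType} (dl B : R) : \bar R :=
  (\int[@lebesgue_measure R]_t (if 0 < t < B then expR (- t) * (t `^ (- dl) - B `^ (- dl)) else 0)%:E)%E.

Lemma ge0_powR_sub {R : realType} (dl t B : R) : 0 <= dl -> 0 < t -> t <= B ->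
  0 <= t `^ (- dl) - B `^ (- dl).
Proof.
move=> d0 t0 tB; have B0 := lt_le_trans t0 tB.
rewrite subr_ge0 !powRN lef_pV2 ?posrE ?powR_gt0//.
by apply: ge0_ler_powR; rewrite ?nnegrE// ltW.
Qed.

Lemma measurable_cake {R : realType} (dl B : R) : measurable_fun setT
  (fun t : R => if 0 < t < B then expR (- t) * (t `^ (- dl) - B `^ (- dl)) else 0).
Proof.
apply: measurable_fun_ifT => //; first by apply: measurable_and; apply: measurable_fun_ltr.
apply: measurable_funM; first by apply: measurableT_comp => //; exact: measurable_funN.
by apply: measurable_funB => //; exact: measurable_powR.
Qed.

Lemma layer_cake_power {R : realType} d (T : measurableType d)
    (m : {sigma_finite_measure set T -> \bar R}) (y w : T -> R) (B C dl : R) :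
  measurable_fun setT y -> measurable_fun setT w -> (forall p, 0 <= w p) ->
  0 <= C -> 0 <= dl ->
  (forall t, 0 < t -> t < B -> (\int[m]_p (if (t < y p <= B)%R then w p else 0)%:E =
      (C * (t `^ (- dl) - B `^ (- dl)))%:E)%E) ->
  (\int[m]_p (if 0 < y p <= B then w p * (1 - expR (- y p)) else 0)%:E =
   C%:E * cake dl B)%E.
Proof.
move=> my mw w0 C0 d0 h; rewrite layer_cake// /cake -ge0_integralZl ?lee_fin//; last 2 first.
- apply/measurable_EFinP; exact: measurable_cake.
- move=> t _; rewrite lee_fin; case: ifP => // /andP[t0 tB].
  by rewrite mulr_ge0 ?expR_ge0// ge0_powR_sub// ltW.
apply: eq_integral => t _; case: (ltP 0 t) => t0 /=; last by rewrite mul0e mule0.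
have [tB|Bt] := ltP t B.
  by rewrite h// -!EFinM; congr EFin; ring.
rewrite (eq_integral (cst 0%E)) ?integral0 ?mule0// => p _.
by rewrite ifF//; apply/negbTE/negP => /andP[h1 h2]; move: (lt_le_trans h1 h2); rewrite ltNge Bt.
Qed.

(** Under the weight [u^(-dl-1)] the interval []t, B]] has mass [dl^-1 (t^(-dl) - B^(-dl))]. This
    replaces an integration by parts at the singular end 0 of the integral in [lgamma_cont]. *)
Lemma cake_lebesgue {R : realType} (dl B : R) : 0 < dl ->
  (\int[@lebesgue_measure R]_u (if 0 < u <= B then u `^ (- dl - 1) * (1 - expR (- u)) else 0)%:E =
   dl^-1%:E * cake dl B)%E.
Proof.
move=> d0; have dN0 : - dl != 0 by rewrite oppr_eq0 gt_eqF.
apply: (@layer_cake_power R _ (measurableTypeR R) lebesgue_measure id (fun u => u `^ (- dl - 1))) => //.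
- by move=> u; exact: powR_ge0.
- by rewrite invr_ge0 ltW.
- exact: ltW.
- move=> t t0 tB; rewrite integral_power//; congr EFin.
  by rewrite invrN; ring.
Qed.

(** The majorant [t^(-dl)] is integrable at 0 because [dl < 1], which is where [alpha > 2]
    enters. *)
Lemma cake_fin {R : realType} (dl B : R) : 0 < dl -> dl < 1 -> 0 < B ->
  (0 <= cake dl B < +oo)%E.
Proof.
move=> d0 d1 B0; apply/andP; split.
  apply: integral_ge0 => t _; rewrite lee_fin; case: ifP => // /andP[t0 tB].
  by rewrite mulr_ge0 ?expR_ge0// ge0_powR_sub// ltW.
have D0 : 1 - dl != 0 by rewrite subr_eq0 eq_sym lt_eqF.
have D1 : 0 < 1 - dl by rewrite subr_gt0.
(* The integral of [t^(-dl)] over []0, B]]. Truncating at [1 / (n + 1)] keeps the primitive away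
   from its singular end. *)
pose K := (1 - dl)^-1 * B `^ (1 - dl).
pose g (n : nat) (t : R) : R := if (n.+1%:R)^-1 < t <= B then t `^ (- dl) else 0.
have g0 n t : 0 <= g n t by rewrite /g; case: ifP => // _; exact: powR_ge0.
have mg n : measurable_fun setT (g n).
  by apply: measurable_fun_ifT => //; exact: measurable_itv_test.
have gK n : (\int[@lebesgue_measure R]_t (g n t)%:E <= K%:E)%E.
  have [nB|Bn] := ltP (n.+1%:R)^-1 B.
    rewrite /g (_ : - dl = 1 - dl - 1); last by ring.
    rewrite integral_power//.
    rewrite lee_fin /K ler_pM2l ?invr_gt0//.
    by have := @powR_ge0 R (n.+1%:R)^-1 (1 - dl); lra.
  rewrite (eq_integral (cst 0%E)).
    by rewrite integral0 lee_fin mulr_ge0 ?powR_ge0// invr_ge0 ltW.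
  move=> t _; rewrite /g ifF//; apply/negbTE/negP => /andP[h1 h2].
  by move: (lt_le_trans h1 h2); rewrite ltNge Bn.
have gnd t : nondecreasing_seq (fun n => (g n t)%:E).
  apply/nondecreasing_seqP => n; rewrite lee_fin /g.
  case: ifPn => [/andP[h1 h2]|_]; last by case: ifP => // _; exact: powR_ge0.
  rewrite ifT// h2 andbT (le_lt_trans _ h1)// lef_pV2 ?posrE// ler_nat//.
pose f (t : R) : R := if 0 < t <= B then t `^ (- dl) else 0.
have glim t : limn (fun n => (g n t)%:E) = (f t)%:E.
  apply/cvg_lim => //; apply: cvg_near_cst; rewrite /f.
  case: (ltP 0 t) => t0 /=; last first.
    apply: nearW => n; rewrite /g ifF//; apply/negbTE/negP => /andP[h _].
    have i0 : 0 < (n.+1%:R)^-1 :> R by rewrite invr_gt0.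
    by move: (lt_le_trans (lt_trans i0 h) t0); rewrite ltxx.
  exists (Num.truncn t^-1) => // n /= hn; rewrite /g; congr (if _ then _ else _)%:E.
  rewrite (_ : (n.+1%:R)^-1 < t)//= -[t]invrK ltf_pV2 ?posrE ?invr_gt0//.
  by rewrite (lt_le_trans (truncnS_gt _))// ler_nat.
have fK : (\int[@lebesgue_measure R]_t (f t)%:E <= K%:E)%E.
  under eq_integral => t _ do rewrite -glim.
  rewrite monotone_convergence//.
  - apply: lime_le; last exact: nearW.
    apply: ereal_nondecreasing_is_cvgn; apply/nondecreasing_seqP => n.
    apply: ge0_le_integral => //.
    + by move=> t _; rewrite lee_fin.
    + by apply/measurable_EFinP; exact: mg.
    + by apply/measurable_EFinP; exact: mg.
    + by move=> t _; have /nondecreasing_seqP := gnd t; apply.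
  - by move=> n; apply/measurable_EFinP; exact: mg.
  - by move=> n t _; rewrite lee_fin.
apply: le_lt_trans (ltry K); apply: (le_trans _ fK); apply: ge0_le_integral => //.
- move=> t _; rewrite lee_fin; case: ifP => // /andP[t0 tB].
  by rewrite mulr_ge0 ?expR_ge0// ge0_powR_sub// ltW.
- apply/measurable_EFinP; exact: measurable_cake.
- apply/measurable_EFinP; apply: measurable_fun_ifT => //; exact: measurable_itv_test.
- move=> t _; rewrite lee_fin /f; case: ifP => [/andP[t0 tB]|_]; last first.
    by case: ifP => // _; exact: powR_ge0.
  rewrite t0 (ltW tB)/=.
  have e1 : expR (- t) <= 1 by rewrite -[leRHS]expR0 ler_expR oppr_le0 ltW.
  have e0 := expR_ge0 (- t); have h := ge0_powR_sub (ltW d0) t0 (ltW tB).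
  have hB := @powR_ge0 R B (- dl).
  rewrite (@le_trans _ _ (t `^ (- dl) - B `^ (- dl)))//; last by lra.
  by rewrite ler_piMl.
Qed.

(** * Comparing coefficients of generating functions *)

Section pgf_determines.
Context {R : realType} {d : measure_display} {Omega : measurableType d}
  (P : probability Omega R) (K : Omega -> nat) (Y1 Y2 : Omega -> R) (C : R).
Hypothesis mK : forall k, measurable [set w | K w = k].
Hypothesis mY1 : measurable_fun setT Y1.
Hypothesis mY2 : measurable_fun setT Y2.
Hypothesis Y1_01 : forall w, 0 <= Y1 w <= 1.
Hypothesis Y2_01 : forall w, 0 <= Y2 w <= 1.

(** The power series of [Y] in [th] with its first [k] terms removed, divided by [th^k]; its
    constant term is [A Y k]. *)
Let D (Y : Omega -> R) (k : nat) (th : R) : R :=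
  fine (\int[P]_w (if (k <= K w)%N then th ^+ (K w - k) * Y w else 0)%:E).

Let A (Y : Omega -> R) (k : nat) : R :=
  fine (\int[P]_w (if K w == k then Y w else 0)%:E).

Let mKeq k : measurable_fun setT (fun w => K w == k).
Proof.
apply: (@measurable_fun_bool _ _ _ _ true); rewrite setTI.
rewrite (_ : _ @^-1` _ = [set w | K w = k])//.
by apply/seteqP; split => w /= /eqP.
Qed.

Let mKnat (h : nat -> R) : measurable_fun setT (fun w => h (K w)).
Proof.
move=> _ V mV; rewrite setTI.
rewrite (_ : _ @^-1` V = \bigcup_(k in [set k | V (h k)]) [set w | K w = k]).
  by apply: bigcup_measurable => k _; exact: mK.
apply/seteqP; split => w /=; first by move=> hw; exists (K w).
by move=> [k /= hk Kw]; rewrite Kw.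
Qed.

Let mD (Y : Omega -> R) k (th : R) : measurable_fun setT Y ->
  measurable_fun setT (fun w => if (k <= K w)%N then th ^+ (K w - k) * Y w else 0).
Proof.
move=> mY; rewrite (_ : (fun w => _) =
    fun w => (if (k <= K w)%N then th ^+ (K w - k) else 0) * Y w).
  by apply: measurable_funM => //; exact: (mKnat (fun j => if (k <= j)%N then th ^+ (j - k) else 0)).
by apply/funext => w; case: ifP; rewrite ?mul0r.
Qed.

Let mA (Y : Omega -> R) k : measurable_fun setT Y ->
  measurable_fun setT (fun w => if K w == k then Y w else 0).
Proof. by move=> mY; apply: measurable_fun_ifT => //. Qed.

Let D01 (Y : Omega -> R) k (th : R) : (forall w, 0 <= Y w <= 1) -> 0 <= th <= 1 ->
  forall w, 0 <= (if (k <= K w)%N then th ^+ (K w - k) * Y w else 0) <= 1.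
Proof.
move=> Y01 /andP[t0 t1] w; case: ifP => _; last by rewrite lexx ler01.
have /andP[y0 y1] := Y01 w.
by rewrite mulr_ge0 ?exprn_ge0//= mulr_ile1 ?exprn_ge0 ?exprn_ile1.
Qed.

Let A01 (Y : Omega -> R) k : (forall w, 0 <= Y w <= 1) ->
  forall w, 0 <= (if K w == k then Y w else 0) <= 1.
Proof. by move=> Y01 w; case: ifP => // _; rewrite lexx ler01. Qed.

Let fin_unit (g : Omega -> R) : measurable_fun setT g -> (forall w, 0 <= g w <= 1) ->
  (\int[P]_w (g w)%:E)%E \is a fin_num.
Proof.
move=> mg g01; have /andP[h0 h1] := integral_unit_fin P mg g01.
by rewrite ge0_fin_numE// (le_lt_trans h1)// ltry.
Qed.

Let fine_unit (g : Omega -> R) : measurable_fun setT g -> (forall w, 0 <= g w <= 1) ->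
  0 <= fine (\int[P]_w (g w)%:E)%E <= 1.
Proof.
by move=> mg g01; rewrite -!lee_fin fineK ?fin_unit//; exact: integral_unit_fin.
Qed.

Let D_step (Y : Omega -> R) k (th : R) : measurable_fun setT Y -> (forall w, 0 <= Y w <= 1) ->
  0 <= th <= 1 -> D Y k th = A Y k + th * D Y k.+1 th.
Proof.
move=> mY Y01 th01; have /andP[t0 _] := th01.
apply: EFin_inj; rewrite EFinD EFinM /D /A.
rewrite !fineK; [|by apply: fin_unit; [exact: mD|exact: D01]|
  by apply: fin_unit; [exact: mA|exact: A01]|by apply: fin_unit; [exact: mD|exact: D01]].
rewrite -ge0_integralZl ?lee_fin//; last 2 first.
- exact/measurable_EFinP/mD.
- by move=> w _; rewrite lee_fin; have /andP[] := D01 k.+1 Y01 th01 w.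
rewrite -ge0_integralD//; last 4 first.
- by move=> w _; rewrite lee_fin; have /andP[] := A01 k Y01 w.
- exact/measurable_EFinP/mA.
- by move=> w _; rewrite -EFinM lee_fin mulr_ge0//; have /andP[] := D01 k.+1 Y01 th01 w.
- by apply: emeasurable_funM => //; exact/measurable_EFinP/mD.
apply: eq_integral => w _; rewrite -EFinM -EFinD; congr EFin.
case: (ltngtP k (K w)) => [h|h|<-].
- by rewrite add0r mulrA -exprS subnSK.
- by rewrite mulr0 addr0.
- by rewrite subnn expr0 mul1r mulr0 addr0.
Qed.

(* Comparing the coefficients of two bounded power series: the constant term
   of their difference is [O(th)] and hence zero; then divide by [th]. *)
Lemma pgf_determines :
  (forall th : R, 0 < th < 1 -> (\int[P]_w (th ^+ K w * Y1 w)%:E =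
     C%:E * \int[P]_w (th ^+ K w * Y2 w)%:E)%E) -> 0 <= C <= 1 ->
  forall k, (\int[P]_w (if K w == k then Y1 w else 0)%:E =
    C%:E * \int[P]_w (if K w == k then Y2 w else 0)%:E)%E.
Proof.
move=> hC /andP[C0 C1].
have thb (th : R) : 0 < th < 1 -> 0 <= th <= 1 by move=> /andP[/ltW -> /ltW ->].
have coef k : (forall th, 0 < th < 1 -> D Y1 k th = C * D Y2 k th) -> A Y1 k = C * A Y2 k.
  move=> h; apply/eqP; rewrite -subr_eq0 -normr_eq0 eq_le normr_ge0 andbT.
  apply/ler_addgt0Pr => e e0; rewrite add0r.
  (* The first bound keeps [th] inside []0, 1[]; the second makes the remainder, at most [th] in
     absolute value, smaller than [e]. *)
  pose th := Num.min (2^-1) (e / 2).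
  have th0 : 0 < th by rewrite lt_min; apply/andP; split; [rewrite invr_gt0|rewrite divr_gt0].
  have th1 : th < 1 by rewrite gt_min invf_lt1// ltr1n.
  have the : th <= e / 2 by rewrite ge_min lexx orbT.
  have thI : 0 < th < 1 by rewrite th0.
  have Db1 : 0 <= D Y1 k.+1 th <= 1.
    exact: fine_unit (mD k.+1 th mY1) (D01 k.+1 Y1_01 (thb _ thI)).
  have Db2 : 0 <= D Y2 k.+1 th <= 1.
    exact: fine_unit (mD k.+1 th mY2) (D01 k.+1 Y2_01 (thb _ thI)).
  have := h th thI.
  rewrite (D_step k mY1 Y1_01 (thb _ thI)) (D_step k mY2 Y2_01 (thb _ thI)).
  move: (A Y1 k) (A Y2 k) (D Y1 k.+1 th) (D Y2 k.+1 th) Db1 Db2.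
  move=> a1 a2 x1 x2 /andP[b0 b1] /andP[c0 c1] E.
  have -> : a1 - C * a2 = th * (C * x2 - x1) by move: E; rewrite !mulrDr; lra.
  have hC1 : `|C * x2 - x1| <= 1.
    have h0 : 0 <= C * x2 by rewrite mulr_ge0.
    have h1 : C * x2 <= 1 by rewrite mulr_ile1.
    by rewrite ler_norml; apply/andP; split; lra.
  rewrite normrM (gtr0_norm th0) (le_trans (ler_wpM2l (ltW th0) hC1))//.
  by rewrite mulr1; lra.
have all k : forall th, 0 < th < 1 -> D Y1 k th = C * D Y2 k th.
  elim: k => [th thI|k IH th thI].
    apply: EFin_inj; rewrite EFinM /D !fineK; last 2 first.
    - exact: (fin_unit (mD 0 th mY2) (D01 0 Y2_01 (thb _ thI))).
    - exact: (fin_unit (mD 0 th mY1) (D01 0 Y1_01 (thb _ thI))).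
    under eq_integral => w _ do rewrite leq0n subn0.
    under [in RHS]eq_integral => w _ do rewrite leq0n subn0.
    exact: hC.
  have := IH th thI.
  rewrite (D_step k mY1 Y1_01 (thb _ thI)) (D_step k mY2 Y2_01 (thb _ thI)) (coef k IH).
  have /andP[th0 _] := thI.
  move: (A Y2 k) (D Y1 k.+1 th) (D Y2 k.+1 th) => a2 x1 x2 E.
  apply: (mulfI (lt0r_neq0 th0)); move: E; rewrite mulrDr => /addrI ->.
  by rewrite mulrCA.
move=> k; have := congr1 EFin (coef k (all k)).
by rewrite EFinM /A !fineK//; apply: fin_unit; try exact: mA; exact: A01.
Qed.

End pgf_determines.

(** * The mean measure of the values z *)

Lemma marked_plane_tonelli_swap {R : realType} (mu : probability R R)
    (F : (R * R) * R -> \bar R) :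
  measurable_fun setT F -> (forall p, 0 <= F p)%E ->
  (\int[(plane R \x mu)%E]_z F z = \int[mu]_h \int[plane R]_p F (p, h))%E.
Proof.
move=> mF F0; exact: (@fubini_tonelli2 _ _
  (measurableTypeR R * measurableTypeR R)%type R R
  (sigma_finite_prod lebesgue_measure lebesgue_measure) mu F mF F0).
Qed.

Lemma measurable_marked_plane_integral {R : realType} (F : (R * R) * R -> \bar R) :
  measurable_fun setT F -> (forall p, 0 <= F p)%E ->
  measurable_fun setT (fun h : R => \int[plane R]_p F (p, h))%E.
Proof.
move=> mF F0; exact: (@measurable_fun_fubini_tonelli_G _ _
  (measurableTypeR R * measurableTypeR R)%type R R
  (sigma_finite_prod lebesgue_measure lebesgue_measure) F mF F0).
Qed.

Lemma ltr_powR_pos {R : realType} (r a b : R) : 0 < r -> 0 <= a -> 0 <= b ->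
  (a `^ r < b `^ r) = (a < b).
Proof.
move=> r0 a0 b0; apply/idP/idP => [|ab]; last by apply: gt0_ltr_powR => //; rewrite nnegrE.
by rewrite !ltNge; apply: contra => ba; apply: ge0_ler_powR; rewrite ?nnegrE// ltW.
Qed.

Lemma measurable_lteb {R : realType} d (T : measurableType d) (f g : T -> \bar R) :
  measurable_fun setT f -> measurable_fun setT g ->
  measurable_fun setT (fun t => (f t < g t)%E).
Proof.
move=> mf mg; apply: (@measurable_fun_bool _ _ _ _ true).
exact: measurable_lte.
Qed.

Lemma measurable_leeb {R : realType} d (T : measurableType d) (f g : T -> \bar R) :
  measurable_fun setT f -> measurable_fun setT g ->
  measurable_fun setT (fun t => (f t <= g t)%E).
Proof.
move=> mf mg; apply: (@measurable_fun_bool _ _ _ _ true).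
exact: measurable_lee.
Qed.

Section intensity.
Context {R : realType} (mu : probability R R) (x0 : R * R) (alpha phi hb s : R).
Hypothesis alpha2 : 2 < alpha.
Hypothesis phi0 : 0 < phi.
Hypothesis phi2 : phi <= 2 * pi.
Hypothesis s0 : 0 < s.
Hypothesis mu_neg : mu [set h | h < 0] = 0%E.
Let dl := 2 / alpha.
Hypothesis hbE : (\int[mu]_h (if 0 <= h then h `^ dl else 0)%:E = hb%:E)%E.

Definition zof (z : (R * R) * R) : \bar R := zval x0 alpha z.1 z.2.
Definition sector_of (z : (R * R) * R) : bool := in_sector x0 phi z.1.
(** The inverse of [zof] as a real number, equal to 0 where [zof] is [+oo]. *)
Definition gain (z : (R * R) * R) : R := z.2 / radius x0 z.1 `^ alpha.
(** The integral of [1 - e^(-s/z)] over [z >= b] per unit of [lam], in the closed form of the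
    theorem; the sign makes it nonnegative. *)
Definition exponent (b : R) : R := - (phi / alpha * hb * q_fun alpha b s).

Let alpha_gt0 : 0 < alpha.
Proof. by have h := alpha2; lra. Qed.

Let dl_gt0 : 0 < dl.
Proof. by rewrite divr_gt0. Qed.

Let dl_lt1 : dl < 1.
Proof. by rewrite ltr_pdivrMr// mul1r. Qed.

Lemma zofE z : zof z =
  if z.2 == 0 then +oo%E else (radius x0 z.1 `^ alpha / z.2)%:E.
Proof. by []. Qed.

Let m1 : measurable_fun setT (fun z : (R * R) * R => radius x0 z.1 `^ alpha).
Proof.
apply: (measurableT_comp (f := fun r : R => r `^ alpha)); first exact: measurable_powR.
apply: measurableT_comp => //; exact: measurable_radius.
Qed.

Lemma measurable_zof : measurable_fun setT zof.
Proof.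
apply: measurable_fun_ifT.
- by apply: measurable_fun_eqr => //.
- exact: measurable_cst.
- apply/measurable_EFinP; apply: measurable_funM => //.
  by apply: (measurableT_comp (f := @GRing.inv R)) => //; exact: measurable_inv.
Qed.

Lemma measurable_gain : measurable_fun setT gain.
Proof.
apply: measurable_funM => //.
by apply: (measurableT_comp (f := @GRing.inv R)) => //; exact: measurable_inv.
Qed.

Lemma measurable_sector_of : measurable_fun setT sector_of.
Proof.
apply: (measurableT_comp (f := in_sector x0 phi)) => //.
exact: measurable_in_sector.
Qed.

Lemma zof_lt p h t : 0 < h -> 0 <= t ->
  (zof (p, h) < t%:E)%E = (radius x0 p < (t * h) `^ alpha^-1).
Proof.
move=> h0 t0; rewrite zofE/= gt_eqF// lte_fin ltr_pdivrMr//.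
have th0 : 0 <= t * h by rewrite mulr_ge0// ltW.
rewrite -[in LHS](powRr1 th0) -(mulVf (lt0r_neq0 alpha_gt0)) powRrM.
by rewrite ltr_powR_pos// ?powR_ge0// radius_ge0.
Qed.

Definition ztest (t : R) (z : (R * R) * R) : R :=
  if sector_of z && (zof z < t%:E)%E then 1 else 0.

Lemma measurable_ztest t : measurable_fun setT (ztest t).
Proof.
apply: measurable_fun_ifT => //; apply: measurable_and.
  exact: measurable_sector_of.
by apply: measurable_lteb; [exact: measurable_zof|exact: measurable_cst].
Qed.

Lemma ztest_ge0 t z : 0 <= ztest t z.
Proof. by rewrite /ztest; case: ifP. Qed.

(** For a fixed mark [h > 0] the points counted fill a sector of radius [(t h)^(1/alpha)] and area
    [phi / 2 * (t h)^dl]; averaging over [h] brings in [hb]. *)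
Lemma integral_ztest t : 0 <= t ->
  (\int[(plane R \x mu)%E]_z (ztest t z)%:E = (phi / 2 * t `^ dl * hb)%:E)%E.
Proof.
move=> t0.
have mzt : measurable_fun setT (EFin \o ztest t) by apply/measurable_EFinP; exact: measurable_ztest.
have zt0 z : (0 <= (EFin \o ztest t) z)%E by rewrite /= lee_fin ztest_ge0.
rewrite (marked_plane_tonelli_swap _ mzt zt0).
have mpow : measurable_fun setT (fun h : R => if 0 <= h then h `^ dl else 0).
  apply: measurable_fun_ifT => //; first exact: measurable_fun_ler.
have k0 : 0 <= phi / 2 * t `^ dl by rewrite mulr_ge0 ?powR_ge0// divr_ge0// ltW.
rewrite EFinM -hbE -ge0_integralZl ?lee_fin//; last 2 first.
- exact/measurable_EFinP.
- by move=> h _; rewrite lee_fin; case: ifP => // _; exact: powR_ge0.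
apply: ge0_ae_eq_integral => //.
- exact: (measurable_marked_plane_integral mzt zt0).
- by apply: emeasurable_funM => //; exact/measurable_EFinP.
- by move=> h _; apply: integral_ge0 => p _; exact: zt0.
- by move=> h _; rewrite -EFinM lee_fin mulr_ge0//; case: ifP => // _; exact: powR_ge0.
(* The formula for the radius covers nonnegative marks; the negative ones form a null set. *)
exists [set h | h < 0]; split => //.
  by rewrite (_ : [set h | h < 0] = `]-oo, 0[%classic)//; apply/seteqP; split => h /=; rewrite in_itv.
move=> h /= hne; rewrite ltNge; apply/negP => h0; apply: hne => _.
(* A zero mark gives [z = +oo], hence no point below [t], in agreement with [0^dl = 0]. *)
rewrite h0 -EFinM; move: h0; rewrite le_eqVlt => /predU1P[<-|h0].
  rewrite powR0 ?gt_eqF// mulr0 (eq_integral (cst 0%E)) ?integral0// => p _.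
  by rewrite /ztest zofE/= eqxx andbF.
rewrite (_ : phi / 2 * t `^ dl * h `^ dl = phi * ((t * h) `^ alpha^-1) ^+ 2 / 2); last first.
  rewrite -powR_mulrn ?powR_ge0// -powRrM (_ : alpha^-1 * 2%:R = dl); last by rewrite mulrC.
  by rewrite powRM// ?(ltW h0)//; ring.
rewrite -(area_sector x0 phi0 phi2 (powR_ge0 _ _)).
by apply: eq_integral => p _; rewrite /ztest zof_lt.
Qed.

(** Taking inverses in [t < s / z <= s / b]. In the degenerate cases, a mark at most 0 or a point at
    the apex, both sides are false. *)
Lemma gain_window b t z : 0 < b -> 0 < t ->
  (t < s * gain z <= s / b) = (b%:E <= zof z)%E && (zof z < (s / t)%:E)%E.
Proof.
move=> b0 t0; rewrite zofE /gain; move: (radius x0 z.1 `^ alpha) (powR_ge0 (radius x0 z.1) alpha) => r r0.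
have [->|h0] := eqVneq z.2 0; first by rewrite mul0r mulr0 ltNge (ltW t0)/= andbF.
rewrite lee_fin lte_fin.
have [h1|h1] := ltP 0 z.2; last first.
  have h2 : z.2 / r <= 0 by rewrite mulr_le0_ge0// invr_ge0.
  have h3 : r / z.2 <= 0 by rewrite mulr_ge0_le0// invr_le0.
  have h4 : s * (z.2 / r) <= 0 by rewrite mulr_ge0_le0// ltW.
  rewrite [in LHS]ltNge (le_trans h4 (ltW t0))/=; apply/esym/negbTE.
  by rewrite negb_and -ltNge (le_lt_trans h3 b0).
move: r0; rewrite le_eqVlt => /predU1P[<-|r0].
  by rewrite invr0 mul0r !mulr0 ltNge (ltW t0)/= leNgt b0.
have -> : (t < s * (z.2 / r)) = (r / z.2 < s / t).
  by rewrite mulrA ltr_pdivlMr// ltr_pdivrMr// mulrAC ltr_pdivlMr// (mulrC r).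
have -> : (s * (z.2 / r) <= s / b) = (b <= r / z.2).
  by rewrite ler_pM2l// ler_pdivrMr// ler_pdivlMr// mulrC ler_pdivlMr// mulrC.
by rewrite andbC.
Qed.

Lemma gain_itv b z : 0 < b -> (b%:E <= zof z)%E -> 0 < s * gain z <= s / b \/ gain z = 0.
Proof.
move=> b0; rewrite zofE /gain; move: (radius x0 z.1 `^ alpha) (powR_ge0 (radius x0 z.1) alpha) => r r0.
have [->|h0] := eqVneq z.2 0; first by right; rewrite mul0r.
rewrite lee_fin => br; left.
have hr0 : 0 < r / z.2 by exact: lt_le_trans br.
have h1 : 0 < z.2.
  by rewrite ltNge; apply/negP => h; move: hr0; rewrite ltNge mulr_ge0_le0// invr_le0.
have r1 : 0 < r by rewrite lt_neqAle r0 andbT; apply/eqP => rE; move: hr0; rewrite -rE mul0r ltxx.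
rewrite mulr_gt0 ?divr_gt0//= ler_pM2l// ler_pdivrMr// mulrC ler_pdivlMr//.
by rewrite mulrC -ler_pdivlMr.
Qed.

Lemma gain_itv_zof b z : 0 < b -> 0 < s * gain z <= s / b -> (b%:E <= zof z)%E.
Proof.
move=> b0 /andP[g0 gb].
have h2 : 0 < s * gain z / 2 by rewrite divr_gt0.
have : s * gain z / 2 < s * gain z <= s / b by rewrite gb andbT ltr_pdivrMr// ltr_pMr// ltr1n.
by rewrite gain_window// => /andP[].
Qed.

Lemma gain_ge0 b z : 0 < b -> (b%:E <= zof z)%E -> 0 <= gain z.
Proof.
move=> b0 /(gain_itv b0)[/andP[h _]|->//]; by rewrite -(pmulr_rge0 _ s0) ltW.
Qed.

Definition far_term (b : R) (z : (R * R) * R) : R :=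
  if sector_of z && (b%:E <= zof z)%E then 1 - expR (- s * gain z) else 0.

Lemma far_term_ge0 b z : 0 < b -> 0 <= far_term b z.
Proof.
move=> b0; rewrite /far_term; case: ifP => // /andP[_ /(gain_ge0 b0) g0].
by rewrite subr_ge0 -[leRHS]expR0 ler_expR mulNr oppr_le0 mulr_ge0// ltW.
Qed.

Lemma measurable_far_term b : measurable_fun setT (far_term b).
Proof.
apply: measurable_fun_ifT => //.
  apply: measurable_and; first exact: measurable_sector_of.
  by apply: measurable_leeb; [exact: measurable_cst|exact: measurable_zof].
apply: measurable_funB => //; apply: measurableT_comp => //.
by apply: measurable_funM => //; exact: measurable_gain.
Qed.

Let hb_ge0 : 0 <= hb.
Proof.
by rewrite -lee_fin -hbE; apply: integral_ge0 => h _; rewrite lee_fin; case: ifP => // _; exact: powR_ge0.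
Qed.

Let M := sigma_finite_prod (sigma_finite_prod (@lebesgue_measure R) (@lebesgue_measure R)) mu.

Lemma powR_inv_neg (a r : R) : 0 <= a -> (a^-1) `^ r = a `^ (- r).
Proof. by move=> a0; rewrite -powR_inv1// -powRrM mulN1r. Qed.

(** The window is [b <= z < s / t], so its mass is a difference of two values of [integral_ztest];
    in powers of [t] it has the shape that [layer_cake_power] asks for. *)
Lemma integral_window b t : 0 < b -> 0 < t -> t < s / b ->
  (\int[M]_z (if (t < s * gain z <= s / b)%R then (if sector_of z then 1 else 0) else 0 : R)%:E =
   (phi / 2 * hb * s `^ dl * (t `^ (- dl) - (s / b) `^ (- dl)))%:E)%E.
Proof.
move=> b0 t0 tsb.
have st0 : 0 < s / t by rewrite divr_gt0.
have bst : b < s / t by rewrite ltr_pdivlMr// mulrC -ltr_pdivlMr.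
pose k z : R := if (t < s * gain z <= s / b)%R then (if sector_of z then 1 else 0) else 0.
have k0 z : 0 <= k z by rewrite /k; case: ifP => // _; case: ifP.
have mk : measurable_fun setT k.
  apply: measurable_fun_ifT => //.
    apply: measurable_itv_test; apply: measurable_funM => //; exact: measurable_gain.
  by apply: measurable_fun_ifT => //; exact: measurable_sector_of.
have E : (\int[M]_z (ztest (s / t) z)%:E =
    \int[M]_z (ztest b z)%:E + \int[M]_z (k z)%:E)%E.
  rewrite -ge0_integralD//; last 4 first.
  - by move=> z _; rewrite lee_fin ztest_ge0.
  - by apply/measurable_EFinP; exact: measurable_ztest.
  - by move=> z _; rewrite lee_fin.
  - by apply/measurable_EFinP; exact: mk.
  apply: eq_integral => z _; rewrite -EFinD; congr EFin.
  rewrite /k gain_window// /ztest; case: (sector_of z) => /=; last by rewrite add0r; case: ifP.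
  have [zb|bz] := ltP (zof z) b%:E; last by rewrite add0r.
  by rewrite (lt_trans zb) ?lte_fin// addr0.
have E1 := integral_ztest (ltW st0); have E2 := integral_ztest (ltW b0).
move: E; rewrite E1 E2 => E.
rewrite -/(k _); have : (\int[M]_z (k z)%:E = (phi / 2 * (s / t) `^ dl * hb)%:E - (phi / 2 * b `^ dl * hb)%:E)%E.
  by rewrite E addeAC subee ?add0e.
rewrite -EFinB => ->; congr EFin.
have e1 : (s / t) `^ dl = s `^ dl * t `^ (- dl).
  by rewrite powRM ?invr_ge0 ?(ltW s0) ?(ltW t0)// powR_inv_neg// ltW.
have e2 : b `^ dl = s `^ dl * (s / b) `^ (- dl).
  rewrite -powR_inv_neg ?divr_ge0 ?(ltW s0) ?(ltW b0)//.
  rewrite -powRM ?invr_ge0 ?divr_ge0 ?(ltW s0) ?(ltW b0)//; congr (_ `^ _).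
  by field; rewrite !gt_eqF.
by rewrite e1 e2; ring.
Qed.

(** The boundary term of [lgamma_cont], multiplied by [s^dl], cancels [alpha / 2 * b^dl] because
    [s^dl * (s / b)^(-dl) = b^dl]. What remains of [q_fun] is a multiple of [cake]. *)
Lemma exponentE b : 0 < b -> exists2 c : R, cake dl (s / b) = c%:E &
  exponent b = phi / 2 * hb * s `^ dl * c.
Proof.
move=> b0; have sb0 : 0 < s / b by rewrite divr_gt0.
have /andP[c0 cfin] := cake_fin dl_gt0 dl_lt1 sb0.
have cE : cake dl (s / b) = (fine (cake dl (s / b)))%:E by rewrite fineK// ge0_fin_numE.
exists (fine (cake dl (s / b))) => //; set c := fine _ in cE *.
have := cake_lebesgue (s / b) dl_gt0; rewrite cE -EFinM.
rewrite (_ : (fun u : R => _) = fun u : R => (if 0 < u <= s / b then u `^ (- dl - 1) * (1 - expR (- u)) else 0)%:E)//.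
rewrite integral_if (_ : [set u | 0 < u <= s / b] = `]0, (s / b)]%classic)// => I.
have dl0 : dl != 0 by rewrite gt_eqF.
have e2 : b `^ dl = s `^ dl * (s / b) `^ (- dl).
  rewrite -powR_inv_neg ?divr_ge0 ?(ltW s0) ?(ltW b0)//.
  rewrite -powRM ?invr_ge0 ?divr_ge0 ?(ltW s0) ?(ltW b0)//; congr (_ `^ _).
  by field; rewrite !gt_eqF.
have L : lgamma_cont (- dl) (s / b) = - (dl^-1 * c) - (s / b) `^ (- dl) / dl.
  rewrite /lgamma_cont /Rintegral.
  rewrite (_ : fine _ = - (dl^-1 * c)); last first.
    transitivity (fine (- \int[@lebesgue_measure R]_(u in `]0%R, (s / b)%R]) (u `^ (- dl - 1) * (1 - expR (- u)))%:E)%E).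
      rewrite -integral_ge0N//.
        by congr fine; apply: eq_integral => u _; rewrite -EFinN; congr EFin; ring.
      move=> u; rewrite /= in_itv/= => /andP[u0 _]; rewrite lee_fin mulr_ge0 ?powR_ge0//.
      by rewrite subr_ge0 -[leRHS]expR0 ler_expR oppr_le0 ltW.
    by rewrite I.
  by rewrite invrN mulrN.
rewrite /exponent /q_fun -/dl L.
rewrite (_ : alpha / 2 = dl^-1); last by rewrite /dl invf_div.
rewrite e2; have a0 := lt0r_neq0 alpha_gt0.
rewrite (_ : phi / alpha = phi / 2 * dl); last by rewrite /dl; field.
by field.
Qed.

Lemma integral_far_term b : 0 < b ->
  (\int[(plane R \x mu)%E]_z (far_term b z)%:E = (exponent b)%:E)%E.
Proof.
move=> b0; have [c cE ->] := exponentE b0.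
have mg : measurable_fun setT (fun z => s * gain z).
  by apply: measurable_funM => //; exact: measurable_gain.
have mw : measurable_fun setT (fun z => if sector_of z then 1 else 0 : R).
  by apply: measurable_fun_ifT => //; exact: measurable_sector_of.
have C0 : 0 <= phi / 2 * hb * s `^ dl.
  by rewrite !mulr_ge0 ?powR_ge0// ltW.
have w0 z : 0 <= (if sector_of z then 1 else 0 : R) by case: ifP.
have := @layer_cake_power R _ _ M (fun z => s * gain z) (fun z => if sector_of z then 1 else 0)
  (s / b) (phi / 2 * hb * s `^ dl) dl mg mw w0 C0 (ltW dl_gt0)
  (fun t t0 tB => integral_window b0 t0 tB).
rewrite cE -EFinM => <-; apply: eq_integral => z _; congr EFin.
rewrite /far_term; have [bz|zb] := leP b%:E (zof z).
  rewrite andbT; case: ifP => _; last by case: ifP; rewrite ?mul0r.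
  have [->|->] := gain_itv b0 bz; first by rewrite mul1r mulNr.
  by rewrite !mulr0 oppr0 expR0 subrr ltxx.
rewrite andbF; case: ifP => // /(gain_itv_zof b0).
by rewrite leNgt zb.
Qed.

(** Raising the level from [b] to [b'] loses the points with [b <= z < b'], each of which
    contributes between 0 and 1. This gives monotonicity and continuity without differentiating
    [q_fun]. *)
Lemma exponent_lip b b' : 0 < b -> b <= b' ->
  0 <= exponent b - exponent b' <= phi / 2 * (b' `^ dl - b `^ dl) * hb.
Proof.
move=> b0 bb'; have b'0 := lt_le_trans b0 bb'.
have ft0 b1 z : 0 < b1 -> 0 <= far_term b1 z by exact: far_term_ge0.
have h1 : ((exponent b')%:E <= (exponent b)%:E)%E.
  rewrite -!integral_far_term//; apply: ge0_le_integral => //.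
  - by move=> z _; rewrite lee_fin ft0.
  - by apply/measurable_EFinP; exact: measurable_far_term.
  - by apply/measurable_EFinP; exact: measurable_far_term.
  - move=> z _; rewrite lee_fin {1}/far_term; case: ifPn => [/andP[sz b'z]|_]; last exact: ft0.
    by rewrite /far_term sz (le_trans _ b'z)// lee_fin.
have h2 : ((exponent b + phi / 2 * b `^ dl * hb)%:E <=
    (exponent b' + phi / 2 * b' `^ dl * hb)%:E)%E.
  rewrite !EFinD -!integral_far_term// -!integral_ztest ?(ltW b0) ?(ltW b'0)//.
  have D b1 : 0 < b1 -> (\int[(plane R \x mu)%E]_z (far_term b1 z)%:E + \int[(plane R \x mu)%E]_z (ztest b1 z)%:E =
      \int[(plane R \x mu)%E]_z ((far_term b1 z)%:E + (ztest b1 z)%:E))%E.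
    move=> b10; rewrite ge0_integralD//.
    - by move=> z _; rewrite lee_fin ft0.
    - by apply/measurable_EFinP; exact: measurable_far_term.
    - by move=> z _; rewrite lee_fin ztest_ge0.
    - by apply/measurable_EFinP; exact: measurable_ztest.
  rewrite !D//; apply: ge0_le_integral => //.
  - by move=> z _; rewrite -EFinD lee_fin addr_ge0 ?ft0 ?ztest_ge0.
  - by apply: emeasurable_funD; apply/measurable_EFinP; [exact: measurable_far_term|exact: measurable_ztest].
  - by apply: emeasurable_funD; apply/measurable_EFinP; [exact: measurable_far_term|exact: measurable_ztest].
  - move=> z _; rewrite -!EFinD lee_fin /far_term /ztest.
    case: (sector_of z) => /=; last by rewrite !addr0.
    have [bz|zb] := leP b%:E (zof z).
      have [b'z|zb'] := leP b'%:E (zof z); first by [].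
      by rewrite addr0 add0r gerBl expR_ge0.
    have zb' : (zof z < b'%:E)%E by rewrite (lt_le_trans zb)// lee_fin.
    by rewrite zb' (lt_geF zb').
move: h1 h2; rewrite !lee_fin => h1 h2; apply/andP; split; first by rewrite subr_ge0.
by move: h2; rewrite mulrBr mulrBl; lra.
Qed.

End intensity.

(** * Conditioning by refinement of dyadic cells *)

Section discretize.
Context {R : realType} {d : measure_display} {Omega : measurableType d}
  (P : probability Omega R) (z Yl : Omega -> R) (Y : R -> Omega -> R) (G : R -> R).
Hypothesis mz : measurable_fun setT z.
Hypothesis z_ge0 : forall w, 0 <= z w.
Hypothesis ae_z_gt0 : {ae P, forall w, 0 < z w}.
Hypothesis mY : forall b : Omega -> R, measurable_fun setT b ->
  measurable_fun setT (fun w => Y (b w) w).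
Hypothesis Y01 : forall b w, 0 <= Y b w <= 1.
Hypothesis G01 : forall b, 0 < b -> 0 <= G b <= 1.
Hypothesis G_le : forall b b', 0 < b -> b <= b' -> G b <= G b'.
Hypothesis cell : forall a b, 0 <= a -> 0 < b -> a <= b ->
  (\int[P]_w (if a <= z w < b then Y b w else 0)%:E =
   (G b)%:E * \int[P]_w (if a <= z w < b then 1 else 0 : R)%:E)%E.
Hypothesis G_cvg : forall (t : R) (b : nat -> R), 0 < t -> (forall m, t < b m) ->
  b m @[m --> \oo] --> t -> G (b m) @[m --> \oo] --> G t.
Hypothesis Y_cvg : forall w (b : nat -> R), (forall m, z w < b m) ->
  b m @[m --> \oo] --> z w -> Y (b m) w @[m --> \oo] --> Yl w.

Let grid (m : nat) (t : R) : R := (Num.truncn (2 ^+ m * t)).+1%:R / 2 ^+ m.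
Let Gpos (t : R) : R := if 0 < t then G t else 0.

Let two_gt0 m : 0 < (2 : R) ^+ m.
Proof. by rewrite exprn_gt0. Qed.

Let grid_gt0 m t : 0 < grid m t.
Proof. by rewrite divr_gt0. Qed.

Let grid_gt m t : t < grid m t.
Proof. by rewrite ltr_pdivlMr// mulrC truncnS_gt. Qed.

Let grid_le m t : 0 <= t -> grid m t <= t + 2^-1 ^+ m.
Proof.
move=> t0; rewrite ler_pdivrMr// mulrDl exprVn mulVf ?gt_eqF// -natr1 lerD2r mulrC.
by rewrite truncn_le mulr_ge0// ltW.
Qed.

Let grid_cvg t : 0 <= t -> grid m t @[m --> \oo] --> t.
Proof.
move=> t0; apply: (@squeeze_cvgr _ _ _ _ (cst t) (fun m => t + 2^-1 ^+ m)).
- by apply: nearW => m; rewrite ltW//= grid_le.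
- exact: cvg_cst.
- rewrite -[X in _ --> X]addr0; apply: cvgD; first exact: cvg_cst.
  by apply: cvg_expr; rewrite gtr0_norm ?invr_gt0// invf_lt1// ltr1n.
Qed.

Let mgrid m : measurable_fun setT (fun w => grid m (z w)).
Proof.
apply: (measurableT_comp (f := grid m)) => //.
apply: nondecreasing_measurable => // t t' tt'; rewrite ler_pM2r ?invr_gt0// ler_nat ltnS.
by apply: le_truncn; rewrite ler_pM2l.
Qed.

Let Gpos01 t : 0 <= Gpos t <= 1.
Proof. by rewrite /Gpos; case: ifP => [/G01//|_]; rewrite lexx ler01. Qed.

Let mGpos : measurable_fun setT Gpos.
Proof.
apply: nondecreasing_measurable => // t t' tt'; rewrite /Gpos.
case: ifPn => [t0|_]; first by rewrite (lt_le_trans t0 tt'); exact: G_le.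
by have /andP[] := Gpos01 t'.
Qed.

Let mGz (b : Omega -> R) : measurable_fun setT b -> measurable_fun setT (fun w => Gpos (b w)).
Proof. by move=> mb; apply: (measurableT_comp mGpos mb). Qed.

Let tail (a : R) : set Omega := [set w | a <= z w].

Let mle a b : measurable [set w | a <= z w < b].
Proof.
rewrite -[X in measurable X]setTI.
apply: (measurable_and (f := fun w => a <= z w) (g := fun w => z w < b)) => //.
  by apply: measurable_fun_ler => //; exact: measurable_cst.
by apply: measurable_fun_ltr => //; exact: measurable_cst.
Qed.

(** On a dyadic cell the grid point is constant and [cell] applies. The left ends are cut at [a],
    which may lie between grid points. *)
Let grid_tail m a : (\int[P]_(w in tail a) (Y (grid m (z w)) w)%:E =
  \int[P]_(w in tail a) (Gpos (grid m (z w)))%:E)%E.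
Proof.
pose lo (k : nat) := Num.max a (k%:R / 2 ^+ m).
pose hi (k : nat) : R := k.+1%:R / 2 ^+ m.
pose F k := [set w | lo k <= z w < hi k].
have trE k w : k%:R / 2 ^+ m <= z w < hi k = (Num.truncn (2 ^+ m * z w) == k).
  by rewrite truncn_eq ?mulr_ge0 ?(ltW (two_gt0 m))// ler_pdivrMr// ltr_pdivlMr// [z w * _]mulrC.
have FE k w : F k w -> grid m (z w) = hi k.
  rewrite /F/= ge_max => /andP[/andP[_ h1] h2].
  have : k%:R / 2 ^+ m <= z w < hi k by rewrite h1.
  by rewrite trE /grid => /eqP ->.
have tailE : tail a = \bigcup_k F k.
  apply/seteqP; split => w /=; last by move=> [k _]; rewrite /F/= ge_max => /andP[/andP[]].
  move=> az; exists (Num.truncn (2 ^+ m * z w)) => //; rewrite /F/= ge_max.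
  by rewrite (az : is_true (_ <= _))/= trE.
have mF k : measurable (F k) by exact: mle.
have trF : trivIset setT F.
  apply/trivIsetP => i j _ _ ij; apply/seteqP; split => w //= [].
  rewrite /F/= !ge_max -!andbA !trE => /andP[_ /eqP ->] /andP[_ /eqP ijE].
  by move: ij; rewrite ijE eqxx.
rewrite tailE !ge0_integral_bigcup//; last 4 first.
- apply/measurable_EFinP; apply: measurable_funTS; exact: mGz.
- by move=> w _; rewrite lee_fin; have /andP[] := Gpos01 (grid m (z w)).
- apply/measurable_EFinP; apply: measurable_funTS; exact: mY.
- by move=> w _; rewrite lee_fin; have /andP[] := Y01 (grid m (z w)) w.
apply: eq_eseriesr => k _.
have hi0 : 0 < hi k by rewrite divr_gt0.
transitivity (\int[P]_(w in F k) (Y (hi k) w)%:E)%E.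
  by apply: eq_integral => w; rewrite inE => /FE ->.
transitivity (\int[P]_(w in F k) (G (hi k))%:E)%E; last first.
  by apply: eq_integral => w; rewrite inE => /FE ->; rewrite /Gpos hi0.
(* A dyadic cell lying below [a] is empty after the cut. *)
have [lohi|hilo] := leP (lo k) (hi k); last first.
  rewrite (_ : F k = set0) ?integral_set0//; apply/seteqP; split => w //= /andP[h1 h2].
  by move: hilo; rewrite ltNge (le_trans h1)// ltW.
have lo0 : 0 <= lo k by rewrite le_max divr_ge0 ?orbT// ltW.
have := cell lo0 hi0 lohi; rewrite !integral_if => ->.
by rewrite !integral_EFin_cst// mul1e.
Qed.

Let mYl : measurable_fun setT Yl.
Proof.
apply: (measurable_fun_cvg (h := fun m w => Y (grid m (z w)) w)) => [m|w _]; first exact: mY.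
by apply: Y_cvg => //; exact: grid_cvg.
Qed.

Let Yl01 w : 0 <= Yl w <= 1.
Proof.
have cv : Y (grid m (z w)) w @[m --> \oo] --> Yl w by apply: Y_cvg => //; exact: grid_cvg.
apply/andP; split.
  by apply: (cvgr_to_ge cv); apply: nearW => m; have /andP[] := Y01 (grid m (z w)) w.
by apply: (cvgr_to_le cv); apply: nearW => m; have /andP[] := Y01 (grid m (z w)) w.
Qed.

Let mtail a : measurable (tail a).
Proof.
rewrite -[X in measurable X]setTI.
by apply: (measurable_fun_ler (measurable_cst a) mz).
Qed.

Let tail_eq a : (\int[P]_(w in tail a) (Yl w)%:E = \int[P]_(w in tail a) (Gpos (z w))%:E)%E.
Proof.
have c1 : (\int[P]_(w in tail a) (Y (grid m (z w)) w)%:E @[m --> \oo] -->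
    \int[P]_(w in tail a) (Yl w)%:E)%E.
  apply: (@bounded_cvg_integral _ _ _ _ _ (fun m w => Y (grid m (z w)) w)) => //.
  - by move=> m; exact: mY.
  - by apply: aeW => w; apply: Y_cvg => //; exact: grid_cvg.
have c2 : (\int[P]_(w in tail a) (Gpos (grid m (z w)))%:E @[m --> \oo] -->
    \int[P]_(w in tail a) (Gpos (z w))%:E)%E.
  apply: (@bounded_cvg_integral _ _ _ _ _ (fun m w => Gpos (grid m (z w)))) => //.
  - by move=> m; exact: mGz.
  - exact: mGz.
  - apply: filterS ae_z_gt0 => w zw0; rewrite /Gpos zw0.
    under eq_fun do rewrite grid_gt0.
    by apply: G_cvg => //; exact: grid_cvg.
apply: cvg_unique c1 _ => //=.
rewrite (_ : (fun m => _) = fun m => \int[P]_(w in tail a) (Gpos (grid m (z w)))%:E)%E//.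
by apply/funext => m; exact: grid_tail.
Qed.

(** As functions of [B] both sides are finite measures, and they agree on the half-lines [[a, +oo[],
    a pi-system generating the Borel sets. *)
Lemma integral_discretized (B : set R) : measurable B ->
  (\int[P]_(w in z @^-1` B) (Yl w)%:E =
   \int[P]_(w in z @^-1` B) (if 0 < z w then G (z w) else 0)%:E)%E.
Proof.
move=> mB.
have Yl0 w : 0 <= Yl w by have /andP[] := Yl01 w.
have G0 w : 0 <= Gpos (z w) by have /andP[] := Gpos01 (z w).
have [m1 m1E] := @weighted_law_exists R _ _ _ (measurableTypeR R) P z Yl mz mYl Yl0.
have [m2 m2E] := @weighted_law_exists R _ _ _ (measurableTypeR R) P z _ mz (mGz mz) G0.
rewrite -m1E -m2E.
apply: (@measure_unique _ R (measurableTypeR R) (@RGenCInfty.G R)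
  (fun k => `[- k%:R, +oo[%classic)) => //.
- exact: RGenCInfty.measurableE.
- move=> _ _ [a ->] [b ->]; exists (Num.max a b); apply/seteqP; split => t /=.
    by rewrite !in_itv/= !andbT ge_max => -[-> ->].
  by rewrite !in_itv/= !andbT ge_max => /andP[].
- by move=> k; exists (- k%:R).
- apply/seteqP; split => // t _; exists (Num.truncn `|t|).+1 => //=.
  rewrite in_itv/= andbT lerNl (le_trans (ler_norm _))// normrN ltW//.
  exact: truncnS_gt.
- move=> _ [a ->]; rewrite m1E m2E (_ : z @^-1` _ = tail a); first exact: tail_eq.
  by apply/seteqP; split => w /=; rewrite in_itv/= andbT.
- move=> k; rewrite m1E.
  have mT : measurable (z @^-1` `[- k%:R, +oo[).
    by rewrite -[X in measurable X]setTI; exact: mz.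
  apply: (@le_lt_trans _ _ (\int[P]_w (Yl w)%:E)%E).
    apply: ge0_subset_integral => //; first exact/measurable_EFinP.
    by move=> w _; rewrite lee_fin.
  by have /andP[_ h] := integral_unit_fin P mYl Yl01; rewrite (le_lt_trans h)// ltry.
Qed.

End discretize.

(** * Independence of near and far points in the model *)

(** A divergent sum makes the product 0, the value of [expNE] at [+oo]. *)
Lemma iprod_expR {R : realType} (s : R) (a : nat -> R) : 0 < s -> (forall i, 0 <= a i) ->
  iprod (fun i => expR (- s * a i)) = expNE s (\sum_(i <oo) (a i)%:E)%E.
Proof.
move=> s0 a0.
have prodE M : \prod_(i < M) expR (- s * a i) = expR (- s * \sum_(i < M) a i).
  by rewrite -expR_sum mulr_sumr.
have cv : (\sum_(i < M) a i)%:E @[M --> \oo] --> (\sum_(i <oo) (a i)%:E)%E.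
  rewrite (_ : (fun M => _) = (fun M => \sum_(0 <= i < M) (a i)%:E)%E); last first.
    by apply/funext => M; rewrite big_mkord sumEFin.
  by apply: is_cvg_nneseries => i _ _; rewrite lee_fin.
have S0 : (0 <= \sum_(i <oo) (a i)%:E)%E by apply: nneseries_ge0 => i _ _; rewrite lee_fin.
rewrite /iprod; under eq_fun do rewrite prodE.
move: cv S0; case: (\sum_(i <oo) (a i)%:E)%E => [r cv _|cv _|_] /=; last by rewrite leeNy_eq.
- apply/cvg_lim => //; apply: (@continuous_cvg _ _ _ _ _ _ (fun z => expR z)).
    exact: continuous_expR.
  by apply: cvgMr; move/fine_cvgP : cv => [_].
- apply/cvg_lim => //; apply/cvgrPdist_lt => e e0.
  (* A partial sum beyond [1 - ln e / s] makes the product at most [e * exp(-s)], which is below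
     [e]. *)
  move/cvgeyPge : cv => /(_ (1 - ln e / s)) [N _ HN]; exists N => // n /= /HN.
  rewrite lee_fin => h; rewrite sub0r normrN gtr0_norm ?expR_gt0//.
  rewrite -[ltRHS](lnK e0) ltr_expR mulNr ltrNl.
  have : - ln e < s * (1 - ln e / s).
    by rewrite mulrBr mulr1 mulrCA divff ?gt_eqF// mulr1; lra.
  by move/lt_le_trans; apply; rewrite ler_pM2l.
Qed.

(** An infinite count, [None], is not below any [n]. *)
Definition below (n : nat) (o : option nat) : bool :=
  if o is Some k then (k < n)%N else false.

Section model.
Context {R : realType} {d : measure_display} {Omega : measurableType d}
  (P : probability Omega R) (lam alpha phi : R) (x0 : R * R)
  (f : R -> R) (X : nat -> Omega -> R * R) (H : nat -> Omega -> R)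
  (mu : probability R R) (hb s : R).
Hypothesis lam0 : 0 < lam.
Hypothesis alpha2 : 2 < alpha.
Hypothesis phi0 : 0 < phi.
Hypothesis phi2 : phi <= 2 * pi.
Hypothesis PPP : is_homogeneous_PPP P lam X.
Hypothesis H0 : forall i w, 0 <= H i w.
Hypothesis iid : iid_marks_indep P f X H.
Hypothesis muE : forall B, measurable B -> mu B = (Rintegral (@lebesgue_measure R) B f)%:E.
Hypothesis mu_neg : mu [set h | h < 0] = 0%E.
Let dl := 2 / alpha.
Hypothesis hbE : (\int[mu]_h (if 0 <= h then h `^ dl else 0)%:E = hb%:E)%E.
Hypothesis hb0 : 0 < hb.
Hypothesis s0 : 0 < s.

Let Z i w := (X i w, H i w).
Let zf := zof x0 alpha.
Let sec := sector_of x0 phi.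
Let gn := gain x0 alpha.
Let ex := exponent alpha phi hb s.
(** [lam * V a] is the mean number of values [z_i] below [a]. *)
Let V a := phi / 2 * a `^ dl * hb.

Let mX i : measurable_fun setT (X i).
Proof. by have [] := PPP. Qed.

Let mH i : measurable_fun setT (H i).
Proof. by have [] := iid. Qed.

Let mZ i : measurable_fun setT (Z i).
Proof. exact: measurable_fun_pair. Qed.

Definition level_test (a : R) i w : bool := sec (Z i w) && (zf (Z i w) < a%:E)%E.
Definition count_below (a : R) w : option nat := total_count (level_test a ^~ w).
Definition far_factor (b : R) i w : R :=
  if sec (Z i w) && (b%:E <= zf (Z i w))%E then expR (- s * gn (Z i w)) else 1.
Definition far_prod (b : R) w : R := iprod (far_factor b ^~ w).
Definition law_far (b : R) : R := expR (- lam * ex b).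

Let gn_ge0 i w : 0 <= gn (Z i w).
Proof. by rewrite /gn /gain/= mulr_ge0// invr_ge0 powR_ge0. Qed.

Let zf_ge0 i w : (0 <= zf (Z i w))%E.
Proof.
rewrite /zf zofE/=; case: ifP => _; first exact: leey.
by rewrite lee_fin mulr_ge0 ?powR_ge0// invr_ge0.
Qed.

Let msec : measurable_fun setT (fun z => sec z).
Proof. exact: measurable_sector_of. Qed.

Let mzf : measurable_fun setT zf.
Proof. exact: measurable_zof. Qed.

Let mgn : measurable_fun setT gn.
Proof. exact: measurable_gain. Qed.

Let expR_unit (g : R) : 0 <= g -> 0 <= expR (- s * g) <= 1.
Proof. by move=> g0; rewrite expR_ge0/= -expR0 ler_expR mulNr oppr_le0 mulr_ge0// ltW. Qed.

Lemma far_factor_unit b i w : 0 <= far_factor b i w <= 1.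
Proof. by rewrite /far_factor; case: ifP => _; [exact: expR_unit|rewrite ler01 lexx]. Qed.

Lemma far_prod_unit b w : 0 <= far_prod b w <= 1.
Proof. by apply: iprod_unit => i; exact: far_factor_unit. Qed.

Lemma measurable_far_prod (b : Omega -> R) : measurable_fun setT b ->
  measurable_fun setT (fun w => far_prod (b w) w).
Proof.
move=> mb; apply: (measurable_iprod (f := fun i w => far_factor (b w) i w)); last first.
  by move=> i w; exact: far_factor_unit.
move=> i; apply: measurable_fun_ifT => //.
  apply: measurable_and; first exact: (measurableT_comp msec (mZ i)).
  apply: measurable_leeb; first exact/measurable_EFinP.
  exact: (measurableT_comp mzf (mZ i)).
apply: measurableT_comp => //; apply: measurable_funM => //.
exact: (measurableT_comp mgn (mZ i)).
Qed.

Lemma measurable_level_test a i : measurable_fun setT (level_test a i).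
Proof.
apply: measurable_and; first exact: (measurableT_comp msec (mZ i)).
apply: measurable_lteb; last exact: measurable_cst.
exact: (measurableT_comp mzf (mZ i)).
Qed.

Lemma measurable_count_below a k : measurable [set w | count_below a w = Some k].
Proof.
by apply: (@measurable_total_count R _ _ (level_test a)) => i; exact: measurable_level_test.
Qed.

(** One evaluation serves three laws: the weights [(c, e)] equal to [(1 - th, 0)], [(0, 1)] and
    [(1 - th, 1)] give the count below [a], the far product, and the two jointly. As [a <= b] the
    two regions are disjoint, which keeps the factor in [[0, 1]]. *)
Lemma mixed_pgfl (a b c e : R) : 0 <= a -> 0 < b -> a <= b -> 0 <= c <= 1 -> 0 <= e <= 1 ->
  (\int[P]_w (iprod (fun i => 1 - (c * ztest x0 alpha phi a (Z i w) +
       e * far_term x0 alpha phi s b (Z i w))))%:E =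
   (expR (- lam * (c * V a + e * ex b)))%:E)%E.
Proof.
move=> a0 b0 ab /andP[c0 c1] /andP[e0 e1].
pose v z := 1 - (c * ztest x0 alpha phi a z + e * far_term x0 alpha phi s b z).
have ft0 z : 0 <= far_term x0 alpha phi s b z by exact: far_term_ge0.
have ft1 z : far_term x0 alpha phi s b z <= 1.
  by rewrite /far_term; case: ifP => // _; rewrite gerBl expR_ge0.
have v01 z : 0 <= v z <= 1.
  apply/andP; split; last by rewrite gerBl addr_ge0// mulr_ge0// ztest_ge0.
  rewrite subr_ge0 /ztest; case: ifPn => [/andP[_ za]|_].
    rewrite /far_term ifF ?mulr0 ?addr0 ?mulr1//.
    by apply/negP => /andP[_]; rewrite leNgt (lt_le_trans za)// lee_fin.
  by rewrite mulr0 add0r mulr_ile1.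
have mzt : measurable_fun setT (ztest x0 alpha phi a) by exact: measurable_ztest.
have mft : measurable_fun setT (far_term x0 alpha phi s b) by exact: measurable_far_term.
have mv : measurable_fun setT v.
  by apply: measurable_funB => //; apply: measurable_funD; apply: measurable_funM.
have I : (\int[(plane R \x mu)%E]_z (1 - v z)%:E = (c * V a + e * ex b)%:E)%E.
  transitivity (\int[(plane R \x mu)%E]_z (c%:E * (ztest x0 alpha phi a z)%:E +
      e%:E * (far_term x0 alpha phi s b z)%:E))%E.
    by apply: eq_integral => z _; rewrite -!EFinM -EFinD /v; congr EFin; ring.
  have E1 : (\int[(plane R \x mu)%E]_z (ztest x0 alpha phi a z)%:E = (V a)%:E)%E.
    exact: integral_ztest.
  have E2 : (\int[(plane R \x mu)%E]_z (far_term x0 alpha phi s b z)%:E = (ex b)%:E)%E.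
    exact: integral_far_term.
  rewrite ge0_integralD//; last 4 first.
  - by move=> z _; rewrite -EFinM lee_fin mulr_ge0// ztest_ge0.
  - by apply: emeasurable_funM => //; apply/measurable_EFinP; exact: mzt.
  - by move=> z _; rewrite -EFinM lee_fin mulr_ge0.
  - by apply: emeasurable_funM => //; apply/measurable_EFinP; exact: mft.
  rewrite ge0_integralZl ?lee_fin//; last 2 first.
  - by apply/measurable_EFinP; exact: mzt.
  - by move=> z _; rewrite lee_fin ztest_ge0.
  rewrite ge0_integralZl ?lee_fin//; last 2 first.
  - by apply/measurable_EFinP; exact: mft.
  - by move=> z _; rewrite lee_fin.
  by rewrite E1 E2.
have := marked_pgfl iid muE (ltW lam0) PPP mv v01.
by rewrite I ltry => /(_ isT) ->.
Qed.

Let level_factorE (th a : R) i w : (if level_test a i w then th else 1) =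
  1 - ((1 - th) * ztest x0 alpha phi a (Z i w)).
Proof. by rewrite /level_test /ztest -/zf -/sec; case: ifP => _; ring. Qed.

Let far_factorE b i w : far_factor b i w = 1 - far_term x0 alpha phi s b (Z i w).
Proof. by rewrite /far_factor /far_term -/zf -/sec -/gn; case: ifP => _; ring. Qed.

Lemma level_pgf th a : 0 <= a -> 0 <= th < 1 ->
  (\int[P]_w (oapp (fun k => th ^+ k) 0 (count_below a w))%:E =
   (expR (- lam * ((1 - th) * V a)))%:E)%E.
Proof.
move=> a0 th01; have /andP[t0 t1] := th01.
have c01 : 0 <= 1 - th <= 1 by apply/andP; split; lra.
have e01 : 0 <= (0 : R) <= 1 by apply/andP; split.
(* Any positive level above [a] will do, since the far term has weight 0 here. *)
have a1 : 0 < a + 1 by rewrite ltr_wpDl.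
have aa1 : a <= a + 1 by rewrite lerDl.
have := mixed_pgfl a0 a1 aa1 c01 e01; rewrite mul0r addr0 => <-.
apply: eq_integral => w _; rewrite -iprod_count//; congr ((iprod _)%:E).
by apply/funext => i; rewrite level_factorE mul0r addr0.
Qed.

Lemma far_mean b : 0 < b -> (\int[P]_w (far_prod b w)%:E = (law_far b)%:E)%E.
Proof.
move=> b0; have c01 : 0 <= (0 : R) <= 1 by apply/andP; split.
have e01 : 0 <= (1 : R) <= 1 by apply/andP; split.
have := mixed_pgfl (lexx 0) b0 (ltW b0) c01 e01; rewrite mul0r add0r mul1r => <-.
apply: eq_integral => w _; congr ((iprod _)%:E).
by apply/funext => i; rewrite far_factorE mul0r add0r mul1r.
Qed.

Lemma joint_pgf th a b : 0 <= a -> 0 < b -> a <= b -> 0 <= th < 1 ->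
  (\int[P]_w (oapp (fun k => th ^+ k) 0 (count_below a w) * far_prod b w)%:E =
   (law_far b)%:E * \int[P]_w (oapp (fun k => th ^+ k) 0 (count_below a w))%:E)%E.
Proof.
move=> a0 b0 ab th01; have /andP[t0 t1] := th01.
have c01 : 0 <= 1 - th <= 1 by apply/andP; split; lra.
have e01 : 0 <= (1 : R) <= 1 by apply/andP; split.
rewrite level_pgf// -EFinM /law_far -expRD.
have -> : - lam * ex b + - lam * ((1 - th) * V a) = - lam * ((1 - th) * V a + 1 * ex b) by ring.
rewrite -mixed_pgfl//; apply: eq_integral => w _.
rewrite -iprod_count// /far_prod -iprodM; last 2 first.
- by move=> i; case: ifP => _; rewrite ?ler01 ?lexx// t0 ltW.
- by move=> i; exact: far_factor_unit.
congr ((iprod _)%:E); apply/funext => i.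
rewrite level_factorE far_factorE mul1r /ztest /far_term.
case: (sector_of x0 phi (Z i w)) => /=; last by ring.
have [bz|zb] := leP b%:E (zof x0 alpha (Z i w)).
  by rewrite ltNge (le_trans _ bz) ?lee_fin//=; ring.
by case: ifP => _; ring.
Qed.

Lemma law_far_unit b : 0 < b -> 0 <= law_far b <= 1.
Proof.
move=> b0; rewrite -!lee_fin -far_mean//.
have := integral_unit_fin P (measurable_far_prod (measurable_cst b)) (far_prod_unit b).
by [].
Qed.

(** [pgf_determines] takes a count in [nat]: infinite counts are sent to 0 in [K] and removed by the
    weight [fin], so the two series compared have weights [fin * far_prod b] and [fin]. *)
Lemma count_far_indep a b k : 0 <= a -> 0 < b -> a <= b ->
  (\int[P]_w (if count_below a w == Some k then far_prod b w else 0)%:E =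
   (law_far b)%:E * \int[P]_w (if count_below a w == Some k then 1 else 0 : R)%:E)%E.
Proof.
move=> a0 b0 ab.
pose K w := odflt 0 (count_below a w).
pose fin w : R := if count_below a w is Some _ then 1 else 0.
have mK j : measurable [set w | count_below a w = Some j] by exact: measurable_count_below.
have mN : measurable [set w | count_below a w = None].
  rewrite (_ : [set w | _] = ~` \bigcup_j [set w | count_below a w = Some j]).
    by apply: measurableC; apply: bigcup_measurable.
  apply/seteqP; split => w /=; first by move=> wN [j _ /=]; rewrite wN.
  by case E : (count_below a w) => [j|//] h; exfalso; apply: h; exists j.
have mKk j : measurable [set w | K w = j].
  case: j => [|j]; last first.
    rewrite (_ : [set w | _] = [set w | count_below a w = Some j.+1])//.
    by apply/seteqP; split => w; rewrite /K/=; case: (count_below a w) => //= i; [move=> ->|case].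
  rewrite (_ : [set w | _] = [set w | count_below a w = Some 0] `|` [set w | count_below a w = None]).
    exact: measurableU.
  apply/seteqP; split => w; rewrite /K/=.
    by case: (count_below a w) => [i /= ->|_]; [left|right].
  by case=> ->.
have mfin : measurable_fun setT fin.
  rewrite (_ : fin = \1_(~` [set w | count_below a w = None])).
    by apply: measurable_indic; exact: measurableC.
  apply/funext => w; rewrite /fin indicE; case E : (count_below a w) => [j|].
    by rewrite mem_set//= E.
  by rewrite memNset//=; exact.
have fin01 w : 0 <= fin w <= 1 by rewrite /fin; case: count_below => [?|]; rewrite ?lexx ler01.
have mfar : measurable_fun setT (far_prod b) by exact: (measurable_far_prod (measurable_cst b)).
have mY : measurable_fun setT (fun w => fin w * far_prod b w) by exact: measurable_funM.
have Y01 w : 0 <= fin w * far_prod b w <= 1.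
  have /andP[h1 h2] := fin01 w; have /andP[h3 h4] := far_prod_unit b w.
  by rewrite mulr_ge0//= mulr_ile1.
have hyp th : 0 < th < 1 -> (\int[P]_w (th ^+ K w * (fin w * far_prod b w))%:E =
    (law_far b)%:E * \int[P]_w (th ^+ K w * fin w)%:E)%E.
  move=> /andP[t0 t1]; have th01 : 0 <= th < 1 by rewrite ltW.
  have E w : th ^+ K w * fin w = oapp (fun k => th ^+ k) 0 (count_below a w).
    by rewrite /K /fin; case: (count_below a w) => [i|] /=; rewrite ?mulr1 ?mulr0.
  under eq_integral => w _ do rewrite mulrA E.
  under [in RHS]eq_integral => w _ do rewrite E.
  exact: joint_pgf.
have Kk (Y : Omega -> R) w : (if count_below a w == Some k then Y w else 0) =
    (if K w == k then fin w * Y w else 0).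
  rewrite /K /fin; case: (count_below a w) => [i|] /=; first by rewrite mul1r.
  by rewrite mul0r; case: ifP.
under eq_integral => w _ do rewrite Kk.
under [in RHS]eq_integral => w _ do rewrite (Kk (fun=> 1)) mulr1.
exact: (pgf_determines mKk mY mfin Y01 fin01 hyp (law_far_unit b0)).
Qed.

(** * The n-th smallest value *)

Variable n : nat.
Hypothesis n1 : (1 <= n)%N.
Let zn w := z_order X H x0 alpha phi n w.
(** The weak test of [z_order], whereas the counts use the strict [level_test]; [reached_not_below]
    and [not_below_reached] pass between the two. *)
Let le_test (t : R) w i : bool := sec (Z i w) && (zf (Z i w) <= t%:E)%E.
Let S w : set R := [set t | (n%:R%:E <= @count_series R (le_test t w))%E].

Let znE w : zn w = inf (S w).
Proof. by []. Qed.

Lemma reached_ge0 w t : S w t -> 0 <= t.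
Proof.
move=> /le_count_seriesP[M nM]; rewrite leNgt; apply/negP => t0.
have : (n <= 0)%N.
  rewrite (leq_trans nM)// /partial_count big1// => i _; rewrite /le_test.
  by rewrite leNgt (lt_le_trans _ (zf_ge0 i w)) ?lte_fin// andbF.
by rewrite leqNgt n1.
Qed.

Let S_lb w : has_lbound (S w).
Proof. by exists 0 => t; exact: reached_ge0. Qed.

Lemma not_belowE a w : ~~ below n (count_below a w) <->
  (n%:R%:E <= @count_series R (level_test a ^~ w))%E.
Proof. by rewrite le_count_series. Qed.

Lemma reached_not_below w t a : S w t -> t < a -> ~~ below n (count_below a w).
Proof.
move=> /le_count_seriesP[M nM] ta; apply/not_belowE/le_count_seriesP; exists M.
rewrite (leq_trans nM)// /partial_count; apply: leq_sum => i _.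
rewrite /le_test /level_test; case: (sec _) => //=.
by case: (leP _ t%:E) => // h; rewrite (le_lt_trans h)// lte_fin.
Qed.

(** Finitely many points already witness the count [n], and finitely many values below [a] have a
    common bound [t < a]; this turns the strict test at [a] into the weak one at [t]. *)
Lemma not_below_reached w a : ~~ below n (count_below a w) -> exists2 t, S w t & t < a.
Proof.
move=> /not_belowE/le_count_seriesP[M nM].
have [t ta ht] : exists2 t, t < a & forall i, (i < M)%N ->
    (zf (Z i w) < a%:E)%E -> (zf (Z i w) <= t%:E)%E.
  elim: (M) => [|M' [t ta ht]]; first by exists (a - 1) => //; rewrite gtrBl.
  have [h|h] := ltP (zf (Z M' w)) a%:E; last first.
    exists t => // i; rewrite ltnS leq_eqVlt => /predU1P[->|]; last exact: ht.
    by rewrite ltNge h.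
  have hf : zf (Z M' w) = (fine (zf (Z M' w)))%:E.
    by rewrite fineK// ge0_fin_numE ?zf_ge0// (lt_trans h)// ltry.
  exists (Num.max t (fine (zf (Z M' w)))).
    by rewrite gt_max ta -lte_fin -hf.
  move=> i; rewrite ltnS leq_eqVlt => /predU1P[->|iM] hi.
    by rewrite {1}hf lee_fin le_max lexx orbT.
  by rewrite (le_trans (ht i iM hi))// lee_fin le_max lexx.
exists t => //; apply/le_count_seriesP; exists M.
rewrite (leq_trans nM)// /partial_count; apply: leq_sum => i _.
rewrite /le_test /level_test; case: (sec _) => //=.
by case: ltP => // h; rewrite ht.
Qed.

(** For empty [S w] the infimum would take its default value 0 and lie below every positive [a]
    although no level is reached. *)
Lemma order_stat_lt w a : S w !=set0 -> (zn w < a) = ~~ below n (count_below a w).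
Proof.
move=> Sw; apply/idP/idP.
  by rewrite znE => /(inf_lt Sw)[t St ta]; exact: reached_not_below St ta.
move=> /not_below_reached[t St ta]; rewrite znE (le_lt_trans _ ta)//.
by apply: ge_inf.
Qed.

Lemma order_stat_ge0 w : 0 <= zn w.
Proof.
rewrite znE; have [->|/set0P Sw] := eqVneq (S w) set0; first by rewrite inf0.
by apply: lb_le_inf => // t; exact: reached_ge0.
Qed.

Lemma reachedP w : S w !=set0 <-> exists k : nat, ~~ below n (count_below k%:R w).
Proof.
split=> [[t St]|[k /not_below_reached[t St _]]]; last by exists t.
exists (Num.truncn t).+1; apply: (reached_not_below St); exact: truncnS_gt.
Qed.

Lemma measurable_below a : measurable [set w | below n (count_below a w)].
Proof.
rewrite (_ : [set w | _] = \bigcup_(k in [set k | (k < n)%N]) [set w | count_below a w = Some k]).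
  by apply: bigcup_measurable => k _; exact: measurable_count_below.
apply/seteqP; split => w /=; rewrite /below; last by move=> [k /= kn ->].
by case E : (count_below a w) => [k|//] kn; exists k.
Qed.

Let mbelow a : measurable_fun setT (fun w => below n (count_below a w)).
Proof.
apply: (@measurable_fun_bool _ _ _ _ true); rewrite setTI.
exact: measurable_below.
Qed.

Let half_unit a w : 0 <= oapp (fun k => (2^-1 : R) ^+ k) 0 (count_below a w) <= 1.
Proof.
case: (count_below a w) => [k|] /=; last by rewrite lexx ler01.
by rewrite exprn_ge0 ?invr_ge0//= exprn_ile1 ?invr_ge0// invf_le1// ler1n.
Qed.

Let mhalf a : measurable_fun setT (fun w => oapp (fun k => (2^-1 : R) ^+ k) 0 (count_below a w)).
Proof.
rewrite (_ : (fun w => _) = fun w => iprod (fun i => if level_test a i w then 2^-1 else 1)).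
  apply: (measurable_iprod (f := fun i w => if level_test a i w then 2^-1 else 1)).
    by move=> i; apply: measurable_fun_ifT => //; exact: measurable_level_test.
  move=> i w; case: ifP => _; rewrite ?ler01 ?lexx//.
  by rewrite invr_ge0 ler0n/= invf_le1// ler1n.
by apply/funext => w; rewrite iprod_count// invr_ge0 ler0n/= invf_lt1// ltr1n.
Qed.

Let half_mean a : 0 <= a ->
  (\int[P]_w (oapp (fun k => (2^-1 : R) ^+ k) 0 (count_below a w))%:E =
   (expR (- (lam / 2 * V a)))%:E)%E.
Proof.
move=> a0; rewrite level_pgf//; last by rewrite invr_ge0 ler0n/= invf_lt1// ltr1n.
by congr ((expR _)%:E); field.
Qed.

(* Markov's inequality for [2^-N], where [N] counts the [z_i] below [a]. *)
Lemma below_small a : 0 <= a ->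
  fine (P [set w | below n (count_below a w)]) * expR (lam / 2 * V a) <= 2 ^+ n.
Proof.
move=> a0; have mb := measurable_below a.
have Pfin : P [set w | below n (count_below a w)] \is a fin_num by exact: fin_num_measure.
have h : (((2^-1) ^+ n)%:E * P [set w | below n (count_below a w)] <=
    (expR (- (lam / 2 * V a)))%:E)%E.
  rewrite -half_mean// -integral_EFin_cst// -integral_if.
  apply: ge0_le_integral => //.
  - by move=> w _; rewrite lee_fin; case: ifP => // _; rewrite exprn_ge0// invr_ge0.
  - by apply/measurable_EFinP; apply: measurable_fun_ifT.
  - by apply/measurable_EFinP; exact: mhalf.
  - move=> w _; rewrite lee_fin; case: ifPn => [|_]; last by have /andP[] := half_unit a w.
    rewrite /below; case: (count_below a w) => [k|//] /= kn.
    by rewrite ler_wiXn2l ?invr_ge0// ?invf_le1 ?ler1n// ltnW.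
move: h; rewrite -(fineK Pfin) -EFinM lee_fin expRN exprVn => h.
rewrite -ler_pdivlMr ?expR_gt0// -ler_pdivrMl ?exprn_gt0//.
Qed.

(** With [N] the number of [z_i] below [a], the event forces [N >= 1] because [n >= 1], so
    [2^-N <= 1/2] there. Hence half its probability is at most [1 - E 2^-N = 1 - exp(- lam V / 2) <=
    lam V / 2]. *)
Lemma not_below_small a : 0 <= a ->
  fine (P [set w | ~~ below n (count_below a w)]) <= lam * V a.
Proof.
move=> a0; set A := [set w | _].
have mA : measurable A.
  rewrite (_ : A = ~` [set w | below n (count_below a w)]).
    by apply: measurableC; exact: measurable_below.
  by apply/seteqP; split => w /= /negP.
have Pfin : P A \is a fin_num by exact: fin_num_measure.
have h : ((2^-1)%:E * P A + (expR (- (lam / 2 * V a)))%:E <= 1)%E.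
  rewrite -half_mean// -integral_EFin_cst// -integral_if -ge0_integralD//; last 4 first.
  - by move=> w _; rewrite lee_fin; case: ifP.
  - apply/measurable_EFinP; apply: measurable_fun_ifT => //.
    by apply: measurable_neg; exact: mbelow.
  - by move=> w _; rewrite lee_fin; have /andP[] := half_unit a w.
  - by apply/measurable_EFinP; exact: mhalf.
  rewrite -(integral_probability1 P); apply: ge0_le_integral => //.
  - move=> w _; rewrite -EFinD lee_fin addr_ge0//; first by case: ifP.
    by have /andP[] := half_unit a w.
  - apply: emeasurable_funD; apply/measurable_EFinP; last exact: mhalf.
    by apply: measurable_fun_ifT => //; apply: measurable_neg; exact: mbelow.
  - move=> w _; rewrite -EFinD lee_fin; case: ifPn => [|_]; last first.
      by rewrite add0r; have /andP[] := half_unit a w.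
    rewrite /below; case: (count_below a w) => [k|] /=.
      rewrite -leqNgt => nk; have k1 : (1 <= k)%N by exact: leq_trans nk.
      have : (2^-1 : R) ^+ k <= 2^-1 ^+ 1.
        by rewrite ler_wiXn2l ?invr_ge0// invf_le1// ler1n.
      by rewrite expr1; lra.
    by rewrite addr0 => _; rewrite invf_le1// ler1n.
move: h; rewrite -(fineK Pfin) -EFinM -EFinD lee_fin.
have := expR_ge1Dx (- (lam / 2 * V a)); lra.
Qed.

Let ccoef := phi / 2 * hb.

Let ccoef0 : 0 < ccoef.
Proof. by rewrite mulr_gt0// divr_gt0. Qed.

Let dl0 : 0 < dl.
Proof. by rewrite divr_gt0//; have h := alpha2; lra. Qed.

Let VE a : V a = ccoef * a `^ dl.
Proof. by rewrite /V /ccoef; ring. Qed.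

Let powK (A : R) : 0 <= A -> (A `^ dl^-1) `^ dl = A.
Proof. by move=> A0; rewrite -powRrM mulVf ?powRr1// gt_eqF. Qed.

Lemma ae_reached : {ae P, forall w, S w !=set0}.
Proof.
pose N := \bigcap_k [set w | below n (count_below k%:R w)].
have mN : measurable N by apply: bigcap_measurable => // k _; exact: measurable_below.
exists N; split => //; last first.
  move=> w /= /reachedP/forallNP h k _ /=; have := h k.
  by move/negP; rewrite negbK.
have Pfin : P N \is a fin_num by exact: fin_num_measure.
apply/eqP; rewrite -(fineK Pfin) eqe eq_le fine_ge0// andbT leNgt; apply/negP => p0.
set p := fine (P N) in p0.
(* Chosen so that [lam / 2 * V k >= 2^n / p] at an integer [k] above [A^(1/dl)]. Together with
   [1 + x <= e^x], [below_small] would then give [p + 2^n <= 2^n]. *)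
pose A := 2 ^+ n / p / (lam / 2 * ccoef).
have l2 : 0 < lam / 2 by rewrite divr_gt0.
have A0 : 0 <= A by rewrite !divr_ge0 ?mulr_ge0 ?exprn_ge0// ltW.
pose k := (Num.truncn (A `^ dl^-1)).+1.
have pk : p <= fine (P [set w | below n (count_below k%:R w)]).
  apply: fine_le => //; first by apply: fin_num_measure; exact: measurable_below.
  apply: le_measure; rewrite ?inE//; first exact: measurable_below.
  by move=> w; apply.
have hV : 2 ^+ n / p <= lam / 2 * V k%:R.
  rewrite VE mulrA -ler_pdivrMl ?mulr_gt0// mulrC -/A -[leLHS](powK A0).
  apply: ge0_ler_powR; rewrite ?nnegrE ?powR_ge0 ?(ltW dl0)//.
  exact: (ltW (truncnS_gt _)).
have := below_small (ler0n R k).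
have h1 : 1 + 2 ^+ n / p <= expR (lam / 2 * V k%:R).
  by rewrite (le_trans _ (expR_ge1Dx _))// lerD2l.
have : p * (1 + 2 ^+ n / p) = p + 2 ^+ n by field; rewrite gt_eqF.
have h2 : p * (1 + 2 ^+ n / p) <= fine (P [set w | below n (count_below k%:R w)]) * expR (lam / 2 * V k%:R).
  by apply: ler_pM => //; [exact: ltW|rewrite addr_ge0// divr_ge0 ?exprn_ge0// ltW].
by move: h2; lra.
Qed.

Lemma ae_order_stat_gt0 : {ae P, forall w, 0 < zn w}.
Proof.
pose N := \bigcap_k [set w | ~~ below n (count_below (k.+1%:R)^-1 w)].
have mnb a : measurable [set w | ~~ below n (count_below a w)].
  rewrite (_ : [set w | _] = ~` [set w | below n (count_below a w)]).
    by apply: measurableC; exact: measurable_below.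
  by apply/seteqP; split => w /= /negP.
have mN : measurable N by apply: bigcap_measurable => // k _; exact: mnb.
have PN : P N = 0%E.
  have Pfin : P N \is a fin_num by exact: fin_num_measure.
  apply/eqP; rewrite -(fineK Pfin) eqe eq_le fine_ge0// andbT leNgt; apply/negP => p0.
  set p := fine (P N) in p0.
  (* At a level [1 / (k + 1)] below [A^(1/dl)] the bound of [not_below_small] is at most [p / 2],
     while the event has probability at least [p]. *)
  pose A := p / 2 / (lam * ccoef).
  have A0 : 0 < A by rewrite !divr_gt0// mulr_gt0.
  pose k := Num.truncn (A `^ dl^-1)^-1.
  have pk : p <= fine (P [set w | ~~ below n (count_below (k.+1%:R)^-1 w)]).
    apply: fine_le => //; first by apply: fin_num_measure.
    by apply: le_measure; rewrite ?inE// => w; apply.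
  have hV : lam * V (k.+1%:R)^-1 <= p / 2.
    rewrite VE mulrA -ler_pdivlMl ?mulr_gt0// mulrC -/A -[leRHS](powK (ltW A0)).
    apply: ge0_ler_powR; rewrite ?nnegrE ?powR_ge0 ?(ltW dl0) ?invr_ge0//.
    rewrite -[leRHS]invrK lef_pV2 ?posrE ?invr_gt0 ?powR_gt0//.
    exact: (ltW (truncnS_gt _)).
  have i0 : 0 <= (k.+1%:R)^-1 :> R by rewrite invr_ge0.
  by have := not_below_small i0; lra.
apply: filterS2 ae_reached (_ : {ae P, forall w, ~ N w}) => [w Sw Nw|].
  rewrite lt0r order_stat_ge0 andbT; apply/eqP => z0; apply: Nw => k _ /=.
  by rewrite -order_stat_lt// z0 invr_gt0.
by exists N; split => // w /= /contrapT.
Qed.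

(* If fewer than [n] points are ever reached, [S w] is empty and [zn w] is the
   junk value [inf set0 = 0]. *)
Lemma measurable_order_stat : measurable_fun setT zn.
Proof.
apply: (measurability _ (RGenCInfty.measurableE R)) => // _ [_ [a ->] <-]; rewrite setTI.
have [a0|a0] := leP a 0.
  rewrite (_ : zn @^-1` _ = setT)//; apply/seteqP; split => // w _ /=.
  by rewrite in_itv/= andbT (le_trans a0)// order_stat_ge0.
rewrite (_ : zn @^-1` _ = [set w | below n (count_below a w)] `&`
    \bigcup_(k : nat) ~` [set w | below n (count_below k%:R w)]).
  apply: measurableI; first exact: measurable_below.
  by apply: bigcup_measurable => k _; apply: measurableC; exact: measurable_below.
apply/seteqP; split => w /=.
  rewrite in_itv/= andbT => az.
  have Sw : S w !=set0.
    apply/set0P/eqP => S0; move: az; rewrite znE S0 inf0 leNgt a0//.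
  split; first by move: az; rewrite leNgt order_stat_lt// negbK.
  by move/reachedP : Sw => [k /negP hk]; exists k.
move=> [ab [k _ /= /negP hk]]; rewrite in_itv/= andbT leNgt order_stat_lt ?ab//.
by apply/reachedP; exists k.
Qed.

(** * Independence on cells and the conditional Laplace transform *)

Let integral_belowE a (Y : Omega -> R) : measurable_fun setT Y -> (forall w, 0 <= Y w) ->
  (\int[P]_w (if below n (count_below a w) then Y w else 0)%:E =
   \sum_(k < n) \int[P]_w (if count_below a w == Some (k : nat) then Y w else 0)%:E)%E.
Proof.
move=> mY Y0; rewrite -ge0_integral_sum//; last 2 first.
- move=> k; apply/measurable_EFinP; apply: measurable_fun_ifT => //.
  apply: (@measurable_fun_bool _ _ _ _ true); rewrite setTI.
  rewrite (_ : _ @^-1` _ = [set w | count_below a w = Some (k : nat)]).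
    exact: measurable_count_below.
  by apply/seteqP; split => w /= /eqP.
- by move=> k w _; rewrite lee_fin; case: ifP.
apply: eq_integral => w _; rewrite sumEFin; congr EFin; rewrite /below.
case: (count_below a w) => [j|]; last by rewrite big1.
case: ifPn => [jn|]; last first.
  rewrite -leqNgt => nj; rewrite big1// => k _; case: ifP => // /eqP[jk].
  by move: nj; rewrite jk leqNgt ltn_ord.
rewrite (bigD1 (Ordinal jn))//= eqxx big1 ?addr0// => k kj; case: ifP => // /eqP[jk].
by move: kj; rewrite -val_eqE/= jk eqxx.
Qed.

Let mfar b : measurable_fun setT (far_prod b).
Proof. exact: (measurable_far_prod (measurable_cst b)). Qed.

Let far_ge0 b w : 0 <= far_prod b w.
Proof. by have /andP[] := far_prod_unit b w. Qed.

Lemma below_far a b : 0 <= a -> 0 < b -> a <= b ->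
  (\int[P]_w (if below n (count_below a w) then far_prod b w else 0)%:E =
   (law_far b)%:E * \int[P]_w (if below n (count_below a w) then 1 else 0 : R)%:E)%E.
Proof.
move=> a0 b0 ab; rewrite (integral_belowE a (mfar b))// (integral_belowE a (Y := cst 1))//.
rewrite ge0_sume_distrr; last first.
  by move=> k _; apply: integral_ge0 => w _; rewrite lee_fin; case: ifP.
by apply: eq_bigr => k _; exact: count_far_indep.
Qed.

Let mcell a b : measurable_fun setT (fun w => a <= zn w < b).
Proof.
have mz := measurable_order_stat.
apply: measurable_and.
  by apply: measurable_fun_ler => //; exact: measurable_cst.
by apply: measurable_fun_ltr => //; exact: measurable_cst.
Qed.

Let integral_cell a b (Y : Omega -> R) : a <= b -> measurable_fun setT Y ->
  (forall w, 0 <= Y w) ->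
  (\int[P]_w (if below n (count_below a w) then Y w else 0)%:E =
   \int[P]_w (if a <= zn w < b then Y w else 0)%:E +
   \int[P]_w (if below n (count_below b w) then Y w else 0)%:E)%E.
Proof.
move=> ab mY Y0; rewrite -ge0_integralD//; last 4 first.
- by move=> w _; rewrite lee_fin; case: ifP.
- by apply/measurable_EFinP; apply: measurable_fun_ifT.
- by move=> w _; rewrite lee_fin; case: ifP.
- by apply/measurable_EFinP; apply: measurable_fun_ifT.
apply: ae_eq_integral => //.
- by apply/measurable_EFinP; apply: measurable_fun_ifT.
- by apply: emeasurable_funD; apply/measurable_EFinP; apply: measurable_fun_ifT.
(* Once [S w] is nonempty, being below [n] at level [c] is [c <= zn w], and the event at [a] splits
   at [b]. *)
apply: filterS ae_reached => w Sw _; rewrite -EFinD; congr EFin.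
have E c : below n (count_below c w) = (c <= zn w) by rewrite leNgt order_stat_lt// negbK.
rewrite !E; have [bz|zb] := leP b (zn w); first by rewrite (le_trans ab)// andbF add0r.
by rewrite andbT addr0.
Qed.

Let cancel_common (g : R) (x u v : \bar R) : x \is a fin_num -> u \is a fin_num ->
  v \is a fin_num -> (x + g%:E * v = g%:E * (u + v) -> x = g%:E * u)%E.
Proof.
case: x u v => [x| |] [u| |] [v| |] // _ _ _.
move=> h; have [{}h] : (x + g * v)%:E = (g * (u + v))%:E by exact: h.
have -> : x = g * u by apply: (addIr (g * v)); rewrite h mulrDr.
by [].
Qed.

(** Subtracts [below_far] at level [b] from [below_far] at level [a], both with the same
    [far_prod b]. The finiteness facts license the cancellation in the extended reals. *)
Lemma cell_far a b : 0 <= a -> 0 < b -> a <= b ->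
  (\int[P]_w (if a <= zn w < b then far_prod b w else 0)%:E =
   (law_far b)%:E * \int[P]_w (if a <= zn w < b then 1 else 0 : R)%:E)%E.
Proof.
move=> a0 b0 ab.
have := below_far a0 b0 ab; have := below_far (ltW b0) b0 (lexx b).
rewrite (integral_cell ab (mfar b))// (integral_cell (Y := cst 1) ab)//= => ->.
have fin (q : Omega -> bool) (Y : Omega -> R) : measurable_fun setT q ->
    measurable_fun setT Y -> (forall w, 0 <= Y w <= 1) ->
    (\int[P]_w (if q w then Y w else 0)%:E)%E \is a fin_num.
  move=> mq mY Y01; have mg : measurable_fun setT (fun w => if q w then Y w else 0).
    by apply: measurable_fun_ifT.
  have g01 w : 0 <= (if q w then Y w else 0) <= 1 by case: ifP; rewrite ?lexx ?ler01.
  have /andP[h1 h2] := integral_unit_fin P mg g01.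
  by rewrite ge0_fin_numE// (le_lt_trans h2)// ltry.
have u01 (w : Omega) : 0 <= (cst 1 w : R) <= 1 by rewrite ler01 lexx.
have f1 := fin _ _ (mcell a b) (mfar b) (far_prod_unit b).
have f2 := fin _ (cst 1) (mcell a b) (measurable_cst _) u01.
have f3 := fin _ (cst 1) (mbelow b) (measurable_cst _) u01.
exact: cancel_common f1 f2 f3.
Qed.

(** Each factor is eventually constant: a point with [z_i > zn w] is eventually at or above [b m],
    and any other point never is. All factors dominate their limits, so the limit passes through the
    product. *)
Lemma cvg_far_prod w (b : nat -> R) : (forall m, zn w < b m) -> b m @[m --> \oo] --> zn w ->
  far_prod (b m) w @[m --> \oo] --> expNE s (interf X H x0 alpha phi n w).
Proof.
move=> zb bz.
pose v i := if sec (Z i w) && ((zn w)%:E < zf (Z i w))%E then expR (- s * gn (Z i w)) else 1.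
have <- : iprod v = expNE s (interf X H x0 alpha phi n w).
  pose a i := if sec (Z i w) && ((zn w)%:E < zf (Z i w))%E then gn (Z i w) else 0.
  rewrite (_ : interf _ _ _ _ _ _ _ = \sum_(i <oo) (a i)%:E)%E; last first.
    by apply: eq_eseriesr => i _; rewrite /a; case: ifP.
  rewrite -iprod_expR//; last by move=> i; rewrite /a; case: ifP.
  by congr iprod; apply/funext => i; rewrite /v /a; case: ifP => // _; rewrite mulr0 expR0.
have vv m i : v i <= far_factor (b m) i w.
  rewrite /far_factor; case: ifPn => [/andP[si bi]|_].
    by rewrite /v si (lt_le_trans _ bi) ?lte_fin.
  by rewrite /v; case: ifP => // _; have /andP[] := expR_unit (gn_ge0 i w).
apply: cvg_iprod_above => //.
- by move=> i; rewrite /v; case: ifP => // _; exact: expR_ge0.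
- by move=> m i; have /andP[] := far_factor_unit (b m) i w.
move=> i; apply: cvg_near_cst.
have [zi|zi] := ltP (zn w)%:E (zf (Z i w)).
  have : \forall m \near \oo, ((b m)%:E <= zf (Z i w))%E.
    have := zf_ge0 i w; case E : (zf (Z i w)) zi => [r| |]//; last first.
      by move=> _ _; near=> m; exact: leey.
    rewrite lte_fin => zr _; near=> m; rewrite lee_fin ltW//.
    by near: m; exact: (cvgr_lt _ bz).
  by apply: filterS => m h; rewrite /far_factor /v zi h.
apply: nearW => m; rewrite /far_factor /v ltNge zi /= andbF.
by rewrite leNgt (le_lt_trans zi) ?lte_fin// andbF.
Unshelve. all: by end_near.
Qed.

Let exE b b' : 0 < b -> b <= b' ->
  0 <= ex b - ex b' <= phi / 2 * (b' `^ dl - b `^ dl) * hb.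
Proof. exact: (exponent_lip x0 alpha2 phi0 phi2 s0 mu_neg hbE). Qed.

Lemma law_far_le b b' : 0 < b -> b <= b' -> law_far b <= law_far b'.
Proof.
move=> b0 bb'; rewrite ler_expR !mulNr lerN2 ler_pM2l// -subr_ge0.
by have /andP[] := exE b0 bb'.
Qed.

Lemma cvg_law_far (t : R) (b : nat -> R) : 0 < t -> (forall m, t < b m) ->
  b m @[m --> \oo] --> t -> law_far (b m) @[m --> \oo] --> law_far t.
Proof.
move=> t0 tb bt.
have cpow : b m `^ dl @[m --> \oo] --> t `^ dl.
  have powE r : 0 < r -> r `^ dl = expR (dl * ln r) by move=> r0; rewrite /powR gt_eqF.
  rewrite powE// (_ : (fun m => _) = fun m => expR (dl * ln (b m))); last first.
    by apply/funext => m; rewrite powE// (lt_trans t0).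
  apply: (@continuous_cvg _ _ _ _ _ _ (fun r : R => expR r)); first exact: continuous_expR.
  by apply: cvgMr; apply: (@continuous_cvg _ _ _ _ _ _ (fun r : R => ln r)) => //; exact: continuous_ln.
have cex : ex (b m) @[m --> \oo] --> ex t.
  apply: (@squeeze_cvgr _ _ _ _ (fun m => ex t - phi / 2 * (b m `^ dl - t `^ dl) * hb) (cst (ex t))).
  - apply: nearW => m; have /andP[h1 h2] := exE t0 (ltW (tb m)).
    by apply/andP; split; rewrite ?lerBlDr -?lerBlDl// /= -subr_ge0.
  - rewrite -[X in _ --> X]subr0; apply: cvgB; first exact: cvg_cst.
    rewrite -[X in _ --> X](mul0r hb); apply: cvgMl.
    rewrite -[X in _ --> X](mulr0 (phi / 2)); apply: cvgMr.
    by rewrite -[X in _ --> X](subrr (t `^ dl)); apply: cvgB => //; exact: cvg_cst.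
  - exact: cvg_cst.
apply: (@continuous_cvg _ _ _ _ _ _ (fun r : R => expR r)); first exact: continuous_expR.
exact: cvgMr.
Qed.

Lemma conditional_laplace (B : set R) : measurable B ->
  (\int[P]_(w in [set w | B (zn w)]) (expNE s (interf X H x0 alpha phi n w))%:E =
   \int[P]_(w in [set w | B (zn w)]) (expR (phi * lam / alpha * hb * q_fun alpha (zn w) s))%:E)%E.
Proof.
move=> mB; have mz := measurable_order_stat.
have mD : measurable [set w | B (zn w)] by rewrite -[X in measurable X]setTI; exact: mz.
rewrite (integral_discretized mz order_stat_ge0 ae_order_stat_gt0 measurable_far_prod
  far_prod_unit law_far_unit law_far_le cell_far cvg_law_far cvg_far_prod mB).
have lawE w : law_far (zn w) = expR (phi * lam / alpha * hb * q_fun alpha (zn w) s).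
  by congr expR; rewrite /ex /exponent; ring.
have mpos : measurable_fun setT (fun t : R => if 0 < t then law_far t else 0).
  apply: nondecreasing_measurable => // t t' tt'.
  case: ifPn => [t0|_]; first by rewrite (lt_le_trans t0 tt'); exact: law_far_le.
  by case: ifP => // _; exact: expR_ge0.
have mposz : measurable_fun setT (fun w => if 0 < zn w then law_far (zn w) else 0).
  exact: (measurableT_comp mpos mz).
apply: ae_eq_integral => //.
- by apply/measurable_EFinP; exact: measurable_funTS.
- apply/measurable_EFinP; apply: measurable_funTS.
  (* Monotonicity of [law_far] is known for positive arguments only; as [zn] is nonnegative, the
     rest is the single value [law_far 0]. *)
  rewrite (_ : (fun w => _) = fun w => if 0 < zn w then (if 0 < zn w then law_far (zn w) else 0)
      else law_far 0); last first.
    apply/funext => w; rewrite -lawE; have [z0|z0] := ltP 0 (zn w); first by [].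
    have -> : zn w = 0 by apply/eqP; rewrite eq_le order_stat_ge0 andbT.
    by [].
  apply: measurable_fun_ifT => //.
  by apply: measurable_fun_ltr => //; exact: measurable_cst.
- by apply: filterS ae_order_stat_gt0 => w z0 _; rewrite z0 lawE.
Qed.

End model.

(** The right-hand integrand is a function of [z_n], so equality of the integrals over every event
    [z_n in B] is the defining property of the conditional expectation given [z_n]. *)
Theorem theorem2 (R : realType) (d : measure_display) (Omega : measurableType d)
  (P : probability Omega R) (lam alpha phi : R) (x : R * R)
  (f : R -> R) (X : nat -> Omega -> R * R) (H : nat -> Omega -> R) :
  0 < lam -> 2 < alpha -> 0 < phi -> phi <= 2 * pi ->
  is_homogeneous_PPP P lam X ->
  (forall t, 0 <= f t) -> measurable_fun setT f ->
  (\int[@lebesgue_measure R]_(t in setT) (f t)%:E = 1)%E ->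
  (forall i w, 0 <= H i w) ->
  iid_marks_indep P f X H ->
  (\int[@lebesgue_measure R]_(t in [set t : R | (0 <= t)%R]) (t `^ (2 / alpha) * f t)%:E
     < +oo)%E ->
  let hbar := fine (\int[@lebesgue_measure R]_(t in [set t : R | (0 <= t)%R])
                      (t `^ (2 / alpha) * f t)%:E) in
  forall (n : nat) (s : R), (1 <= n)%N -> 0 < s ->
  forall B : set R, measurable B ->
    (\int[P]_(w in [set w | B (z_order X H x alpha phi n w)])
        (expNE s (interf X H x alpha phi n w))%:E =
     \int[P]_(w in [set w | B (z_order X H x alpha phi n w)])
        (expR (phi * lam / alpha * hbar *
               q_fun alpha (z_order X H x alpha phi n w) s))%:E)%E.
Proof.
move=> lam0 alpha2 phi0 phi2 PPP f0 mf f1 H0 iid hfin hbar n s n1 s0 B mB.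
have [mu [muP muE]] := mark_law_exists iid.
have mneg : measurable [set h : R | h < 0].
  by rewrite (_ : [set h : R | h < 0] = `]-oo, 0[%classic)//; apply/seteqP; split => t /=; rewrite in_itv.
have mu_neg : mu [set h | h < 0] = 0%E.
  rewrite muP// (_ : _ @^-1` _ = set0) ?measure0//.
  by apply/seteqP; split => w //=; rewrite ltNge H0.
pose g (h : R) : R := if 0 <= h then h `^ (2 / alpha) else 0.
have mg : measurable_fun setT g.
  apply: measurable_fun_ifT => //.
  by apply: measurable_fun_ler => //; exact: measurable_cst.
have g0 h : 0 <= g h by rewrite /g; case: ifP => // _; exact: powR_ge0.
have hbE : (\int[mu]_h (g h)%:E = hbar%:E)%E.
  rewrite (mark_integral f0 mf f1 muE mg g0) /hbar fineK; last first.
    rewrite ge0_fin_numE//; apply: integral_ge0 => t _.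
    by rewrite lee_fin mulr_ge0// powR_ge0.
  refine (etrans _ (@integral_if R _ (measurableTypeR R) lebesgue_measure
    (fun t : R => 0 <= t) (fun t => t `^ (2 / alpha) * f t))).
  apply: eq_integral => t _.
  by rewrite /g; case: ifP => // _; rewrite mul0r.
(* If the mean were 0 the marks would vanish almost surely, whereas a law with a density gives no
   mass to 0. Positivity makes the mean measure of the [z_i] unbounded, so that an [n]-th value
   exists almost surely. *)
have hb0 : 0 < hbar.
  have hb_ge0 : 0 <= hbar.
    by rewrite -lee_fin -hbE; apply: integral_ge0 => h _; rewrite lee_fin.
  rewrite lt_neqAle hb_ge0 andbT eq_sym; apply/eqP => hb_eq0.
  have mu0 : mu [set 0] = 0%E.
    by rewrite muE// Rintegral_set1.
  have : (\int[mu]_h `|(g h)%:E| = 0)%E.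
    by under eq_integral => h _ do rewrite gee0_abs ?lee_fin//; rewrite hbE hb_eq0.
  have mgE : measurable_fun setT (fun h => (g h)%:E) by exact/measurable_EFinP.
  move/(ae_eq_integral_abs mu measurableT mgE) => h.
  have : mu setT = 0%E.
    have [N [mN N0 sN]] := h.
    rewrite (_ : setT = [set 0] `|` [set h | h < 0] `|` N); last first.
      apply/seteqP; split => // t _.
      have [t0|t0|->] := ltgtP t 0; [by left; right| |by left; left].
      right; apply: sN => /= /(_ I) [] /eqP; rewrite /g (ltW t0).
      by rewrite powR_eq0 gt_eqF.
    have m0 : measurable ([set 0] `|` [set h : R | h < 0]) by exact: measurableU.
    exact: etrans (measureU0 m0 mN N0) (etrans (measureU0 (measurable_set1 0) mneg mu_neg) mu0).
  by move/eqP; rewrite probability_setT onee_eq0.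
exact: (conditional_laplace x lam0 alpha2 phi0 phi2 PPP H0 iid muE mu_neg hbE hb0 s0 n1 mB).
Qed.
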